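(* Let $n\ge1$. For $1\le i,s\le n$ and $1\le j\le n-s$ consider the elements of the $A_{\mathbb{Q}}$-algebra $H^*_G(B_GS^1)^{\otimes n}=A_{\mathbb{Q}}[u_i,\alpha_i]_{1\le i\le n}/(x\alpha_i=0,\ \alpha_i^2=\alpha_i)$ given by $$\alpha=\sigma_1(\alpha_1,\dots,\alpha_n)=\sum_{1\le m\le n}\alpha_m,\qquad c_i=\sigma_i(u_1,\dots,u_n)=\sum_{m_*\in K_i}u_{m_1}\cdots u_{m_i},$$ $$\gamma_{s,j}=\sum_{(m_*,l_* )\in K_{s,j}}u_{m_1}\cdots u_{m_s}\alpha_{l_1}\cdots\alpha_{l_j},$$ where $K_i$ consists of the sequences $1\le m_1<\cdots<m_i\le n$, $K_{s,j}\subseteq K_s\times K_j$ consists of the pairs with $\{m_*\}\cap\{l_*\}=\emptyset$, and $\sigma_i$ is the $i$-th elementary symmetric polynomial. Then $$H^*_G(B_GU(n))=\frac{A_{\mathbb{Q}}[\alpha,c_i,\gamma_{s,j}]}{(x\alpha=0,\ x\gamma_{s,j}=0,\ S)},$$ where the finite set $S$ of relations consists of three types of relations: Type I: $$\alpha^{n+1}=\sum_{m=1}^n r_m\alpha^m,$$ where $r_1=(-1)^n n!$ and $$r_{m+1}=(-1)^{n+m}n!\sum_{1\le i_1<\cdots<i_m\le n}\frac{1}{i_1\cdots i_m}.$$ This relation can also be written as $\alpha(\alpha-1)\cdots(\alpha-n)=0$. Type II: $$\alpha^s\gamma_{s,i}=\frac{s!}{(s+i)!}\,c_s\alpha^{s+i}+\cdots,$$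 where $\cdots$ denotes a homogeneous polynomial smaller than $c_s\alpha^{s+i}$. Type III: if $s\le t\le s+i$, $$\gamma_{s,i}\gamma_{t,j}=\binom{\min(i+j+s,n)-t}{j}\,c_t\,\gamma_{s,\min(i+j,n-s)}+\cdots,$$ where $\cdots$ denotes a homogeneous polynomial smaller than $c_t\gamma_{s,\min(i+j,n-s)}$. The polynomials $\cdots$ can be algorithmically computed in terms of $\alpha,c_i,\gamma_{s,j}$. The elements $c_i$ are algebraically independent and $H^*_G(B_GU(n))$ is finite over $A_{\mathbb{Q}}[c_1,\dots,c_n]$, hence has Krull dimension $n$. A basis of $H^*_G(B_GU(n))$ over $A_{\mathbb{Q}}$ consists of the elements $$\alpha^a\prod_{i=1}^n c_i^{k_i}\prod_{s=1}^n\prod_{i=1}^{n-s}\gamma_{s,i}^{\epsilon_{s,i}},$$ where $0\le a\le n$ and $\epsilon_{s,i}=0,1$ are such that for any $\gamma_{s,i}$ appearing in the product we must have $a<s$, and for any two factors $\gamma_{s,i},\gamma_{t,j}$ with $s\le t$ we must have $s+i<t$.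
   Context: $G=C_2$. $A_{\mathbb{Q}}$ is the rational Burnside Green functor: $A_{\mathbb{Q}}(G/G)=\mathbb{Q}[x]/(x^2-2x)$ with $x=\mathrm{Tr}(1)$, $A_{\mathbb{Q}}(G/e)=\mathbb{Q}$, restriction $x\mapsto 2$; $y=1-x/2$. For a $G$-space $X$, $H^*_G(X)$ is the integer-graded unreduced Bredon cohomology $H^*_G(X)(G/H)=[X_+,\Sigma^*HA_{\mathbb{Q}}]^H$; here it denotes its top level $H^*_G(X)(G/G)$, a graded algebra over $A_{\mathbb{Q}}(G/G)$ (also written $A_{\mathbb{Q}}$). By Greenlees–May there is a natural ring isomorphism $H^*_G(X)(G/G)\cong H^*(X;\mathbb{Q})^{C_2}\times H^*(X^{C_2};\mathbb{Q})$ under which $x=(2,0)$, $y=(0,1)$ and restriction is projection to the first factor. Tensor products are over $A_{\mathbb{Q}}$. $B_GU(n)$ is the classifying space of $C_2$-equivariant complex $n$-plane bundles (Grassmannian of complex $n$-dimensional subspaces of $\mathbb{C}^{\infty\rho}$, $\rho=1+\sigma$), and $B_GS^1=B_GU(1)$. $H^*_G(B_GU(n))$ is identified with $(H^*_G(B_GS^1)^{\otimes n})^{\Sigma_n}$ through the isomorphism induced by the maximal torus inclusion. $H^*_G(B_GS^1)=A_{\mathbb{Q}}[\alpha,u]/(\alpha^2-\alpha,x\alpha)$ with $|\alpha|=0$, $|u|=2$: $B_GU(1)^{C_2}$ has two components, $+$ (lines with trivial action) and $-$ (sign action), each a $\mathbb{C}P^\infty$; $\alpha$ is $0$ in $H^0(BU(1);\mathbb{Q})$,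 $1$ on the $+$ component and $0$ on the $-$ component; $u$ is the nonequivariant first Chern class in $H^2(BU(1);\mathbb{Q})$ and on each fixed component. $\alpha_i,u_i$ are the pullbacks along the $i$-th projection of $B_GU(1)^n$, and $\Sigma_n$ acts by $\tau u_i=u_{\tau(i)}$, $\tau\alpha_i=\alpha_{\tau(i)}$. In every $\gamma_{s,i}$ it is implicit that $s,i>0$ and $s+i\le n$. Order: let $R=\mathbb{Q}[u_1,\dots,u_n,\alpha_1,\dots,\alpha_n]/(\alpha_i^2-\alpha_i)$ with $|u_i|=1$, $|\alpha_i|=0$; rational polynomials in $\alpha,c_i,\gamma_{s,j}$ are viewed as elements of $R^{\Sigma_n}$ by the formulas in the claim. Monic monomials $u_1^{a_1}\cdots u_n^{a_n}\alpha_1^{\epsilon_1}\cdots\alpha_n^{\epsilon_n}$ ($\epsilon_i\in\{0,1\}$) of the same degree are ordered lexicographically by $(a_1,\dots,a_n,\epsilon_1,\dots,\epsilon_n)$. The dominant term of a homogeneous element is the greatest monic monomial occurring in it with nonzero coefficient; homogeneous elements are compared via their dominant terms, ignoring coefficients. The algorithm: put $\gamma_{s,0}=c_s$ and $\gamma_{0,i}=\sigma_i(\alpha_1,\dots,\alpha_n)=\alpha(\alpha-1)\cdots(\alpha-i+1)/i!$ in $R^{\Sigma_n}$; the dominant term of a homogeneous element of $R^{\Sigma_n}$ is the dominant term of an explicit product of elements $\gamma_{s,i}$ ($s,i\ge0$), one subtracts the corresponding multiple of that product, and repeats.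
   Formalization: All signs of r_m in Type I are flipped (printed ones fail at n=1); the Type III coefficient is multiplied by binom(j, max(0,s+i+j-n)) (printed one fails for n=3, γ_{1,1}γ_{1,2}); ''basis'' means direct sum of cyclic modules, annihilator 0 for monomials in the c_i and (x) otherwise. *)

(* Defs.v *)
From HB Require Import structures.
From mathcomp Require Import all_boot all_order all_fingroup all_algebra.
From mathcomp Require Import ssrcomplements mpoly.
From Stdlib Require Import ClassicalEpsilon.

Set Implicit Arguments.
Unset Strict Implicit.
Unset Printing Implicit Defensive.

Import GRing.Theory.
Local Open Scope ring_scope.

Definition in_ideal (R : comNzRingType) (s : seq R) (p : R) : Prop :=
  exists a : nat -> R, p = \sum_(i < size s) a i * s`_i.

Definition prime_ideal (R : comNzRingType) (I : R -> Prop) : Prop :=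
  [/\ I 0, forall a b, I a -> I b -> I (a + b), forall a b, I b -> I (a * b),
      ~ I 1 & forall a b, I (a * b) -> I a \/ I b].

Definition prime_chain (R : comNzRingType) (d : nat) (I : nat -> R -> Prop) :=
  (forall k, (k <= d)%N -> prime_ideal (I k)) /\
  (forall k, (k < d)%N ->
     (forall a, I k a -> I k.+1 a) /\ (exists2 a, I k.+1 a & ~ I k a)).

Definition Krull_dimension (R : comNzRingType) (d : nat) : Prop :=
  (exists I : nat -> R -> Prop, prime_chain d I) /\
  (forall e (I : nat -> R -> Prop), prime_chain e I -> (e <= d)%N).

(* Evaluation of a polynomial with coefficients in A at a family of elements of
   an A-algebra. *)
Definition aeval (A : comNzRingType) (B : comAlgType A) (k : nat)
    (h : 'I_k -> B) (p : {mpoly A[k]}) : B := mmap (in_alg B) h p.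

(* B is the A-algebra generated by the h i subject to the relations rels. *)
Definition presented_by (A : comNzRingType) (B : comAlgType A) (k : nat)
    (h : 'I_k -> B) (rels : seq {mpoly A[k]}) : Prop :=
  (forall b, exists p, aeval h p = b) /\
  (forall p, aeval h p = 0 <-> in_ideal rels p).

Definition algebraically_independent (A : comNzRingType) (B : comAlgType A)
    (k : nat) (h : 'I_k -> B) : Prop := injective (aeval h).

(* B is a finitely generated module over the subalgebra A[h_1, ..., h_k]. *)
Definition finite_over_subalgebra (A : comNzRingType) (B : comAlgType A)
    (k : nat) (h : 'I_k -> B) : Prop :=
  exists gs : seq B, forall b, exists q : nat -> {mpoly A[k]},
    b = \sum_(i < size gs) aeval h (q i) * gs`_i.

Definition AQ : Type := {poly %/ ('X^2 - 2%:R *: 'X : {poly rat})}.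
HB.instance Definition _ := GRing.ComUnitAlgebra.on AQ.

Definition xA : AQ := 'qX.

Lemma xA_sqr : xA ^+ 2 = 2%:R * xA.
Proof.
have hm : 'X^2 - 2%:R *: 'X \is @monic rat.
  rewrite monicE lead_coefDl ?lead_coefXn // size_polyXn size_polyN.
  by rewrite (leq_ltn_trans (size_scale_leq _ _)) // size_polyX.
have sz : size ('X^2 - 2%:R *: 'X : {poly rat}) = 3%N.
  rewrite size_polyDl size_polyXn // size_polyN.
  by rewrite (leq_ltn_trans (size_scale_leq _ _)) // size_polyX.
have mk : mk_monic ('X^2 - 2%:R *: 'X : {poly rat}) = 'X^2 - 2%:R *: 'X.
  by rewrite /mk_monic sz hm.
apply/eqP; rewrite -subr_eq0 mulr_natl -scaler_nat; apply/eqP.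
rewrite -[xA ^+ 2](rmorphXn (in_qpoly _)) -[_ *: xA]in_qpolyZ.
rewrite -[LHS](rmorphB (in_qpoly _)) /=; apply: val_inj => /=.
by rewrite mk Pdiv.RingMonic.rmodpp.
Qed.

(* Polynomials in u_1, ..., u_n, alpha_1, ..., alpha_n, in this order. *)
Definition uI (n : nat) (i : 'I_n) : 'I_(n + n) := lshift n i.
Definition aI (n : nat) (i : 'I_n) : 'I_(n + n) := rshift n i.

Definition relsT (n : nat) : seq {mpoly AQ[n + n]} :=
  [seq xA *: 'X_(aI i) | i <- enum 'I_n] ++
  [seq 'X_(aI i) ^+ 2 - 'X_(aI i) | i <- enum 'I_n].

(* The boolean version of in_ideal (relsT n), as required by {ideal_quot _}. *)
Definition idealT (n : nat) : pred {mpoly AQ[n + n]} := fun p =>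
  if excluded_middle_informative (in_ideal (relsT n) p) then true else false.
Arguments idealT n p : clear implicits.

Lemma idealTP n p : reflect (in_ideal (relsT n) p) (idealT n p).
Proof.
by rewrite /idealT; case: excluded_middle_informative => h; constructor.
Qed.

Lemma in_idealB (R : comNzRingType) (s : seq R) p q :
  in_ideal s p -> in_ideal s q -> in_ideal s (p - q).
Proof.
move=> [a ->] [b ->]; exists (fun i => a i - b i).
by rewrite -sumrB; apply: eq_bigr => i _; rewrite mulrBl.
Qed.

Lemma in_idealM (R : comNzRingType) (s : seq R) r p :
  in_ideal s p -> in_ideal s (r * p).
Proof.
move=> [a ->]; exists (fun i => r * a i).
by rewrite mulr_sumr; apply: eq_bigr => i _; rewrite mulrA.
Qed.

Lemma in_ideal0 (R : comNzRingType) (s : seq R) : in_ideal s 0.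
Proof. by exists (fun=> 0); rewrite big1 // => i _; rewrite mul0r. Qed.

Lemma in_idealD (R : comNzRingType) (s : seq R) p q :
  in_ideal s p -> in_ideal s q -> in_ideal s (p + q).
Proof.
move=> hp hq; rewrite -[q]opprK -[- q]add0r; apply: in_idealB => //.
exact/in_idealB/hq/in_ideal0.
Qed.

Lemma in_ideal_sum (R : comNzRingType) (s : seq R) (I : Type) (r : seq I)
    (P : pred I) (F : I -> R) :
  (forall i, P i -> in_ideal s (F i)) -> in_ideal s (\sum_(i <- r | P i) F i).
Proof.
move=> h; elim/big_ind: _ => //; [exact: in_ideal0 | move=> *; exact: in_idealD].
Qed.

Lemma in_ideal_mem (R : comNzRingType) (s : seq R) p :
  p \in s -> in_ideal s p.
Proof.
move=> ps; exists (fun i => (i == index p s)%:R).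
have hi : (index p s < size s)%N by rewrite index_mem.
rewrite (bigD1 (Ordinal hi)) //= eqxx mul1r nth_index // big1 ?addr0 // => i.
by rewrite -val_eqE /= => /negbTE ->; rewrite mul0r.
Qed.

(* A ring morphism maps the ideal of s into the ideal of t as soon as it maps s
   into it. *)
Lemma in_ideal_morph (R R' : comNzRingType) (f : {rmorphism R -> R'}) s t p :
  (forall q, q \in s -> in_ideal t (f q)) -> in_ideal s p -> in_ideal t (f p).
Proof.
move=> h [a ->]; rewrite rmorph_sum; apply: in_ideal_sum => i _ /=.
rewrite rmorphM; apply: in_idealM; apply: h; exact: mem_nth.
Qed.

Lemma in_ideal_nil (R : comNzRingType) (s : seq R) p :
  (forall q, q \in s -> q = 0) -> in_ideal s p -> p = 0.
Proof.
move=> h [a ->]; rewrite big1 // => i _.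
by rewrite (h s`_i) ?mulr0 // mem_nth.
Qed.

Lemma idealT_zmod_closed n : zmod_closed (idealT n).
Proof.
split=> [|p q]; first exact/idealTP/in_ideal0.
by move=> /idealTP hp /idealTP hq; apply/idealTP/in_idealB.
Qed.

Lemma idealT_proper n : 
  1 \notin idealT n /\ (forall r, {in idealT n, forall p, r * p \in idealT n}).
Proof.
split=> [|r p /idealTP hp]; last exact/idealTP/in_idealM.
apply/negP => /idealTP h1.
have hz (q : AQ) : in_ideal [::] q -> q = 0 by apply: in_ideal_nil.
suff /hz /eqP : in_ideal [::] (meval (fun=> 0 : AQ) (1 : {mpoly AQ[n + n]})).
  by rewrite rmorph1 oner_eq0.
apply: in_ideal_morph h1 => q.
rewrite mem_cat => /orP[] /mapP[i _ ->] /=.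
  by rewrite mevalZ mevalXU mulr0; apply: in_ideal0.
by rewrite mevalB rmorphXn /= mevalXU expr0n subrr; apply: in_ideal0.
Qed.

HB.instance Definition _ n :=
  GRing.isZmodClosed.Build {mpoly AQ[n + n]} (idealT n) (idealT_zmod_closed n).
HB.instance Definition _ n :=
  isProperIdeal.Build {mpoly AQ[n + n]} (idealT n) (idealT_proper n).

Local Open Scope quotient_scope.

(* AQ[u_i, alpha_i] / (x alpha_i, alpha_i ^ 2 - alpha_i), that is the n-th tensor
   power over AQ of the top level of the cohomology of B_G S^1. *)
Definition HT (n : nat) : Type :=
  {ideal_quot (idealT n : idealr {mpoly AQ[n + n]})}.
HB.instance Definition _ n := GRing.ComNzRing.on (HT n).
HB.instance Definition _ n := NzRingQuotient.on (HT n).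

Definition piT (n : nat) : {mpoly AQ[n + n]} -> HT n := \pi_(HT n).
HB.instance Definition _ n := GRing.RMorphism.on (@piT n).

Lemma piTE n (p q : {mpoly AQ[n + n]}) :
  piT p = piT q <-> in_ideal (relsT n) (p - q).
Proof.
rewrite /piT; split=> [/eqP|h]; last apply/eqP.
  by rewrite -Quotient.idealrBE => /idealTP.
by rewrite -Quotient.idealrBE; apply/idealTP.
Qed.

Lemma piTK n (t : HT n) : piT (generic_quotient.repr t) = t.
Proof. exact: reprK. Qed.

Section AlgebraStructure.
Variable n : nat.

Definition scaleT (a : AQ) (t : HT n) : HT n := piT a%:MP * t.

Fact scaleTA a b t : scaleT a (scaleT b t) = scaleT (a * b) t.
Proof. by rewrite /scaleT mulrA -rmorphM -mpolyCM. Qed.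
Fact scale1T : left_id 1 scaleT.
Proof. by move=> t; rewrite /scaleT mpolyC1 rmorph1 mul1r. Qed.
Fact scaleTDr : right_distributive scaleT +%R.
Proof. by move=> a t t'; rewrite /scaleT mulrDr. Qed.
Fact scaleTDl t : {morph scaleT^~ t : a b / a + b}.
Proof. by move=> a b; rewrite /scaleT mpolyCD rmorphD mulrDl. Qed.
HB.instance Definition _ := GRing.Zmodule_isLmodule.Build AQ (HT n)
  scaleTA scale1T scaleTDr scaleTDl.

Fact scaleTAl (a : AQ) (t t' : HT n) : a *: (t * t') = (a *: t) * t'.
Proof. exact: mulrA. Qed.
HB.instance Definition _ := GRing.Lmodule_isLalgebra.Build AQ (HT n) scaleTAl.
HB.instance Definition _ := GRing.Lalgebra_isComAlgebra.Build AQ (HT n).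

End AlgebraStructure.

Definition act_var (n : nat) (tau : 'S_n) (k : 'I_(n + n)) : 'I_(n + n) :=
  match split k with
  | inl i => uI (tau i)
  | inr i => aI (tau i)
  end.

Definition act_mpoly (A : comNzRingType) (n : nat) (tau : 'S_n)
    (p : {mpoly A[n + n]}) : {mpoly A[n + n]} :=
  aeval (fun k => 'X_(act_var tau k)) p.

(* Well defined on classes by act_piT. *)
Definition actT (n : nat) (tau : 'S_n) (t : HT n) : HT n :=
  piT (act_mpoly tau (generic_quotient.repr t)).

Lemma act_var_u n (tau : 'S_n) i : act_var tau (uI i) = uI (tau i).
Proof. by rewrite /act_var -[uI i]/(unsplit (inl i)) unsplitK. Qed.

Lemma act_var_a n (tau : 'S_n) i : act_var tau (aI i) = aI (tau i).
Proof. by rewrite /act_var -[aI i]/(unsplit (inr i)) unsplitK. Qed.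

HB.instance Definition _ (A : comNzRingType) (B : comAlgType A) k
    (h : 'I_k -> B) := GRing.RMorphism.copy (aeval h) (mmap (in_alg B) h).
HB.instance Definition _ (A : comNzRingType) n (tau : 'S_n) :=
  GRing.RMorphism.copy (@act_mpoly A n tau)
    (aeval (fun k => 'X_(act_var tau k) : {mpoly A[n + n]})).

Lemma aevalC (A : comNzRingType) (B : comAlgType A) k (h : 'I_k -> B) c :
  aeval h c%:MP = c%:A.
Proof. exact: mmapC. Qed.

Lemma aevalX (A : comNzRingType) (B : comAlgType A) k (h : 'I_k -> B) i :
  aeval h 'X_i = h i.
Proof. by rewrite /aeval mmapX mmap1U. Qed.

Lemma aevalZ (A : comNzRingType) (B : comAlgType A) k (h : 'I_k -> B) c p :
  aeval h (c *: p) = c *: aeval h p.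
Proof. by rewrite -mul_mpolyC rmorphM /= aevalC mulr_algl. Qed.

Lemma act_mpolyX (A : comNzRingType) n (tau : 'S_n) k :
  act_mpoly tau ('X_k : {mpoly A[n + n]}) = 'X_(act_var tau k).
Proof. exact: aevalX. Qed.

Lemma act_piT n (tau : 'S_n) p : actT tau (piT p) = piT (act_mpoly tau p).
Proof.
apply/piTE; rewrite -rmorphB.
have /piTE : piT (generic_quotient.repr (piT p)) = piT p by rewrite piTK.
apply: in_ideal_morph => q.
rewrite mem_cat => /orP[] /mapP[i _ ->] /=; apply: in_ideal_mem.
  rewrite [act_mpoly _ _]aevalZ aevalX act_var_a mem_cat; apply/orP; left.
  by apply/mapP; exists (tau i); rewrite ?mem_enum.
rewrite rmorphB rmorphXn /= act_mpolyX act_var_a mem_cat; apply/orP; right.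
by apply/mapP; exists (tau i); rewrite ?mem_enum.
Qed.

Section ActionMorphism.
Variables (n : nat) (tau : 'S_n).

Fact actT_is_zmod_morphism : zmod_morphism (@actT n tau).
Proof.
move=> t t'; rewrite -[t]piTK -[t']piTK -rmorphB.
by rewrite !act_piT -rmorphB -rmorphB.
Qed.
Fact actT_is_monoid_morphism : monoid_morphism (@actT n tau).
Proof.
split=> [|t t'].
  by have := act_piT tau 1; rewrite !rmorph1.
rewrite -[t]piTK -[t']piTK -rmorphM.
by rewrite !act_piT -rmorphM -rmorphM.
Qed.
HB.instance Definition _ := GRing.isZmodMorphism.Build (HT n) (HT n)
  (@actT n tau) actT_is_zmod_morphism.
HB.instance Definition _ := GRing.isMonoidMorphism.Build (HT n) (HT n)
  (@actT n tau) actT_is_monoid_morphism.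

Lemma actTZ (a : AQ) (t : HT n) : actT tau (a *: t) = a *: actT tau t.
Proof.
rewrite -[a *: t]/(piT _ * t) rmorphM /= act_piT.
by rewrite [act_mpoly _ _]aevalC alg_mpolyC.
Qed.
End ActionMorphism.

Definition invariantT (n : nat) : pred (HT n) :=
  fun t => [forall tau : 'S_n, actT tau t == t].
Arguments invariantT n t : clear implicits.

Lemma invariantTP n t :
  reflect (forall tau : 'S_n, actT tau t = t) (t \in invariantT n).
Proof. by apply: (iffP forallP) => h tau; apply/eqP. Qed.

Lemma invariantT_subalg n : subalg_closed (invariantT n).
Proof.
split=> [|a s t /invariantTP hs /invariantTP ht|
         s t /invariantTP hs /invariantTP ht];
  apply/invariantTP => tau.
- exact: rmorph1.
- by rewrite rmorphD /= actTZ hs ht.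
- by rewrite rmorphM /= hs ht.
Qed.
HB.instance Definition _ n := GRing.isSubalgClosed.Build AQ (HT n)
  (invariantT n) (invariantT_subalg n).

(* The top level of the cohomology of B_G U(n), identified with the invariants by
   restriction to the maximal torus. *)
Record HBU (n : nat) : predArgType := MkHBU {
  HBU_val :> HT n;
  _ : HBU_val \in invariantT n
}.
HB.instance Definition _ n := [isSub for @HBU_val n].
HB.instance Definition _ n := [Choice of HBU n by <:].
HB.instance Definition _ n := [SubChoice_isSubComNzRing of HBU n by <:].
HB.instance Definition _ n := [SubZmodule_isSubLmodule of HBU n by <:].
HB.instance Definition _ n :=
  [SubNzRing_SubLmodule_isSubLalgebra of HBU n by <:].
HB.instance Definition _ n := GRing.Lalgebra_isComAlgebra.Build AQ (HBU n).

(* The indices (s, i) of the elements gamma_{s,i}. *)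
Definition gidx (n : nat) : finType :=
  {p : 'I_n.+1 * 'I_n.+1 | [&& 0 < p.1, 0 < p.2 & p.1 + p.2 <= n]%N}.
Definition gs (n : nat) (g : gidx n) : nat := (val g).1.
Definition gi (n : nat) (g : gidx n) : nat := (val g).2.

Section Elements.
Variables (B : comNzRingType) (n : nat) (u a : 'I_n -> B).

Definition alpha_elt : B := \sum_(m < n) a m.

Definition chern_elt (i : nat) : B :=
  \sum_(M : {set 'I_n} | #|M| == i) \prod_(m in M) u m.

Definition gamma_elt (s j : nat) : B :=
  \sum_(M : {set 'I_n} | #|M| == s)
    \sum_(L : {set 'I_n} | (#|L| == j) && [disjoint M & L])
      (\prod_(m in M) u m) * (\prod_(l in L) a l).

End Elements.

(* The names of the generators: alpha, then c_(i+1) for i : 'I_n, then the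
   gamma_g for g : gidx n. *)
Definition gname (n : nat) : finType := (unit + 'I_n + gidx n)%type.
Notation ngen n := #|{: gname n}|.

Definition gen_elt (B : comNzRingType) (n : nat) (u a : 'I_n -> B)
    (v : gname n) : B :=
  match v with
  | inl (inl _) => alpha_elt a
  | inl (inr i) => chern_elt u i.+1
  | inr g => gamma_elt u a (gs g) (gi g)
  end.

Lemma gen_elt_invariant (B : comNzRingType) n (u a : 'I_n -> B) (tau : 'S_n)
    (f : {rmorphism B -> B}) (v : gname n) :
  (forall i, f (u i) = u (tau i)) -> (forall i, f (a i) = a (tau i)) ->
  f (gen_elt u a v) = gen_elt u a v.
Proof.
move=> fu fa.
have bij : bijective (fun M : {set 'I_n} => tau @: M).
  exists (fun M : {set 'I_n} => tau^-1%g @: M) => M;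
    rewrite -imset_comp; apply/setP=> i; apply/imsetP/idP => /=.
  - by case=> j jM ->; rewrite permK.
  - by move=> iM; exists i; rewrite ?permK.
  - by case=> j jM ->; rewrite permKV.
  - by move=> iM; exists i; rewrite ?permKV.
have prd (h : 'I_n -> B) (M : {set 'I_n}) : (forall i, f (h i) = h (tau i)) ->
    f (\prod_(m in M) h m) = \prod_(m in tau @: M) h m.
  move=> fh; rewrite rmorph_prod big_imset /=; last by move=> ? ? _ _ /perm_inj.
  by apply: eq_bigr.
have card (M : {set 'I_n}) : #|tau @: M| = #|M| by apply/card_imset/perm_inj.
case: v => [[_|i]|g] /=.
- rewrite /alpha_elt rmorph_sum [RHS](reindex_inj (@perm_inj _ tau)) /=.
  by apply: eq_bigr.
- rewrite /chern_elt rmorph_sum [RHS](reindex _ (onW_bij _ bij)) /=.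
  by apply: eq_big => [M|M _]; rewrite ?card // prd.
- rewrite /gamma_elt rmorph_sum [RHS](reindex _ (onW_bij _ bij)) /=.
  apply: eq_big => [M|M _]; rewrite ?card //.
  rewrite rmorph_sum [RHS](reindex _ (onW_bij _ bij)) /=.
  apply: eq_big => [L|L _]; last by rewrite rmorphM /= !prd.
  rewrite card; congr (_ && _).
  by rewrite -!setI_eq0 -imsetI ?imset_eq0 // => ? ? _ _ /perm_inj.
Qed.

Definition uT (n : nat) (i : 'I_n) : HT n := piT 'X_(uI i).
Definition aT (n : nat) (i : 'I_n) : HT n := piT 'X_(aI i).

Lemma gen_eltT_invariant n (v : gname n) :
  gen_elt (@uT n) (@aT n) v \in invariantT n.
Proof.
apply/invariantTP => tau.
by apply: gen_elt_invariant => i;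
  rewrite [LHS]act_piT act_mpolyX (act_var_u, act_var_a).
Qed.

Definition genH (n : nat) (v : gname n) : HBU n :=
  MkHBU (gen_eltT_invariant v).

(* The same family, indexed as the variables of a polynomial ring. *)
Definition genH_fam (n : nat) (k : 'I_(ngen n)) : HBU n := genH (enum_val k).

Definition chernH (n : nat) (i : 'I_n) : HBU n := genH (inl (inr i)).

(* An element of R is represented by any f : {mpoly rat[n + n]} in its class;
   red f is its expression in the basis of the monomials whose exponents in the
   alpha_i are at most 1 (red_eqP). *)

Definition redm (n : nat) (m : 'X_{1..n + n}) : 'X_{1..n + n} :=
  [multinom (if split k is inr _ then minn (m k) 1 else m k) | k < n + n].

Definition red (n : nat) (f : {mpoly rat[n + n]}) : {mpoly rat[n + n]} :=
  \sum_(m <- msupp f) f@_m *: 'X_[redm m].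

Definition relsR (n : nat) : seq {mpoly rat[n + n]} :=
  [seq 'X_(aI i) ^+ 2 - 'X_(aI i) | i <- enum 'I_n].

Lemma redE n (f : {mpoly rat[n + n]}) k : (msize f <= k)%N ->
  red f = \sum_(m : 'X_{1..(n + n) < k}) f@_m *: 'X_[redm m].
Proof.
move=> le_fk; set I : subFinType _ := 'X_{1..(n + n) < k}.
rewrite /red (big_mksub I) ?msupp_uniq //=; first last.
  by move=> m /msize_mdeg_lt /leq_trans; apply.
rewrite big_rmcond //= => m /memN_msupp_eq0 ->.
by rewrite scale0r.
Qed.

Lemma redD n : {morph (@red n) : f g / f + g}.
Proof.
move=> f g; pose k := maxn (msize (f + g)) (maxn (msize f) (msize g)).
rewrite (@redE _ _ k) ?leq_maxl // [red f](@redE _ _ k) 1?[red g](@redE _ _ k).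
- by rewrite -big_split; apply: eq_bigr => m _; rewrite mcoeffD scalerDl.
- by rewrite /k !leq_max leqnn !orbT.
- by rewrite /k !leq_max leqnn !orbT.
Qed.

Lemma redZ n (c : rat) (f : {mpoly rat[n + n]}) : red (c *: f) = c *: red f.
Proof.
pose k := maxn (msize (c *: f)) (msize f).
rewrite (@redE _ _ k) ?leq_maxl // [red f](@redE _ _ k) ?leq_maxr //.
by rewrite scaler_sumr; apply: eq_bigr => m _; rewrite mcoeffZ scalerA.
Qed.

Lemma red0 n : red (0 : {mpoly rat[n + n]}) = 0.
Proof. by rewrite /red msupp0 big_nil. Qed.

Lemma redX n m : red ('X_[m] : {mpoly rat[n + n]}) = 'X_[redm m].
Proof. by rewrite /red msuppX big_seq1 mcoeffX eqxx scale1r. Qed.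

Lemma red_idealR n (f : {mpoly rat[n + n]}) : in_ideal (relsR n) (f - red f).
Proof.
rewrite [X in X - _]mpolyE /red -sumrB; apply: in_ideal_sum => m _.
rewrite -scalerBr -mul_mpolyC; apply: in_idealM.
rewrite !mpolyXE_id; elim/big_rec2: _ => [|k p q _ hpq].
  by rewrite subrr; apply: in_ideal0.
rewrite mnmE; set a := m k; set b := (X in _ - 'X_k ^+ X * _).
have -> : 'X_k ^+ a * q - 'X_k ^+ b * p =
    'X_k ^+ a * (q - p) + p * ('X_k ^+ a - 'X_k ^+ b) :> {mpoly rat[n + n]}.
  by rewrite mulrBr mulrBr ![p * _]mulrC addrA addrNK.
apply: in_idealD; apply: in_idealM => //.
rewrite /b {b}; case: splitP => [i _|i ki]; first by rewrite subrr; apply: in_ideal0.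
have -> : k = aI i by apply: val_inj.
case: a => [|a]; first by rewrite min0n subrr; apply: in_ideal0.
rewrite (minn_idPr (ltn0Sn a)) expr1; elim: a => [|a IHa].
  by rewrite subrr; apply: in_ideal0.
have -> : 'X_(aI i) ^+ a.+2 - 'X_(aI i) =
    'X_(aI i) * ('X_(aI i) ^+ a.+1 - 'X_(aI i)) +
    ('X_(aI i) ^+ 2 - 'X_(aI i)) :> {mpoly rat[n + n]}.
  by rewrite mulrBr -exprS -expr2 addrA addrNK.
apply: in_idealD; first exact: in_idealM.
by apply/in_ideal_mem/mapP; exists i; rewrite ?mem_enum.
Qed.

(* red f is a normal form of the class of f in R. *)
Lemma red_eqP n (f g : {mpoly rat[n + n]}) :
  red f = red g <-> in_ideal (relsR n) (f - g).
Proof.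
split=> [h|[a hfg]].
  have := in_idealB (red_idealR f) (red_idealR g).
  by rewrite h opprB addrA addrNK.
rewrite -[f](addrNK g) hfg redD -[RHS]add0r; congr (_ + _).
elim/big_ind: _ => [|p q hp hq|k _]; first exact: red0.
  by rewrite redD hp hq addr0.
have /mapP[i _ ->] := mem_nth 0 (ltn_ord k).
rewrite [a k]mpolyE mulr_suml.
elim/big_ind: _ => [|p q hp hq|m _]; first exact: red0.
  by rewrite redD hp hq addr0.
rewrite -scalerAl redZ mulrBr mpolyXn -!mpolyXD -scaleN1r redD redZ !redX.
rewrite scaleN1r; apply/eqP; rewrite scaler_eq0 subr_eq0; apply/orP; right.
apply/eqP; congr 'X_[_]; apply/mnmP => j; rewrite !mnmE.
case: splitP => [j' jj'|j' _] /=.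
  suff /negbTE -> : aI i != j by [].
  by rewrite -val_eqE /= jj' neq_ltn ltn_addr ?orbT.
case: (_ == j) => //=; rewrite addn2 addn1.
by rewrite !(minn_idPr (ltn0Sn _)).
Qed.

Definition in_invariantsR (n : nat) (f : {mpoly rat[n + n]}) : Prop :=
  forall tau : 'S_n, red (act_mpoly tau f) = red f.

(* The grading with |u_i| = 1 and |alpha_i| = 0. *)
Definition mdegR (n : nat) (m : 'X_{1..n + n}) : nat := \sum_(i < n) m (uI i).

Definition homogR (n d : nat) (f : {mpoly rat[n + n]}) : bool :=
  all (fun m => mdegR m == d) (msupp (red f)).

Definition mlexlt (n : nat) (m1 m2 : 'X_{1..n + n}) : bool :=
  ((m1 : seq nat) < m2 :> seqlexi nat)%O.

(* The dominant term of f; by convention 0%MM if f is zero in R. *)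
Definition dominant (n : nat) (f : {mpoly rat[n + n]}) : 'X_{1..n + n} :=
  foldr (fun m acc => if mlexlt acc m then m else acc) 0%MM (msupp (red f)).

(* The comparison of homogeneous elements of the same degree; zero, which has no
   dominant term, is smaller than everything else. *)
Definition smallerR (n : nat) (f g : {mpoly rat[n + n]}) : bool :=
  (red g != 0) && ((red f == 0) || mlexlt (dominant f) (dominant g)).

Section GeneratorPolynomials.
Variables (A : comNzRingType) (n : nat).

Definition Xgen (v : gname n) : {mpoly A[ngen n]} := 'X_(enum_rank v).
Definition Xalpha : {mpoly A[ngen n]} := Xgen (inl (inl tt)).
Definition Xgamma (g : gidx n) : {mpoly A[ngen n]} := Xgen (inr g).

(* c_s for 1 <= s <= n. *)
Definition Xc (s : nat) : {mpoly A[ngen n]} :=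
  if [pick i : 'I_n | i.+1 == s] is Some i then Xgen (inl (inr i)) else 0.

End GeneratorPolynomials.

Arguments Xalpha A n : clear implicits.
Arguments Xc A n s : clear implicits.

(* gamma_{s,i} for s + i <= n, with gamma_{s,0} = c_s and
   gamma_{0,i} = alpha (alpha - 1) ... (alpha - i + 1) / i!. *)
Definition Xgam (n s i : nat) : {mpoly rat[ngen n]} :=
  if s == 0%N then
    (i`!%:R^-1 : rat) *: \prod_(k < i) (Xalpha rat n - k%:R)
  else if i == 0%N then Xc rat n s
  else if [pick g : gidx n | (gs g == s) && (gi g == i)] is Some g
       then Xgamma rat g else 0.

(* The grading with |alpha| = 0, |c_i| = i and |gamma_{s,i}| = s. *)
Definition gdeg (n : nat) (v : gname n) : nat :=
  match v with
  | inl (inl _) => 0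
  | inl (inr i) => i.+1
  | inr g => gs g
  end.

Definition homogG (n d : nat) (p : {mpoly rat[ngen n]}) : bool :=
  all (fun m : 'X_{1..ngen n} =>
         \sum_(k < ngen n) m k * gdeg (enum_val k) == d)%N (msupp p).

Definition uR (n : nat) (i : 'I_n) : {mpoly rat[n + n]} := 'X_(uI i).
Definition aR (n : nat) (i : 'I_n) : {mpoly rat[n + n]} := 'X_(aI i).

Definition evalR (n : nat) (p : {mpoly rat[ngen n]}) : {mpoly rat[n + n]} :=
  aeval (fun k => gen_elt (@uR n) (@aR n) (enum_val k)) p.

(* For the monomial u_1^a_1 ... u_n^a_n alpha_1^e_1 ... alpha_n^e_n,
   uexp m s = a_(s+1) (and 0 if s >= n), while run m s is the length of the run of
   ones e_(s+1) = e_(s+2) = ... = 1 if such a run starts there, that is if s = 0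
   or e_s = 0, and 0 otherwise. *)
Definition uexp (n : nat) (m : 'X_{1..n + n}) (s : nat) : nat :=
  nth 0%N [seq m (uI i) | i <- enum 'I_n] s.

Definition aexps (n : nat) (m : 'X_{1..n + n}) : seq nat :=
  [seq m (aI i) | i <- enum 'I_n].

Definition run (n : nat) (m : 'X_{1..n + n}) (s : nat) : nat :=
  if (s == 0%N) || (nth 0%N (aexps m) s.-1 == 0%N)
  then find (pred1 0%N) (drop s (aexps m)) else 0%N.

(* The product of elements gamma_{s,i} with dominant term m, when m is the
   dominant term of an invariant: the power of c_s with exponent
   a_s - a_(s+1) is what the u-part requires, and if a run of i ones starts at
   position s + 1 then invariance forces a_s > a_(s+1) and one of these factors
   c_s = gamma_{s,0} is replaced by gamma_{s,i}. *)
Definition dominant_product (n : nat) (m : 'X_{1..n + n}) :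
    {mpoly rat[ngen n]} :=
  Xgam n 0 (run m 0) *
  \prod_(1 <= s < n.+1)
    let k := (uexp m s.-1 - uexp m s)%N in
    if k == 0%N then 1 else Xc rat n s ^+ k.-1 * Xgam n s (run m s).

(* One step, on a pair (what remains to be expressed, what has been found). *)
Definition algo_step (n : nat)
    (st : {mpoly rat[n + n]} * {mpoly rat[ngen n]}) :
    {mpoly rat[n + n]} * {mpoly rat[ngen n]} :=
  let f := red st.1 in
  if f == 0 then (0, st.2) else
  let m := dominant f in
  let p := f@_m *: dominant_product m in
  (red (f - evalR p), st.2 + p).

(* The dominant terms of the successive remainders are distinct, and there are at
   most (2 * msize f) ^ n monomials among which they can be found. *)
Definition algorithm (n : nat) (f : {mpoly rat[n + n]}) :
    {mpoly rat[n + n]} * {mpoly rat[ngen n]} :=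
  iter ((2 * msize f) ^ n) (@algo_step n) (f, 0).

(* The algorithm stops on f with output p. *)
Definition computes (n : nat) (f : {mpoly rat[n + n]})
  (p : {mpoly rat[ngen n]}) : Prop := algorithm f = (0, p).

(* Minus the coefficient of alpha ^ m in alpha (alpha - 1) ... (alpha - n), for
   1 <= m <= n. *)
Definition coefI (n m : nat) : rat :=
  (-1) ^+ (n + m) * n`!%:R *
  \sum_(I : {set 'I_n} | #|I| == m.-1) \prod_(i in I) (i.+1%:R)^-1.

Definition relI (n : nat) : {mpoly rat[ngen n]} :=
  Xalpha rat n ^+ n.+1 - \sum_(1 <= m < n.+1) coefI n m *: Xalpha rat n ^+ m.

Definition lhsII (n : nat) (g : gidx n) : {mpoly rat[ngen n]} :=
  Xalpha rat n ^+ gs g * Xgamma rat g.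
Definition leadII (n : nat) (g : gidx n) : {mpoly rat[ngen n]} :=
  Xc rat n (gs g) * Xalpha rat n ^+ (gs g + gi g).
Definition coefII (n : nat) (g : gidx n) : rat :=
  (gs g)`!%:R / (gs g + gi g)`!%:R.
Definition restII (n : nat) (g : gidx n) : {mpoly rat[ngen n]} :=
  (algorithm (evalR (lhsII g - coefII g *: leadII g))).2.
Definition relII (n : nat) (g : gidx n) : {mpoly rat[ngen n]} :=
  lhsII g - (coefII g *: leadII g + restII g).

Definition typeIII (n : nat) (g h : gidx n) : bool :=
  (gs g <= gs h <= gs g + gi g)%N.
Definition lhsIII (n : nat) (g h : gidx n) : {mpoly rat[ngen n]} :=
  Xgamma rat g * Xgamma rat h.
Definition leadIII (n : nat) (g h : gidx n) : {mpoly rat[ngen n]} :=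
  Xc rat n (gs h) * Xgam n (gs g) (minn (gi g + gi h) (n - gs g)).
(* With s = gs g, i = gi g, t = gs h, j = gi h and k = min (i + j, n - s), the
   number of pairs (I, J) with I and J contained in {s+1, ..., n} and
   {t+1, ..., n}, of cardinals i and j, and with union {s+1, ..., s+k}. The second
   binomial coefficient is 1 unless s + i + j > n and s + i < n. *)
Definition coefIII (n : nat) (g h : gidx n) : rat :=
  ('C(minn (gi g + gi h + gs g) n - gs h, gi h) *
   'C(gi h, gs g + gi g + gi h - n))%:R.
Definition restIII (n : nat) (g h : gidx n) : {mpoly rat[ngen n]} :=
  (algorithm (evalR (lhsIII g h - coefIII g h *: leadIII g h))).2.
Definition relIII (n : nat) (g h : gidx n) : {mpoly rat[ngen n]} :=
  lhsIII g h - (coefIII g h *: leadIII g h + restIII g h).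

Definition relsS (n : nat) : seq {mpoly rat[ngen n]} :=
  relI n ::
  [seq relII g | g <- enum (gidx n)] ++
  [seq relIII p.1 p.2 | p <- enum {: gidx n * gidx n} & typeIII p.1 p.2].

Definition rels (n : nat) : seq {mpoly AQ[ngen n]} :=
  xA *: Xalpha AQ n ::
  [seq xA *: Xgamma AQ g | g <- enum (gidx n)] ++
  [seq map_mpoly (in_alg AQ) r | r <- relsS n].

(* ((a, k), E) stands for alpha ^ a * prod_i c_i ^ k_i * prod_(g in E) gamma_g. *)
Definition bidx (n : nat) : choiceType := ('I_n.+1 * 'X_{1..n} * {set gidx n})%type.

Definition basis_elt (n : nat) (b : bidx n) : HBU n :=
  genH (inl (inl tt)) ^+ b.1.1 * \prod_(i < n) chernH i ^+ b.1.2 i *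
  \prod_(g in b.2) genH (inr g).

Definition admissible (n : nat) (b : bidx n) : bool :=
  [forall g in b.2, b.1.1 < gs g]%N &&
  [forall g in b.2, forall h in b.2,
     (g != h) && (gs g <= gs h)%N ==> (gs g + gi g < gs h)%N].

(* No factor alpha or gamma. *)
Definition pure_chern (n : nat) (b : bidx n) : bool :=
  (b.1.1 == 0 :> nat) && (b.2 == set0).

(* As x alpha = 0 and x gamma_{s,i} = 0, a basis over AQ cannot consist of free
   generators: the coefficient of a basis element is determined in AQ for the
   monomials in the c_i, and in AQ / (x) for the other ones. *)
Definition is_AQ_basis (n : nat) (P : pred (bidx n)) : Prop :=
  [/\ forall t : HBU n, exists (r : seq (bidx n)) (l : bidx n -> AQ),
        all P r /\ t = \sum_(b <- r) l b *: basis_elt b,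
      forall (r : seq (bidx n)) (l : bidx n -> AQ), uniq r -> all P r ->
        \sum_(b <- r) l b *: basis_elt b = 0 ->
        forall b, b \in r -> l b *: basis_elt b = 0
    & forall (b : bidx n) (l : AQ), P b ->
        l *: basis_elt b = 0 <->
        (if pure_chern b then l = 0 else exists l', l = xA * l')].

(* Main.v *)
(* The product of gamma_{0,i_0} with factors gamma_{s,i}, for admissible indices,
   has as dominant term the monomial whose u-exponents drop at each s and whose
   alphas form a run of length i starting right after s, and every dominant term
   of an invariant arises so from exactly one admissible monomial: a run of ones in
   the alpha-exponents can only start at position 1 or where the u-exponents drop.
   Hence the algorithm terminates, the elements gamma generate, and the admissible
   monomials are linearly independent. The relations of types II and III are
   obtained by running the algorithm on the difference with the expected dominant
   term. They rewrite every monomial into admissible ones, because they decrease a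
   lexicographic order on monomials that is compatible with products; so they
   generate all the relations among the generators.

   All this takes place over Q. The idempotents x/2 and y split AQ into Q x Q; in
   the factor x = 2 the alphas vanish and only the symmetric functions c_i remain,
   in the factor x = 0 one gets the invariants of R. Finally, a prime
   ideal of the invariants contains the kernel of one of the evaluations with
   values in Q[u_1, ..., u_n], in which n + 1 elements are always algebraically
   dependent, whereas a chain of n + 1 strict inclusions of primes would provide
   independent ones. *)

Require Import Defs.
From HB Require Import structures.
From mathcomp Require Import all_boot all_order all_fingroup all_algebra.
From mathcomp Require Import ssrcomplements mpoly.
From Stdlib Require Import Classical_Prop.
From mathcomp Require Import zify ring.

Set Implicit Arguments.
Unset Strict Implicit.
Unset Printing Implicit Defensive.

Import GRing.Theory.
Local Open Scope ring_scope.

(** Two orders are needed because neither does both jobs. Dominant terms tell admissible monomials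
    apart, but idempotence of the alpha_i makes overlapping runs of ones merge, so that order is not
    multiplicative: dominant terms of products are controlled only by multiplying the gammas with
    decreasing s, each new run ending no later than where the older ones begin. Rewriting, on the
    other hand, needs an order stable under products, hence one built from weights that are additive
    in the generators. The bridge between the two: the rest computed by [algorithm] only contains
    monomials of [dominant_product m] with m below the expected dominant term, and each of these
    monomials remembers the u-exponents of m exactly. Only when the u-exponents agree must the
    number of gammas, the power of alpha and the run lengths be compared. The coefficient s!/(s+i)!
    of type II comes from the fact that sigma_a enters alpha^a with coefficient a!; the coefficient
    of type III counts pairs of sets with prescribed union. *)

(** * Lexicographic order on families of natural numbers *)

Definition lexlt (N : nat) (x y : nat -> nat) : Prop :=
  exists k, [/\ (k < N)%N, forall j, (j < k)%N -> x j = y j & (x k < y k)%N].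

Lemma lexlt_irr N x : ~ lexlt N x x.
Proof. by case=> k [_ _]; rewrite ltnn. Qed.

Lemma lexlt_trans N x y z : lexlt N x y -> lexlt N y z -> lexlt N x z.
Proof.
case=> k [kN hk ltk] [l [lN hl ltl]].
case: (ltngtP k l) => [kl|lk|kl].
- exists k; split=> // [j jk|]; last by rewrite -hl.
  by rewrite hk // hl // (ltn_trans jk).
- exists l; split=> // [j jl|]; last by rewrite hk.
  by rewrite -hl // hk // (ltn_trans jl).
- exists k; split=> // [j jk|]; first by rewrite hk // hl // -kl.
  by rewrite (ltn_trans ltk) // kl.
Qed.

Lemma lexlt_total N x y :
  [\/ forall j, (j < N)%N -> x j = y j, lexlt N x y | lexlt N y x].
Proof.
elim: N => [|N [h|h|h]]; first by constructor 1.
- case: (ltngtP (x N) (y N)) => c.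
  + by constructor 2; exists N.
  + by constructor 3; exists N; split=> // j /h.
  + by constructor 1 => j; rewrite ltnS leq_eqVlt => /orP[/eqP->|/h].
- by constructor 2; case: h => k [kN ? ?]; exists k; split=> //; apply: ltnW.
- by constructor 3; case: h => k [kN ? ?]; exists k; split=> //; apply: ltnW.
Qed.

Lemma lexlt_eql N x x' y : (forall j, (j < N)%N -> x j = x' j) ->
  lexlt N x y -> lexlt N x' y.
Proof.
move=> e [k [kN h l]]; exists k; split=> // [j jk|]; rewrite -e //.
  exact: h.
exact: ltn_trans kN.
Qed.

Lemma lexlt_eqr N x y y' : (forall j, (j < N)%N -> y j = y' j) ->
  lexlt N x y -> lexlt N x y'.
Proof.
move=> e [k [kN h l]]; exists k; split=> // [j jk|]; rewrite -e //.
  exact: h.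
exact: ltn_trans kN.
Qed.

Lemma lexlt_add2r N x y z : lexlt N x y ->
  lexlt N (fun j => x j + z j)%N (fun j => y j + z j)%N.
Proof.
case=> k [kN h l]; exists k; split=> // [j /h ->//|]; by rewrite ltn_add2r.
Qed.

Lemma lexlt_add N x1 y1 x2 y2 : lexlt N x1 y1 ->
  (forall j, (j < N)%N -> x2 j = y2 j) \/ lexlt N x2 y2 ->
  lexlt N (fun j => x1 j + x2 j)%N (fun j => y1 j + y2 j)%N.
Proof.
move=> h1 h2; have h := lexlt_add2r x2 h1.
case: h2 => [e|h2]; first by apply: lexlt_eqr h => j /e ->.
apply: lexlt_trans h _.
by apply: (lexlt_eql _ (lexlt_eqr _ (lexlt_add2r y1 h2))) => j _; rewrite addnC.
Qed.

(** Well-foundedness rests on the fixed length N: a strong induction on the first coordinate v,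
    inside which the hypothesis for N is applied to the remaining coordinates and to the predicate
    restricted to elements with first coordinate v. *)
Lemma lexlt_ind (T : Type) (N : nat) (f : T -> nat -> nat) (P : T -> Prop) :
  (forall x, (forall y, lexlt N (f y) (f x) -> P y) -> P x) -> forall x, P x.
Proof.
elim: N f P => [|N IH] f P h x; first by apply: h => y [k []].
suff hm v : forall y, f y 0%N = v -> P y by exact: hm.
elim/ltn_ind: v => v IHv.
apply: (IH (fun y j => f y j.+1) (fun y => f y 0%N = v -> P y)) => y hy fy.
apply: h => z [[|k] [kN hk lt_k]].
  by apply: (IHv (f z 0%N)); rewrite // -fy.
apply: hy; last by rewrite hk.
by exists k; split=> // j jk; apply: hk.
Qed.

(** * Normal forms in R *)

Section Exponents.
Variable n : nat.
Implicit Type m : 'X_{1..n + n}.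

Definition aexp m (j : nat) : nat := nth 0%N (aexps m) j.

Lemma uexpE m (i : 'I_n) : uexp m i = m (uI i).
Proof. by rewrite /uexp (nth_map i) ?size_enum_ord // nth_ord_enum. Qed.

Lemma aexpE m (i : 'I_n) : aexp m i = m (aI i).
Proof. by rewrite /aexp /aexps (nth_map i) ?size_enum_ord // nth_ord_enum. Qed.

Lemma uexp_out m j : (n <= j)%N -> uexp m j = 0%N.
Proof. by move=> h; rewrite /uexp nth_default // size_map size_enum_ord. Qed.

Lemma aexp_out m j : (n <= j)%N -> aexp m j = 0%N.
Proof. by move=> h; rewrite /aexp nth_default // size_map size_enum_ord. Qed.

Lemma uexpD m1 m2 j : uexp (m1 + m2) j = (uexp m1 j + uexp m2 j)%N.
Proof.
case: (ltnP j n) => h; last by rewrite !uexp_out.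
by rewrite -[j]/(nat_of_ord (Ordinal h)) !uexpE mnmDE.
Qed.

Lemma aexpD m1 m2 j : aexp (m1 + m2) j = (aexp m1 j + aexp m2 j)%N.
Proof.
case: (ltnP j n) => h; last by rewrite !aexp_out.
by rewrite -[j]/(nat_of_ord (Ordinal h)) !aexpE mnmDE.
Qed.

Lemma split_uI (i : 'I_n) : split (uI i) = inl i.
Proof. by rewrite -[uI i]/(unsplit (inl i)) unsplitK. Qed.

Lemma split_aI (i : 'I_n) : split (aI i) = inr i.
Proof. by rewrite -[aI i]/(unsplit (inr i)) unsplitK. Qed.

Lemma uexp_redm m j : uexp (redm m) j = uexp m j.
Proof.
case: (ltnP j n) => h; last by rewrite !uexp_out.
by rewrite -[j]/(nat_of_ord (Ordinal h)) !uexpE mnmE split_uI.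
Qed.

Lemma aexp_redm m j : aexp (redm m) j = minn (aexp m j) 1.
Proof.
case: (ltnP j n) => h; last by rewrite !aexp_out.
by rewrite -[j]/(nat_of_ord (Ordinal h)) !aexpE mnmE split_aI.
Qed.

Lemma mnm_uaP m1 m2 : (forall j, (j < n)%N -> uexp m1 j = uexp m2 j) ->
  (forall j, (j < n)%N -> aexp m1 j = aexp m2 j) -> m1 = m2.
Proof.
move=> hu ha; apply/mnmP => k; rewrite -(splitK k).
case: (split k) => i; first by have := hu i (ltn_ord i); rewrite !uexpE.
by have := ha i (ltn_ord i); rewrite !aexpE.
Qed.

Lemma mlexltE m1 m2 : mlexlt m1 m2 <->
  lexlt (n + n) (nth 0%N m1) (nth 0%N m2).
Proof.
rewrite /mlexlt; have : size m1 = size m2 by rewrite !size_tuple.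
rewrite -[X in lexlt X](size_tuple m1).
elim: (val m1 : seq nat) (val m2 : seq nat) => [|x s IH] [|y t] //=.
  by move=> _; split=> // [[k []]].
case=> /IH {}IH; rewrite Order.SeqLexiOrder.ltxi_cons !leEnat.
split.
- case/andP=> h1 /implyP h2; case: (ltngtP x y) h1 h2 => // [xy _ _|-> _ h2].
    by exists 0%N.
  have /IH[k [kN hk l]] := h2 isT.
  by exists k.+1; split=> // -[|j] //; apply: hk.
- case=> -[|k] [kN hk l].
    by rewrite ltnW //= leqNgt l.
  have /= -> := hk 0%N isT; rewrite leqnn /=; apply/IH.
  by exists k; split=> // j jk; apply: (hk j.+1).
Qed.

Lemma uexp_nth m j : (j < n)%N -> uexp m j = nth 0%N m j.
Proof. by move=> h; rewrite -[j]/(nat_of_ord (Ordinal h)) uexpE (mnm_nth 0%N). Qed.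

Lemma aexp_nth m j : (j < n)%N -> aexp m j = nth 0%N m (n + j).
Proof. by move=> h; rewrite -[j]/(nat_of_ord (Ordinal h)) aexpE (mnm_nth 0%N). Qed.

(** The u-exponents fill the first n positions, so the alpha-exponents only break ties. The two
    blocks behave differently in R: u-exponents add up in products, alpha-exponents are truncated at
    1. *)
Lemma mlexltP m1 m2 : mlexlt m1 m2 <->
  lexlt n (uexp m1) (uexp m2) \/
  (forall j, (j < n)%N -> uexp m1 j = uexp m2 j) /\ lexlt n (aexp m1) (aexp m2).
Proof.
rewrite mlexltE; split.
- case=> k [kN hk l]; case: (ltnP k n) => kn.
    left; exists k; split=> // [j jk|]; last by rewrite !uexp_nth.
    by rewrite !uexp_nth ?(ltn_trans jk) // hk.
  have hkn : (k - n < n)%N by lia.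
  right; split=> [j jn|]; first by rewrite !uexp_nth // hk // (leq_trans jn).
  exists (k - n)%N; split=> // [j jk|]; rewrite !aexp_nth ?subnKC //; try lia.
  by apply: hk; lia.
- case=> [[k [kn hk l]]|[hu [k [kn hk l]]]].
    exists k; split=> [|j jk|]; rewrite -?uexp_nth //; try lia.
    by apply: hk.
  exists (n + k)%N; split=> [|j jk|]; rewrite -?aexp_nth //; try lia.
  case: (ltnP j n) => jn; first by rewrite -!uexp_nth // hu.
  by rewrite -(subnKC jn) -!aexp_nth //; try lia; apply: hk; lia.
Qed.

Lemma mlexlt_irr m : mlexlt m m = false.
Proof. by apply/negP => /mlexltE /lexlt_irr. Qed.

Lemma mlexlt_trans m1 m2 m3 : mlexlt m1 m2 -> mlexlt m2 m3 -> mlexlt m1 m3.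
Proof. by move=> /mlexltE h /mlexltE h'; apply/mlexltE/(lexlt_trans h h'). Qed.

Lemma mlexlt_total m1 m2 : [\/ m1 = m2, mlexlt m1 m2 | mlexlt m2 m1].
Proof.
case: (lexlt_total (n + n) (nth 0%N m1) (nth 0%N m2)) => h.
- constructor 1; apply/mnmP => k; rewrite !(mnm_nth 0%N); exact: h.
- by constructor 2; apply/mlexltE.
- by constructor 3; apply/mlexltE.
Qed.

Lemma mlexlt_ind (T : Type) (f : T -> 'X_{1..n + n}) (P : T -> Prop) :
  (forall x, (forall y, mlexlt (f y) (f x) -> P y) -> P x) -> forall x, P x.
Proof.
move=> h; apply: (lexlt_ind (N := n + n) (f := fun x => nth 0%N (f x))) => x hx.
by apply: h => y /mlexltE; apply: hx.
Qed.

End Exponents.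

Section Reduction.
Variable n : nat.
Implicit Types (m : 'X_{1..n + n}) (f g : {mpoly rat[n + n]}).

HB.instance Definition _ := GRing.isZmodMorphism.Build
  {mpoly rat[n + n]} {mpoly rat[n + n]} (@red n)
  (fun f g => etrans (redD f (- g)) (congr1 (fun h => red f + h)
     (etrans (congr1 (@red n) (esym (scaleN1r g)))
       (etrans (redZ (-1) g) (scaleN1r (red g)))))).

Lemma redm_id m : redm (redm m) = redm m.
Proof. by apply: mnm_uaP => j jn; rewrite !(uexp_redm, aexp_redm) -?minnA. Qed.

Lemma red_eq0 f : red f = 0 <-> in_ideal (relsR n) f.
Proof. by have := red_eqP f 0; rewrite red0 subr0. Qed.

Lemma red_red f : red (red f) = red f.
Proof.
apply/red_eqP; rewrite -opprB -sub0r; apply: in_idealB (red_idealR f).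
exact: in_ideal0.
Qed.

Lemma red_mull f g : red (red f * g) = red (f * g).
Proof.
apply/red_eqP; rewrite -mulrBl mulrC -[_ - _]opprB mulrN -mulNr.
exact/in_idealM/red_idealR.
Qed.

Lemma red_mulr f g : red (f * red g) = red (f * g).
Proof. by rewrite mulrC red_mull mulrC. Qed.

Lemma mem_msupp_red f m : m \in msupp (red f) -> redm m = m.
Proof.
rewrite mcoeff_msupp /red raddf_sum /=.
case: (eqVneq (redm m) m) => // ne; rewrite big1 ?eqxx // => k _.
rewrite mcoeffZ mcoeffX; case: eqP => [e|]; last by rewrite mulr0.
by move: ne; rewrite -e redm_id eqxx.
Qed.

Lemma aexp_msupp_red f m j : m \in msupp (red f) -> (aexp m j <= 1)%N.
Proof. by move=> /mem_msupp_red <-; rewrite aexp_redm geq_minr. Qed.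

Lemma redME f g : red (f * g) =
  \sum_(m1 <- msupp (red f)) \sum_(m2 <- msupp (red g))
    ((red f)@_m1 * (red g)@_m2) *: 'X_[redm (m1 + m2)].
Proof.
rewrite -red_mull -red_mulr mpolyME raddf_sum big_allpairs /=.
apply: eq_bigr => m1 _ /=; apply: eq_bigr => m2 _ /=.
by rewrite redZ redX.
Qed.

Lemma mcoeff_redM f g m : (red (f * g))@_m =
  \sum_(m1 <- msupp (red f)) \sum_(m2 <- msupp (red g))
    ((red f)@_m1 * (red g)@_m2) * (redm (m1 + m2) == m)%:R.
Proof.
rewrite redME raddf_sum; apply: eq_bigr => m1 _ /=.
by rewrite raddf_sum; apply: eq_bigr => m2 _ /=; rewrite mcoeffZ mcoeffX.
Qed.

Lemma msupp_redM f g m : m \in msupp (red (f * g)) ->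
  exists m1 m2, [/\ m1 \in msupp (red f), m2 \in msupp (red g) & m = redm (m1 + m2)].
Proof.
rewrite mcoeff_msupp mcoeff_redM => /eqP nz.
have [/hasP[m1 h1 /hasP[m2 h2 /eqP e]]|/hasPn h] :=
  boolP (has (fun m1 => has (fun m2 => redm (m1 + m2) == m) (msupp (red g)))
     (msupp (red f))); first by exists m1, m2.
case: nz; rewrite big_seq big1 // => m1 /h /hasPn h1.
by rewrite big_seq big1 // => m2 /h1 /negbTE ->; rewrite mulr0.
Qed.

(** Idempotence may send several pairs of monomials to the same one; where that does not happen,
    coefficients multiply. If m1 or m2 is outside its support, the hypothesis leaves no pair at all
    and both sides vanish. *)
Lemma mcoeff_redM_uniq f g m1 m2 :
  (forall m1' m2', m1' \in msupp (red f) -> m2' \in msupp (red g) ->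
     redm (m1' + m2') = redm (m1 + m2) -> m1' = m1 /\ m2' = m2) ->
  (red (f * g))@_(redm (m1 + m2)) = (red f)@_m1 * (red g)@_m2.
Proof.
move=> h; rewrite mcoeff_redM.
case: (boolP (m1 \in msupp (red f))) => h1; last first.
  rewrite (memN_msupp_eq0 h1) mul0r big_seq big1 // => k1 hk1.
  rewrite big_seq big1 // => k2 hk2; case: eqP => [/h[]//|]; last by rewrite mulr0.
  by move=> e; rewrite -e hk1 in h1.
rewrite (bigD1_seq m1) ?msupp_uniq //= [X in _ + X]big_seq_cond.
rewrite [X in _ + X]big1 ?addr0; last first.
  move=> k1 /andP[hk1 ne]; rewrite big_seq big1 // => k2 hk2.
  case: eqP => [/h[]// e|]; last by rewrite mulr0.
  by rewrite e eqxx in ne.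
case: (boolP (m2 \in msupp (red g))) => h2; last first.
  rewrite (memN_msupp_eq0 h2) mulr0 big_seq big1 // => k2 hk2.
  case: eqP => [/h[]// _ e|]; last by rewrite mulr0.
  by rewrite -e hk2 in h2.
rewrite (bigD1_seq m2) ?msupp_uniq //= eqxx mulr1 [X in _ + X]big_seq_cond.
rewrite big1 ?addr0 // => k2 /andP[hk2 ne].
case: eqP => [/h[]// _ e|]; last by rewrite mulr0.
by rewrite e eqxx in ne.
Qed.

End Reduction.

(** * Dominant terms of products of the gamma_{s,i} *)

Section Gamma.
Variable n : nat.
Implicit Types (m : 'X_{1..n + n}) (f g : {mpoly rat[n + n]}).
Implicit Types (M L : {set 'I_n}).

Definition gmon M L : 'X_{1..n + n} :=
  [multinom (match split k with inl i => i \in M | inr i => i \in L end : nat)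
    | k < n + n].

Lemma uexp_gmon M L (i : 'I_n) : uexp (gmon M L) i = (i \in M).
Proof. by rewrite uexpE mnmE split_uI. Qed.

Lemma aexp_gmon M L (i : 'I_n) : aexp (gmon M L) i = (i \in L).
Proof. by rewrite aexpE mnmE split_aI. Qed.

Lemma gmon_inj M L M' L' : gmon M L = gmon M' L' -> M = M' /\ L = L'.
Proof.
move=> e; split; apply/setP => i.
  by have := uexp_gmon M L i; rewrite e uexp_gmon; do 2!case: (_ \in _).
by have := aexp_gmon M L i; rewrite e aexp_gmon; do 2!case: (_ \in _).
Qed.

Lemma redm_gmon M L : redm (gmon M L) = gmon M L.
Proof.
apply: mnm_uaP => j jn; rewrite ?uexp_redm ?aexp_redm //.
by rewrite -[j]/(nat_of_ord (Ordinal jn)) aexp_gmon; case: (_ \in _).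
Qed.

Lemma XgmonE M L : (\prod_(m in M) uR m) * (\prod_(l in L) aR l) = 'X_[gmon M L].
Proof.
rewrite mpolyXE_id big_split_ord /=; congr (_ * _).
  rewrite big_mkcond; apply: eq_bigr => i _.
  by rewrite mnmE split_uI /uR; case: (_ \in _).
rewrite big_mkcond; apply: eq_bigr => i _.
by rewrite mnmE split_aI /aR; case: (_ \in _).
Qed.

Definition gammaR s i : {mpoly rat[n + n]} := gamma_elt (@uR n) (@aR n) s i.

Lemma gammaRE s i : gammaR s i =
  \sum_(M : {set 'I_n} | #|M| == s)
    \sum_(L : {set 'I_n} | (#|L| == i) && [disjoint M & L]) 'X_[gmon M L].
Proof. by apply: eq_bigr => M _; apply: eq_bigr => L _; rewrite XgmonE. Qed.

Lemma red_gammaR s i : red (gammaR s i) = gammaR s i.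
Proof.
rewrite gammaRE raddf_sum /=; apply: eq_bigr => M _.
by rewrite raddf_sum; apply: eq_bigr => L _; rewrite /= redX redm_gmon.
Qed.

Lemma msupp_gammaR s i m : m \in msupp (gammaR s i) ->
  exists M L, [/\ m = gmon M L, #|M| = s, #|L| = i & [disjoint M & L]].
Proof.
rewrite mcoeff_msupp gammaRE raddf_sum /= => nz.
have [/existsP[M /andP[/eqP Ms h]]|/existsPn h] := boolP [exists M : {set 'I_n},
  (#|M| == s) && ((\sum_(L : {set 'I_n} | (#|L| == i) && [disjoint M & L])
    ('X_[gmon M L] : {mpoly rat[n + n]}))@_m != 0)]; last first.
  by case/eqP: nz; rewrite big1 // => M Ms; move: (h M); rewrite Ms negbK => /eqP.
rewrite raddf_sum /= in h.
have [/existsP[L /andP[/andP[/eqP Li d] h']]|/existsPn h'] := boolP [exists L : {set 'I_n},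
  ((#|L| == i) && [disjoint M & L]) && (('X_[gmon M L] : {mpoly rat[n + n]})@_m != 0)].
  exists M, L; split=> //; move: h'; rewrite mcoeffX.
  by case: (gmon M L =P m) => [->//|_]; rewrite mulr0n eqxx.
by case/eqP: h; rewrite big1 // => L Li; move: (h' L); rewrite Li negbK => /eqP.
Qed.

Lemma mcoeff_gammaR s i M L : #|M| = s -> #|L| = i -> [disjoint M & L] ->
  (gammaR s i)@_(gmon M L) = 1.
Proof.
move=> Ms Li d; rewrite gammaRE raddf_sum (bigD1 M) ?Ms //= raddf_sum /=.
rewrite (bigD1 L) ?Li ?eqxx ?d //= mcoeffX eqxx big1 ?addr0; last first.
  move=> L' /andP[_ ne]; rewrite mcoeffX; case: eqP => // /gmon_inj[_ e].
  by rewrite e eqxx in ne.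
rewrite big1 ?addr0 // => M' /andP[_ ne]; rewrite raddf_sum big1 // => L' _ /=.
rewrite mcoeffX; case: eqP => // /gmon_inj[e _].
by rewrite e eqxx in ne.
Qed.

Definition itv s i : {set 'I_n} := [set k : 'I_n | (s <= k < s + i)%N].

Lemma card_itv s i : (s + i <= n)%N -> #|itv s i| = i.
Proof.
move=> h; pose e (k : 'I_i) : 'I_n := Ordinal (leq_trans (introT idP (eq_rect _ is_true
  (ltn_ord k) _ (esym (ltn_add2l s k i)))) h).
have -> : itv s i = [set e k | k : 'I_i].
  apply/setP => k; rewrite inE; apply/idP/imsetP => [/andP[h1 h2]|[j _ ->]] /=.
    have hk : (k - s < i)%N by lia.
    by exists (Ordinal hk) => //; apply: val_inj => /=; rewrite subnKC.
  by rewrite leq_addr ltn_add2l ltn_ord.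
by rewrite card_imset ?card_ord // => j k [/addnI /val_inj].
Qed.

(** The initial interval is lexicographically the greatest choice, and the first gap j is the
    position that decides the comparison. The cardinal is only bounded because type III applies this
    to a union of two sets. *)
Lemma itv_or_gap L s i : (s + i <= n)%N -> (#|L| <= i)%N ->
  (forall k : 'I_n, k \in L -> (s <= k)%N) ->
  L = itv s i \/ exists j : 'I_n, [/\ (s <= j < s + i)%N, j \notin L &
    forall k : 'I_n, (s <= k < j)%N -> k \in L].
Proof.
move=> hn Li Ls; have [sub|] := boolP (itv s i \subset L).
  by left; apply/esym/eqP; rewrite eqEcard sub card_itv.
case/subsetPn => j0; rewrite inE => h0 n0.
right.
case: (arg_minnP (P := fun j => (j \in itv s i) && (j \notin L)) (i0 := j0)
  (fun j : 'I_n => j : nat)) => [|j /andP[]]; first by rewrite inE h0.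
rewrite inE => hj nj hmin; exists j; split=> // k' /andP[h1 h2].
apply: contraLR h2 => nk'; rewrite -leqNgt.
case: (ltnP k' (s + i)) => hk'; last by case/andP: hj => _ /ltnW /leq_trans; apply.
by apply: hmin; rewrite inE h1 hk'.
Qed.
End Gamma.

Section Lead.
Variable n : nat.
Implicit Types (m : 'X_{1..n + n}) (f g : {mpoly rat[n + n]}).
Implicit Types (M L : {set 'I_n}).

Definition imon s i : 'X_{1..n + n} := gmon (itv n 0 s) (itv n s i).

Lemma uexp_imon s i j : (j < n)%N -> uexp (imon s i) j = (j < s)%N.
Proof. by move=> h; rewrite -[j]/(nat_of_ord (Ordinal h)) uexp_gmon inE. Qed.

Lemma aexp_imon s i j : (j < n)%N -> aexp (imon s i) j = (s <= j < s + i)%N.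
Proof. by move=> h; rewrite -[j]/(nat_of_ord (Ordinal h)) aexp_gmon inE. Qed.

(* As alpha_i ^ 2 = alpha_i, the order on monomials is not compatible with
   products. The vanishing of the first t alpha-exponents of the monomials with the
   u-exponents of m makes this property stable under multiplication by
   gamma_{s,i} for s + i <= t. *)
Definition lead f m (c : rat) t : Prop :=
  [/\ (red f)@_m = c, (forall j, (aexp m j <= 1)%N),
      (forall j, (j < t)%N -> aexp m j = 0%N) &
      forall m', m' \in msupp (red f) -> lexlt n (uexp m') (uexp m) \/
        [/\ (forall j, (j < n)%N -> uexp m' j = uexp m j),
            (forall j, (j < t)%N -> aexp m' j = 0%N) &
            m' = m \/ lexlt n (aexp m') (aexp m)]].

Lemma set_fst M s : #|M| = s -> (s <= n)%N -> M = itv n 0 s \/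
  lexlt n (fun j => uexp (gmon M set0) j) (fun j => (j < s)%N).
Proof.
move=> Ms sn; case: (@itv_or_gap n M 0 s) => //; [by rewrite Ms | by left|].
case=> j [/= hj nj h]; right; exists j; split=> //.
  move=> k kj; have kn := ltn_trans kj (ltn_ord j).
  rewrite -[k]/(nat_of_ord (Ordinal kn)) uexp_gmon h //=.
  by rewrite (ltn_trans kj).
by rewrite uexp_gmon (negbTE nj) hj.
Qed.

(** A strict inequality between u-exponents survives because these add. If the u-parts agree, M is
    the initial interval and L lies in positions from s on. Below t neither m nor m1 has alphas, so
    a gap of L inside [itv n s i] decides. If L has no gap, the first difference between m1 and m
    occurs at or after t, beyond the interval, where truncation at 1 cannot hide it. *)
Lemma lead_cmp f m c t t' s i m1 M L : lead f m c t ->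
  (s + i <= n)%N -> (i = 0%N \/ (s + i <= t)%N) -> (t' <= t)%N ->
  ((0 < i)%N -> (t' <= s)%N) ->
  m1 \in msupp (red f) -> #|M| = s -> #|L| = i -> [disjoint M & L] ->
  [\/ [/\ m1 = m, M = itv n 0 s & L = itv n s i],
      lexlt n (uexp (redm (m1 + gmon M L))) (uexp (redm (m + imon s i))) |
      [/\ (forall j, (j < n)%N ->
             uexp (redm (m1 + gmon M L)) j = uexp (redm (m + imon s i)) j),
          (forall j, (j < t')%N -> aexp (redm (m1 + gmon M L)) j = 0%N) &
          lexlt n (aexp (redm (m1 + gmon M L))) (aexp (redm (m + imon s i)))]].
Proof.
case=> _ m1le m0 hsup hsn hit t't t's /hsup {}hsup Ms Li dML.
have eu m' M' L' j : uexp (redm (m' + gmon M' L')) j =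
    (uexp m' j + uexp (gmon M' set0) j)%N.
  rewrite uexp_redm uexpD; case: (ltnP j n) => jn; last by rewrite !uexp_out.
  by rewrite -[j]/(nat_of_ord (Ordinal jn)) !uexp_gmon.
have eu0 m' j : (j < n)%N -> uexp (redm (m' + imon s i)) j = (uexp m' j + (j < s))%N.
  by move=> jn; rewrite uexp_redm uexpD uexp_imon.
have hs : (s <= n)%N by apply: leq_trans hsn; rewrite leq_addr.
have hM := set_fst Ms hs.
have eqM : M = itv n 0 s -> forall j, (j < n)%N -> uexp (gmon M set0) j = (j < s)%N.
  by move=> -> j jn; rewrite -[j]/(nat_of_ord (Ordinal jn)) uexp_gmon inE.
case: hsup => [hlt|[hu h0 ha]].
  constructor 2; apply: (lexlt_eql (x := fun j => (uexp m1 j + uexp (gmon M set0) j)%N)).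
    by move=> j jn; rewrite eu.
  apply: (lexlt_eqr (y := fun j => (uexp m j + (j < s)%N)%N)).
    by move=> j jn; rewrite eu0.
  by apply: lexlt_add => //; case: hM => [/eqM|]; [left|right].
case: hM => [hM|hM]; last first.
  constructor 2; apply: (lexlt_eql (x := fun j => (uexp (gmon M set0) j + uexp m1 j)%N)).
    by move=> j jn; rewrite eu addnC.
  apply: (lexlt_eqr (y := fun j => ((j < s) + uexp m j)%N)).
    by move=> j jn; rewrite eu0 // addnC.
  by apply: lexlt_add => //; left.
have eu' : forall j, (j < n)%N ->
     uexp (redm (m1 + gmon M L)) j = uexp (redm (m + imon s i)) j.
  by move=> j jn; rewrite eu eu0 // hu // eqM.
have Ls (k : 'I_n) : k \in L -> (s <= k)%N.
  move=> kL; rewrite leqNgt; apply/negP => ks.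
  have kM : k \in M by rewrite hM inE.
  by move/disjointFr: dML => /(_ _ kM); rewrite kL.
have aL k : aexp (gmon M L) k = 0%N \/ (s <= k)%N /\ (0 < i)%N.
  case: (ltnP k n) => kn; last by left; rewrite aexp_out.
  rewrite -[k]/(nat_of_ord (Ordinal kn)) aexp_gmon.
  case: (boolP (_ \in L)) => [kL|]; last by left.
  right; split; first exact: (Ls _ kL).
  by rewrite -Li; apply/card_gt0P; exists (Ordinal kn).
have ea0 j : (j < t')%N -> aexp (redm (m1 + gmon M L)) j = 0%N.
  move=> jt'; rewrite aexp_redm aexpD h0 ?(leq_trans jt') //.
  by case: (aL j) => [->//|[sj /t's t's']]; lia.
case: (itv_or_gap hsn (eq_leq Li) Ls) => [hL|[j [hj nj hjj]]]; last first.
  constructor 3; split=> //.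
  have st : (s + i <= t)%N by case: hit => // i0; move: hj; lia.
  exists j; split=> // [k kj|]; last first.
    rewrite !aexp_redm !aexpD aexp_gmon (negbTE nj) aexp_imon ?hj //.
    by rewrite h0 ?m0 //; lia.
  have kn : (k < n)%N by apply: ltn_trans kj _.
  have kt : (k < t)%N by lia.
  rewrite !aexp_redm !aexpD (h0 _ kt) (m0 _ kt) aexp_imon // !add0n.
  rewrite -[k]/(nat_of_ord (Ordinal kn)) aexp_gmon /=; case: (leqP s k) => sk.
    by rewrite hjj ?sk //=; lia.
  by case: (boolP (_ \in L)) => // /Ls /=; lia.
case: ha => [ha|[k [kn hk lk]]]; first by constructor 1.
constructor 3; split=> //; exists k; split=> // [j jk|].
  have jn : (j < n)%N by apply: ltn_trans kn.
  by rewrite !aexp_redm !aexpD hM hL hk.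
have kt : (t <= k)%N by rewrite leqNgt; apply/negP => kt; rewrite h0 // m0 in lk.
rewrite !aexp_redm !aexpD hM hL aexp_imon //.
have -> : (s <= k < s + i)%N = false.
  by apply/negbTE/negP => h; case: hit => h'; lia.
by have := m1le k; lia.
Qed.

(** By [lead_cmp] only one pair of monomials reaches the new dominant one, so the coefficient c is
    kept. A factor gamma_{s,i} with i > 0 must fit below the threshold t and lowers it to at most s,
    which imposes multiplication by decreasing s; a factor c_s leaves t unchanged. *)
Lemma lead_mulgamma f m c t t' s i : lead f m c t ->
  (s + i <= n)%N -> (i = 0%N \/ (s + i <= t)%N) -> (t' <= t)%N ->
  ((0 < i)%N -> (t' <= s)%N) ->
  lead (f * gammaR n s i) (redm (m + imon s i)) c t'.
Proof.
move=> hf hsn hit t't t's.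
have cmp := lead_cmp hf hsn hit t't t's.
have irr m1 M L : m1 \in msupp (red f) -> #|M| = s -> #|L| = i -> [disjoint M & L] ->
    redm (m1 + gmon M L) = redm (m + imon s i) ->
    [/\ m1 = m, M = itv n 0 s & L = itv n s i].
  move=> h1 hM hL d e; case: (cmp _ _ _ h1 hM hL d) => //.
    by rewrite e => /lexlt_irr.
  by case=> _ _; rewrite e => /lexlt_irr.
have hs : (s <= n)%N by apply: leq_trans hsn; rewrite leq_addr.
have dis : [disjoint itv n 0 s & itv n s i].
  rewrite -setI_eq0; apply/eqP/setP => k; rewrite !inE add0n /=; lia.
case: (hf) => fm m1le m0 hsup; split.
- rewrite /imon mcoeff_redM_uniq ?red_gammaR ?mcoeff_gammaR ?card_itv ?mulr1 //.
  move=> m1 m2 h1 /msupp_gammaR[M [L [-> hM hL d]]] e.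
  by case: (irr _ _ _ h1 hM hL d e) => -> -> ->.
- by move=> j; rewrite aexp_redm geq_minr.
- move=> j jt'; rewrite aexp_redm aexpD m0 ?(leq_trans jt') //.
  case: (ltnP j n) => jn; last by rewrite aexp_out.
  rewrite aexp_imon //; suff -> : (s <= j < s + i)%N = false by [].
  by apply/negbTE/negP => h; have := t's; lia.
move=> m' /msupp_redM[m1 [m2 [h1]]]; rewrite red_gammaR.
case/msupp_gammaR=> M [L [-> hM hL d]] ->.
case: (cmp _ _ _ h1 hM hL d) => [[-> -> ->]|?|[? ? ?]]; [right|left=>//|right].
  split=> //; last by left.
  move=> j jt'; rewrite aexp_redm aexpD m0 ?(leq_trans jt') //.
  case: (ltnP j n) => jn; last by rewrite aexp_out.
  rewrite aexp_imon //; suff -> : (s <= j < s + i)%N = false by [].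
  by apply/negbTE/negP => h; have := t's; lia.
by split=> //; right.
Qed.

Lemma lead1 t : lead 1 0%MM 1 t.
Proof.
have a0 j : aexp (0%MM : 'X_{1..n + n}) j = 0%N.
  case: (ltnP j n) => jn; last by rewrite aexp_out.
  by rewrite -[j]/(nat_of_ord (Ordinal jn)) aexpE mnmE.
have r1 : red (1 : {mpoly rat[n + n]}) = 1.
  rewrite -mpolyX0 redX; congr 'X_[_].
  by apply: mnm_uaP => j _; rewrite (uexp_redm, aexp_redm) // a0.
split=> [|j|j|m']; rewrite ?a0 //; first by rewrite r1 mcoeff1 eqxx.
rewrite r1 msupp1 inE => /eqP->; right; split=> //; by left.
Qed.

Lemma lead_weak f m c t t' : (t' <= t)%N -> lead f m c t -> lead f m c t'.
Proof.
move=> tt' [h1 h2 h3 h4]; split=> // [j jt|m' /h4 [|[? h ?]]].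
- by apply: h3; apply: leq_trans tt'.
- by left.
- by right; split=> // j jt; apply: h; apply: leq_trans tt'.
Qed.

Lemma lead_msupp f m c t m' : lead f m c t -> m' \in msupp (red f) ->
  m' = m \/ mlexlt m' m.
Proof.
case=> _ _ _ h /h [?|[? _ [->|?]]]; [right|by left|right]; apply/mlexltP; last by right.
by left.
Qed.

End Lead.

Section ProductLead.
Variable n : nat.
Implicit Types (m : 'X_{1..n + n}) (f g : {mpoly rat[n + n]}).

Lemma lead_mulchern f m c t s k : lead f m c t -> (s <= n)%N ->
  exists m', [/\ lead (f * gammaR n s 0 ^+ k) m' c t,
    forall j, (j < n)%N -> uexp m' j = (uexp m j + k * (j < s))%N &
    forall j, aexp m' j = aexp m j].
Proof.
move=> hf sn; elim: k => [|k [m' [h hu ha]]].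
  by exists m; split=> [|j _|//]; rewrite ?mulr1 ?mul0n ?addn0.
exists (redm (m' + imon n s 0)); split.
- rewrite exprSr mulrA; apply: lead_mulgamma h _ _ _ _ => //; last by left.
  by rewrite addn0.
- by move=> j jn; rewrite uexp_redm uexpD uexp_imon // hu // mulSn; lia.
- move=> j; rewrite aexp_redm aexpD ha; case: (hf) => _ /(_ j) hj _ _.
  case: (ltnP j n) => jn; last by rewrite !aexp_out.
  by rewrite aexp_imon //; lia.
Qed.

(** The value [i s = 0] encodes the absence of a gamma with first index s. One gamma per s suffices
    for admissible monomials and for dominant products. The lower end p serves the induction in
    [lead_gprod]. *)
Definition gprod (k i : nat -> nat) p : {mpoly rat[n + n]} :=
  \prod_(p <= s < n.+1) (gammaR n s 0 ^+ k s *
    (if (0 < i s)%N then gammaR n s (i s) else 1)).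

(** Descending induction on p, so that gamma_{p, i p} joins after all factors with s > p. The
    monomial m is chosen before the threshold t: the induction step uses the hypothesis at t or at p
    + i p, according to whether [i p] is zero, and needs the same monomial in both cases. *)
Lemma lead_gprod (k i : nat -> nat) p : (p <= n.+1)%N ->
  (forall s, (p <= s <= n)%N -> (s + i s <= n)%N) ->
  (forall s s', (p <= s)%N -> (s < s' <= n)%N -> (0 < i s)%N -> (0 < i s')%N ->
     (s + i s <= s')%N) ->
  exists m, [/\ forall t, (forall s, (p <= s <= n)%N -> (0 < i s)%N -> (t <= s)%N) ->
      lead (gprod k i p) m 1 t,
    forall j, (j < n)%N ->
      uexp m j = (\sum_(p <= s < n.+1) (k s + (0 < i s)) * (j < s))%N &
    forall j, (j < n)%N ->
      aexp m j = has (fun s => (s <= j < s + i s)%N) (index_iota p n.+1)].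
Proof.
have [d] : {d | d = n.+1 - p}%N by exists (n.+1 - p)%N.
elim: d p => [|d IH] p hd hp hn hs.
  have -> : p = n.+1 by lia.
  exists 0%MM; split=> [t _|j jn|j jn].
  - by rewrite /gprod big_geq //; apply: lead1.
  - rewrite big_geq // -[j]/(nat_of_ord (Ordinal jn)) uexpE mnmE //.
  - by rewrite /index_iota subnn -[j]/(nat_of_ord (Ordinal jn)) aexpE mnmE.
have [||s h|s s' h|m [hl hu ha]] := IH p.+1; [lia|lia|apply: hn; lia|apply: hs; lia|].
have pn : (p < n.+1)%N by lia.
pose t0 := (p + i p)%N.
have hl0 t : (forall s, (p <= s <= n)%N -> (0 < i s)%N -> (t <= s)%N) ->
    exists t', [/\ lead (gprod k i p.+1) m 1 t', i p = 0%N \/ (p + i p <= t')%N & (t <= t')%N].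
  move=> ht; case: (posnP (i p)) => ip.
    exists t; split=> //; last by left.
    by apply: hl => s h; apply: ht; lia.
  exists t0; split; last 1 first.
  - by apply: leq_trans (leq_addr _ _); apply: ht; lia.
  - by apply: hl => s h is0; apply: hs; lia.
  - by right.
have hpn : (p <= n)%N by lia.
have [t1 [hl1 _ _]] := hl0 0%N (fun _ _ _ => isT).
have [m1 [_ hu1 ha1]] := lead_mulchern (k p) hl1 hpn.
have hpi : (p + i p <= n)%N by apply: hn; lia.
have fac : gprod k i p = (gprod k i p.+1 * gammaR n p 0 ^+ k p) *
    (if (0 < i p)%N then gammaR n p (i p) else 1).
  by rewrite /gprod big_ltn // [LHS]mulrC mulrA.
exists (if (0 < i p)%N then redm (m1 + imon n p (i p)) else m1); split.
- move=> t ht; have [t' [hl' hit tt']] := hl0 t ht.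
  have [m2 [hl2 hu2 ha2]] := lead_mulchern (k p) hl' hpn.
  have em : m2 = m1.
    by apply: mnm_uaP => j jn; rewrite ?hu2 ?hu1 ?ha2 ?ha1.
  rewrite em in hl2; rewrite fac; case: posnP => ip.
    by rewrite mulr1; apply: lead_weak hl2.
  apply: (lead_mulgamma hl2) => // _; apply: ht; lia.
- move=> j jn; rewrite big_ltn //; case: posnP => ip.
    by rewrite hu1 // hu // addnC addn0.
  by rewrite uexp_redm uexpD uexp_imon // hu1 // hu //; lia.
- move=> j jn; have -> : index_iota p n.+1 = p :: index_iota p.+1 n.+1.
    by rewrite /index_iota subSn.
  rewrite /=; case: posnP => ip.
    rewrite ha1 ha // ip addn0; suff -> : (p <= j < p)%N = false by [].
    by lia.
  rewrite aexp_redm aexpD aexp_imon // ha1 ha //.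
  by case: (p <= j < p + i p)%N; case: (has _ _).
Qed.

End ProductLead.

(** * Elementary symmetric functions of idempotents and powers of alpha *)

Section GenericGamma.
Variables (B : comNzRingType) (n : nat) (u a : 'I_n -> B).

Lemma gamma_elt_s0 s : gamma_elt u a s 0 = chern_elt u s.
Proof.
apply: eq_bigr => M _; rewrite (bigD1 set0) /=;
  last by rewrite cards0 -setI_eq0 setI0 !eqxx.
rewrite big_set0 mulr1 [X in _ + X]big1 ?addr0 // => L /andP[/andP[/eqP/cards0_eq->]].
by rewrite eqxx.
Qed.

Definition sigma_elt i : B := \sum_(L : {set 'I_n} | #|L| == i) \prod_(l in L) a l.

Lemma gamma_elt_0s i : gamma_elt u a 0 i = sigma_elt i.
Proof.
rewrite /gamma_elt (bigD1 set0) /=; last by rewrite cards0.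
rewrite [X in _ + X]big1 ?addr0; last first.
  by move=> M /andP[/eqP/cards0_eq->]; rewrite eqxx.
apply: eq_big => [L|L _]; last by rewrite big_set0 mul1r.
by rewrite -setI_eq0 set0I eqxx andbT.
Qed.

End GenericGamma.

(** Count the pairs (L, i) by the set [i |: L]: if i is outside L, a set of k + 1 elements arises
    from k + 1 pairs; if i is in L, the set is L itself and arises from its k elements. *)
Lemma sum_setU1 (V : zmodType) (n k : nat) (F : {set 'I_n} -> V) :
  \sum_(L : {set 'I_n} | #|L| == k) \sum_i F (i |: L) =
  (\sum_(L : {set 'I_n} | #|L| == k.+1) F L) *+ k.+1 +
  (\sum_(L : {set 'I_n} | #|L| == k) F L) *+ k.
Proof.
rewrite addrC -!sumrMnl.
have -> : \sum_(L : {set 'I_n} | #|L| == k) F L *+ k =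
    \sum_(L : {set 'I_n} | #|L| == k) \sum_(i in L) F (i |: L).
  apply: eq_bigr => L /eqP Lk.
  rewrite (eq_bigr (fun=> F L)) ?sumr_const ?Lk // => i iL.
  by rewrite (setUidPr _) // sub1set.
have -> : \sum_(L : {set 'I_n} | #|L| == k.+1) F L *+ k.+1 =
    \sum_(L : {set 'I_n} | #|L| == k) \sum_(i | i \notin L) F (i |: L).
  rewrite (exchange_big_dep predT) //=.
  rewrite (eq_bigr (fun L : {set 'I_n} => \sum_(i in L) F L)); last first.
    by move=> L /eqP Lk; rewrite sumr_const Lk.
  rewrite (exchange_big_dep predT) //=; apply: eq_bigr => i _.
  rewrite [RHS](reindex_onto (fun K : {set _} => K :\ i) (fun L => i |: L)) /=; last first.
    by move=> L /andP[_ iL]; rewrite setU1K.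
  apply: eq_big => [K|K /andP[_ iK]]; last by rewrite setD1K.
  rewrite !inE eqxx /= andbT; apply/andP/andP => [[/eqP Kk iK]|[/eqP Kk /eqP e]].
    by rewrite setD1K // eqxx -eqSS -Kk (cardsD1 i K) iK.
  have iK : i \in K by rewrite -e !inE eqxx.
  by rewrite (cardsD1 i K) iK Kk.
rewrite -big_split /=; apply: eq_bigr => L _.
by rewrite (bigID (fun i => i \in L)).
Qed.

Section Alpha.
Variable n : nat.
Implicit Types (m : 'X_{1..n + n}) (f g : {mpoly rat[n + n]}).

Definition sigmaR i : {mpoly rat[n + n]} := sigma_elt (@aR n) i.
Definition alphaR : {mpoly rat[n + n]} := alpha_elt (@aR n).

Lemma sigmaRE i : sigmaR i = \sum_(L : {set 'I_n} | #|L| == i) 'X_[gmon set0 L].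
Proof. by apply: eq_bigr => L _; rewrite -XgmonE big_set0 mul1r. Qed.

Lemma red_sigmaR i : red (sigmaR i) = sigmaR i.
Proof. by rewrite /sigmaR -(gamma_elt_0s (@uR n)) -/(gammaR n 0 i) red_gammaR. Qed.

Lemma sigmaR0 : sigmaR 0 = 1.
Proof.
rewrite /sigmaR /sigma_elt (bigD1 set0) ?cards0 //= big_set0 big1 ?addr0 //.
by move=> L /andP[/eqP/cards0_eq->]; rewrite eqxx.
Qed.

Lemma sigmaR_gt i : (n < i)%N -> sigmaR i = 0.
Proof.
move=> h; rewrite /sigmaR /sigma_elt big_pred0 // => L.
by apply/negbTE; rewrite neq_ltn (leq_ltn_trans (max_card _)) ?card_ord.
Qed.

(** Idempotence turns alpha_i times the monomial of L into the monomial of [i |: L], so [sum_setU1]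
    applies. In the form (alpha - k) sigma_k = (k + 1) sigma_{k+1} this is the source of the falling
    factorials and, for k = n, of the type I relation. *)
Lemma red_alpha_sigma k :
  red (alphaR * sigmaR k) = sigmaR k.+1 *+ k.+1 + sigmaR k *+ k.
Proof.
rewrite !sigmaRE -sum_setU1 /alphaR /alpha_elt mulr_sumr raddf_sum /=.
apply: eq_bigr => L _; rewrite mulr_suml raddf_sum /=; apply: eq_bigr => i _.
have -> : aR i = 'X_[gmon set0 [set i]].
  by rewrite -XgmonE big_set0 mul1r big_set1.
rewrite -mpolyXD redX; congr 'X_[_]; apply: mnm_uaP => j jn.
  by rewrite uexp_redm uexpD -[j]/(nat_of_ord (Ordinal jn)) !uexp_gmon inE.
rewrite aexp_redm aexpD -[j]/(nat_of_ord (Ordinal jn)) !aexp_gmon !inE.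
by case: (_ == _); case: (_ \in _).
Qed.

Lemma alpha_sigma1 : alphaR = sigmaR 1.
Proof.
have := red_alpha_sigma 0; rewrite mulr0n addr0 mulr1n sigmaR0 mulr1 => <-.
rewrite /alphaR /alpha_elt raddf_sum /=; apply: eq_bigr => i _.
rewrite /aR redX; congr 'X_[_]; apply: mnm_uaP => j jn; rewrite ?uexp_redm //.
rewrite aexp_redm -[j]/(nat_of_ord (Ordinal jn)) aexpE mnm1E.
by case: (_ == _).
Qed.

Lemma red_falling i : red (\prod_(k < i) (alphaR - k%:R)) = sigmaR i *+ i`!.
Proof.
elim: i => [|i IH]; first by rewrite big_ord0 -sigmaR0 red_sigmaR.
rewrite big_ord_recr /= -red_mull IH mulrBr mulr_natr mulrnAl -mulrnA.
rewrite raddfB /= 2!raddfMn /= mulrC red_alpha_sigma red_sigmaR mulrnDl.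
by rewrite -!mulrnA [(i`! * i)%N]mulnC addrK factS.
Qed.

Lemma red_alphaX a : exists2 c : nat -> rat, c a = a`!%:R &
  red (alphaR ^+ a) = \sum_(k < a.+1) c k *: sigmaR k.
Proof.
elim: a => [|a [c ca IH]].
  by exists (fun=> 1); rewrite // big_ord1 scale1r expr0 -sigmaR0 red_sigmaR.
(* For k <= a the numbers [c k] are k! times the Stirling numbers of the second kind, and this is
   their recurrence. The test discards the old [c] at a + 1, where its value is unspecified. *)
exists (fun k => (if k == a.+1 then 0 else c k * k%:R) + c k.-1 * k%:R).
  by rewrite eqxx add0r ca factS mulrC natrM.
rewrite exprS -red_mulr IH mulr_sumr raddf_sum /=.
under eq_bigr => k _ do rewrite -scalerAr redZ red_alpha_sigma scalerDr.
rewrite big_split /= addrC; under [RHS]eq_bigr => k _ do rewrite scalerDl.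
rewrite [RHS]big_split /=; congr (_ + _).
  rewrite [RHS]big_ord_recr /= eqxx scale0r addr0; apply: eq_bigr => k _.
  rewrite -[(k : nat) == a.+1]/(nat_of_ord k == a.+1) ltn_eqF //=.
  by rewrite -scaler_nat scalerA.
rewrite [RHS]big_ord_recl /= mulr0 scale0r add0r; apply: eq_bigr => k _.
by rewrite /bump /= add1n -scaler_nat scalerA.
Qed.

(** Weaker than [lead]: the control of low alpha-exponents is only needed while a product is being
    built up. As c may be zero, m is in general only an upper bound of the support. *)
Definition top f m (c : rat) : Prop := (red f)@_m = c /\
  forall m', m' \in msupp (red f) -> m' = m \/ mlexlt m' m.

Lemma lead_top f m c t : lead f m c t -> top f m c.
Proof. by move=> h; split=> [|m']; [case: h | apply: lead_msupp h]. Qed.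

Lemma top_coef_lt f m c m' : top f m c -> mlexlt m m' -> (red f)@_m' = 0.
Proof.
move=> [_ h] lt; apply/memN_msupp_eq0/negP => /h[e|lt'].
  by rewrite e mlexlt_irr in lt.
by have := mlexlt_trans lt lt'; rewrite mlexlt_irr.
Qed.

Lemma topD f g m c : top f m c ->
  (forall m', m' \in msupp (red g) -> mlexlt m' m) -> top (f + g) m c.
Proof.
move=> [h1 h2] hg; split.
  rewrite redD mcoeffD h1 (memN_msupp_eq0 (p := red g)) ?addr0 //.
  by apply/negP => /hg; rewrite mlexlt_irr.
by move=> m' /[!redD] /msuppD_le; rewrite mem_cat => /orP[/h2//|/hg]; right.
Qed.

Lemma top_red f g m c : red f = red g -> top f m c -> top g m c.
Proof. by rewrite /top => ->. Qed.

Lemma topZ f m c a : top f m c -> top (a *: f) m (a * c).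
Proof.
case=> h1 h2; split; first by rewrite redZ mcoeffZ h1.
move=> m' hm'; apply: h2; move: hm'; rewrite !mcoeff_msupp redZ mcoeffZ.
by apply: contraNneq => ->; rewrite mulr0.
Qed.

(** The expected dominant monomial of alpha^a, and equally of sigma_a, times [gprod n k i 1]. The
    condition j < a describes the initial run, the others come from the gammas, each of which also
    makes the u-exponents drop once at its s. *)
Definition bmon a (k i : nat -> nat) : 'X_{1..n + n} :=
  [multinom match split j with
    | inl j => (\sum_(1 <= s < n.+1) (k s + (0 < i s)) * (j < s))%N
    | inr j => (j < a)%N || has (fun s => (s <= j < s + i s)%N) (index_iota 1 n.+1) : nat
    end | j < n + n].

Lemma uexp_bmon a k i j : (j < n)%N -> uexp (bmon a k i) j =
  (\sum_(1 <= s < n.+1) (k s + (0 < i s)) * (j < s))%N.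
Proof.
by move=> jn; rewrite -[j]/(nat_of_ord (Ordinal jn)) uexpE mnmE split_uI.
Qed.

Lemma aexp_bmon a k i j : (j < n)%N -> aexp (bmon a k i) j =
  (j < a)%N || has (fun s => (s <= j < s + i s)%N) (index_iota 1 n.+1).
Proof.
by move=> jn; rewrite -[j]/(nat_of_ord (Ordinal jn)) aexpE mnmE split_aI.
Qed.

Section Runs.
Variables (a : nat) (k i : nat -> nat).
Hypothesis an : (a <= n)%N.
Hypothesis in_n : forall s, (0 < s <= n)%N -> (s + i s <= n)%N.
Hypothesis ai : forall s, (0 < s <= n)%N -> (0 < i s)%N -> (a <= s)%N.
Hypothesis ii : forall s s', (0 < s)%N -> (s < s' <= n)%N ->
  (0 < i s)%N -> (0 < i s')%N -> (s + i s <= s')%N.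

(** As sigma_b is gamma_{0,b}, the product is a [gprod] starting at s = 0, with no power of c_0. *)
Lemma top_sigma_gprod b : (b <= a)%N ->
  top (sigmaR b * gprod n k i 1) (bmon b k i) 1.
Proof.
move=> ba; pose i' s := if s is 0 then b else i s.
pose k' s := if s is 0 then 0%N else k s.
have [|s s' _ ss'|m [hl hu ha]] := @lead_gprod n k' i' 0 isT.
- by case=> [|s] hs /=; [apply: leq_trans an | apply: in_n].
- case: s ss' => [|s]; case: s' => [|s'] //= ss' i0 i0'; last exact: ii.
  by apply: leq_trans ba (ai _ i0').
have -> : sigmaR b * gprod n k i 1 = gprod n k' i' 0.
  rewrite [RHS]/gprod big_ltn //= mul1r; congr (_ * _).
    case: posnP => [->|_]; first exact: sigmaR0.
    by rewrite /gammaR gamma_elt_0s.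
  rewrite /gprod big_nat [RHS]big_nat; apply: eq_bigr => s /andP[s0 _].
  by case: s s0.
suff -> : bmon b k i = m by apply: (lead_top (t := 0)); apply: hl.
apply: mnm_uaP => j jn; rewrite ?uexp_bmon ?aexp_bmon ?hu ?ha //.
  rewrite [RHS]big_ltn //= muln0 add0n big_nat [RHS]big_nat.
  by apply: eq_bigr => -[|s].
have -> : index_iota 0 n.+1 = 0%N :: index_iota 1 n.+1.
  by rewrite /index_iota subn0 subn1.
congr (nat_of_bool (_ || _)); apply: eq_in_has => -[|s] //.
by rewrite mem_index_iota.
Qed.

Lemma bmon_lt b : (b < a)%N -> mlexlt (bmon b k i) (bmon a k i).
Proof.
move=> ba; apply/mlexltP; right; split=> [j jn|]; first by rewrite !uexp_bmon.
exists b; split=> [|j jb|]; first exact: leq_trans an.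
  rewrite !aexp_bmon ?jb ?(ltn_trans jb ba) //; exact: (leq_trans (ltn_trans jb ba)).
have bn := leq_trans ba an.
rewrite !aexp_bmon // ltnn ba /=.
case: hasP => // -[s]; rewrite mem_index_iota => hs /andP[h1 h2].
by have := @ai s; lia.
Qed.

(** Expand alpha^a in the sigma_b with b <= a. For b < a the initial run is shorter and the monomial
    smaller, by [bmon_lt]; sigma_a carries the coefficient a!. *)
Lemma top_alpha_gprod :
  top (alphaR ^+ a * gprod n k i 1) (bmon a k i) a`!%:R.
Proof.
have [c ca e] := red_alphaX a; rewrite -ca -[c a]mulr1.
apply: (top_red (f := (\sum_(b < a.+1) c b *: sigmaR b) * gprod n k i 1)).
  by rewrite -e red_mull.
rewrite mulr_suml big_ord_recr /= addrC; apply: topD.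
  by rewrite -scalerAl; apply/topZ/top_sigma_gprod.
move=> m'; rewrite raddf_sum /= => hm'.
have [b hb] : exists b : 'I_a, m' \in msupp (red (sigmaR b * gprod n k i 1)).
  apply/existsP; apply: contraLR hm' => /existsPn h.
  rewrite -mcoeff_eq0 raddf_sum big1 // => b _ /=.
  by rewrite -scalerAl redZ mcoeffZ (memN_msupp_eq0 (h b)) mulr0.
have lt := bmon_lt (ltn_ord b).
case: (top_sigma_gprod (ltnW (ltn_ord b))) => _ /(_ _ hb)[->//|].
by move=> lt'; apply: mlexlt_trans lt.
Qed.

End Runs.
End Alpha.

HB.instance Definition _ n := GRing.RMorphism.copy (@evalR n)
  (aeval (fun k => gen_elt (@uR n) (@aR n) (enum_val k))).

(** * Dominant terms of invariants, and the algorithm *)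

Section EvalR.
Variable n : nat.

Lemma evalRZ (c : rat) (p : {mpoly rat[ngen n]}) : evalR (c *: p) = c *: evalR p.
Proof. exact: aevalZ. Qed.

Lemma evalR_gen v : evalR (Xgen rat v) = gen_elt (@uR n) (@aR n) v.
Proof. by rewrite /evalR aevalX enum_rankK. Qed.

Lemma evalR_alpha : evalR (Xalpha rat n) = alphaR n.
Proof. exact: evalR_gen. Qed.

Lemma evalR_gamma g : evalR (Xgamma rat g) = gammaR n (gs g) (gi g).
Proof. exact: evalR_gen. Qed.

Lemma XcE (A : comNzRingType) s (h : (s < n)%N) :
  Xc A n s.+1 = Xgen A (inl (inr (Ordinal h))).
Proof.
rewrite /Xc; case: pickP => [i /eqP [e]|/(_ (Ordinal h))]; last by rewrite eqxx.
by congr (Xgen _ (inl (inr _))); apply: val_inj.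
Qed.

Lemma evalR_c s : (0 < s <= n)%N -> evalR (Xc rat n s) = gammaR n s 0.
Proof.
by case: s => // s h; rewrite (XcE _ h) evalR_gen /gammaR gamma_elt_s0.
Qed.

Lemma evalR_gam s i : (0 < s)%N -> (s + i <= n)%N ->
  evalR (Xgam n s i) = gammaR n s i.
Proof.
move=> s0 hn; rewrite /Xgam eqn0Ngt s0 /=; case: eqP hn => [->|/eqP i0] hn.
  by rewrite evalR_c // s0 -[s]addn0.
case: pickP => [g /andP[/eqP <- /eqP <-]|]; first exact: evalR_gamma.
have hs : (s < n.+1)%N by lia.
have hi : (i < n.+1)%N by lia.
pose p : 'I_n.+1 * 'I_n.+1 := (Ordinal hs, Ordinal hi).
have hp : [&& 0 < p.1, 0 < p.2 & p.1 + p.2 <= n]%N by rewrite /= s0 lt0n i0.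
by move/(_ (exist _ p hp)); rewrite /gs /gi /= !eqxx.
Qed.

Lemma red_evalR_gam0 i : red (evalR (Xgam n 0 i)) = sigmaR n i.
Proof.
rewrite /Xgam /= evalRZ redZ rmorph_prod /=.
under eq_bigr => k _ do rewrite rmorphB rmorph_nat /= evalR_alpha.
rewrite red_falling -scaler_nat scalerA mulVf ?scale1r //.
by rewrite Num.Theory.pnatr_eq0 -lt0n fact_gt0.
Qed.

End EvalR.

Section Dominant.
Variable n : nat.
Implicit Types (m : 'X_{1..n + n}) (f g : {mpoly rat[n + n]}).

Lemma mlexlt0 m : mlexlt m 0%MM = false.
Proof.
apply/negP => /mlexltE [k [kn _]].
by rewrite -[k]/(nat_of_ord (Ordinal kn)) -!mnm_nth mnm0E.
Qed.

Lemma dominantP f : red f != 0 -> dominant f \in msupp (red f) /\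
  top f (dominant f) (red f)@_(dominant f).
Proof.
have fold s : let r := foldr (fun m acc => if mlexlt acc m then m else acc) 0%MM s in
    (r = 0%MM \/ r \in s) /\ forall m, m \in s -> m = r \/ mlexlt m r.
  elim: s => [|x s [IH1 IH2]] /=; first by split=> //; left.
  set r := foldr _ _ _ in IH1 IH2 *; case: ifPn => [lt|nlt].
    split=> [|m]; first by right; rewrite inE eqxx.
    rewrite inE => /orP[/eqP|/IH2[->|h]]; [by left|by right|right].
    exact: mlexlt_trans lt.
  split=> [|m]; first by case: IH1 => h; [left|right; rewrite inE h orbT].
  rewrite inE => /orP[/eqP->|/IH2//].
  case: (mlexlt_total x r) nlt => [->|lt _|->//]; [by left|by right].
move=> nz; have [h1 h2] := fold (msupp (red f)); split; last by split.
(* The fold may return its starting value [0%MM] without having met it. Nothing is smaller than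
   [0%MM], so any monomial of the support must then be equal to it. *)
case: h1 => [h1|//].
have [m hm] : exists m, m \in msupp (red f).
  move: nz; rewrite -msupp_eq0; case: (msupp _) => // m s _.
  by exists m; rewrite inE eqxx.
by case: (h2 _ hm) => [e|]; [rewrite /dominant -e | rewrite h1 mlexlt0].
Qed.

Lemma top_neq0 f m c : top f m c -> c != 0 -> red f != 0.
Proof. by case=> <- _; apply: contraNneq => ->; rewrite mcoeff0. Qed.

Lemma top_dominant f m c : top f m c -> c != 0 -> dominant f = m.
Proof.
move=> ht c0; have [h1 [_ h2]] := dominantP (top_neq0 ht c0).
case: ht => h3 h4; case: (h4 _ h1) => // lt.
have /h2[//|lt'] : m \in msupp (red f) by rewrite mcoeff_msupp h3.
by have := mlexlt_trans lt lt'; rewrite mlexlt_irr.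
Qed.

Definition mact (tau : 'S_n) m : 'X_{1..n + n} :=
  [multinom m (act_var tau^-1 k) | k < n + n].

Lemma act_varK (tau : 'S_n) : cancel (act_var tau) (act_var tau^-1).
Proof.
move=> k; rewrite -(splitK k); case: (split k) => i.
  by rewrite -[unsplit _]/(uI i) !act_var_u permK.
by rewrite -[unsplit _]/(aI i) !act_var_a permK.
Qed.

Lemma act_mpolyXm (tau : 'S_n) m :
  act_mpoly tau ('X_[m] : {mpoly rat[n + n]}) = 'X_[mact tau m].
Proof.
rewrite /act_mpoly /aeval mmapX /mmap1 mpolyXE_id.
rewrite [RHS](reindex_inj (can_inj (act_varK tau))) /=.
by apply: eq_bigr => k _; rewrite mnmE act_varK.
Qed.

Lemma uexp_mact tau m (i : 'I_n) : uexp (mact tau m) i = uexp m (tau^-1%g i).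
Proof. by rewrite !uexpE mnmE act_var_u. Qed.

Lemma aexp_mact tau m (i : 'I_n) : aexp (mact tau m) i = aexp m (tau^-1%g i).
Proof. by rewrite !aexpE mnmE act_var_a. Qed.

Lemma redm_mact tau m : redm (mact tau m) = mact tau (redm m).
Proof.
apply: mnm_uaP => j jn; rewrite -[j]/(nat_of_ord (Ordinal jn)).
  by rewrite uexp_redm !uexp_mact uexp_redm.
by rewrite aexp_redm !aexp_mact aexp_redm.
Qed.

Lemma act_mpolyZ tau (c : rat) f : act_mpoly tau (c *: f) = c *: act_mpoly tau f.
Proof. exact: aevalZ. Qed.

Lemma red_act tau f : red (act_mpoly tau f) = act_mpoly tau (red f).
Proof.
rewrite [in LHS](mpolyE f) [X in _ = act_mpoly _ X]/red.
rewrite !(raddf_sum (act_mpoly tau)) raddf_sum /=; apply: eq_bigr => m _.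
by rewrite !act_mpolyZ !act_mpolyXm redZ redX redm_mact.
Qed.

Lemma mact_inj tau : injective (mact tau).
Proof.
move=> m m' /mnmP e; apply/mnmP => k.
by have := e (act_var tau k); rewrite !mnmE act_varK.
Qed.

Lemma mcoeff_act tau f m : (act_mpoly tau f)@_(mact tau m) = f@_m.
Proof.
rewrite [in LHS](mpolyE f) (raddf_sum (act_mpoly tau)) raddf_sum /=.
rewrite (eq_bigr (fun m' => f@_m' * (m' == m)%:R)); last first.
  move=> m' _; rewrite act_mpolyZ act_mpolyXm mcoeffZ mcoeffX.
  by rewrite (inj_eq (@mact_inj tau)).
case: (boolP (m \in msupp f)) => hm.
  rewrite (bigD1_seq m) ?msupp_uniq //= eqxx mulr1 big1 ?addr0 // => m' /negbTE ->.
  by rewrite mulr0.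
rewrite (memN_msupp_eq0 hm) big_seq big1 // => m' hm'.
by case: eqP => [e|]; rewrite ?mulr0 // -e hm' in hm *.
Qed.

(* The monomials that are dominant terms of invariants: sorting the variables
   by a permutation cannot make them greater. *)
Definition good m : Prop := (forall j, (aexp m j <= 1)%N) /\
  forall j, (j.+1 < n)%N -> (uexp m j.+1 < uexp m j)%N \/
    uexp m j.+1 = uexp m j /\ (aexp m j.+1 <= aexp m j)%N.

(** Transpositions of neighbours suffice: by invariance the transposed monomial is again in the
    support, hence not above the dominant one, and position j is the first where the two can differ
    within either block. *)
Lemma good_dominant f : in_invariantsR f -> red f != 0 -> good (dominant f).
Proof.
move=> hf nz; have [hd [_ ht]] := dominantP nz; set m := dominant f in hd ht *.
split=> [j|j jn]; first exact: aexp_msupp_red hd.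
pose i1 : 'I_n := Ordinal (ltnW jn); pose i2 : 'I_n := Ordinal jn.
pose tau := tperm i1 i2.
have hm : mact tau m \in msupp (red f).
  by rewrite -(hf tau) red_act mcoeff_msupp mcoeff_act -mcoeff_msupp.
have tV : tau^-1%g = tau by apply: tpermV.
have e1 k : (k < j)%N -> uexp (mact tau m) k = uexp m k /\
    aexp (mact tau m) k = aexp m k.
  move=> kj; have kn : (k < n)%N by lia.
  rewrite -[k]/(nat_of_ord (Ordinal kn)) uexp_mact aexp_mact tV tpermD //.
    by rewrite -val_eqE /=; lia.
  by rewrite -val_eqE /=; lia.
have eu1 : uexp (mact tau m) i1 = uexp m j.+1 by rewrite uexp_mact tV tpermL.
have ea1 : aexp (mact tau m) i1 = aexp m j.+1 by rewrite aexp_mact tV tpermL.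
have nlt : ~ mlexlt m (mact tau m).
  move=> lt; case: (ht _ hm) => [e|lt']; first by rewrite e mlexlt_irr in lt.
  by have := mlexlt_trans lt lt'; rewrite mlexlt_irr.
case: (ltngtP (uexp m j.+1) (uexp m j)) => [|lt|eu]; first by left.
  case: nlt; apply/mlexltP; left; exists j; split=> [|k /e1[->]//|]; first exact: ltnW.
  by rewrite -[X in uexp (mact _ _) X]/(nat_of_ord i1) eu1.
right; split=> //; rewrite leqNgt; apply/negP => lt.
case: nlt; apply/mlexltP; right; split=> [k kn|].
  rewrite -[k]/(nat_of_ord (Ordinal kn)) uexp_mact tV.
  by case: tpermP => [->|->|] /=; rewrite ?eu.
exists j; split=> [|k /e1[_ ->]//|]; first exact: ltnW.
by rewrite -[X in aexp (mact _ _) X]/(nat_of_ord i1) ea1.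
Qed.

End Dominant.

Section Runs.
Variable n : nat.
Implicit Type m : 'X_{1..n + n}.

Lemma run_le m s : (s <= n)%N -> (s + run m s <= n)%N.
Proof.
move=> sn; have sz : size (aexps m) = n by rewrite size_map size_enum_ord.
rewrite /run; case: ifP => _; last by rewrite addn0.
by have := find_size (pred1 0%N) (drop s (aexps m)); rewrite size_drop sz; lia.
Qed.

Lemma run_in m s j : (s <= j < s + run m s)%N -> aexp m j != 0%N.
Proof.
rewrite /run; case: ifP => _; last by rewrite addn0; lia.
move=> h; have /(before_find 0%N) : (j - s < find (pred1 0%N) (drop s (aexps m)))%N.
  by lia.
by rewrite nth_drop subnKC /= => [->//|]; lia.
Qed.

Lemma run_pred m s : (0 < s)%N -> (0 < run m s)%N -> aexp m s.-1 = 0%N.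
Proof. by rewrite /run; case: s => //= s _; case: eqP. Qed.

Lemma run_cover m j : aexp m j != 0%N -> exists2 s, (s <= j)%N & (j < s + run m s)%N.
Proof.
elim: j => [|j IH] hj.
  exists 0%N => //; rewrite add0n /run /= drop0 lt0n.
  by apply: contra hj; rewrite /aexp; case: (aexps m) => [|x t] //=; case: (x =P 0%N).
have sz : size (aexps m) = n by rewrite size_map size_enum_ord.
have jn : (j.+1 < n)%N by rewrite ltnNge; apply: contra hj => /aexp_out ->.
case: (eqVneq (aexp m j) 0%N) => [e|/IH[s sj js]].
  exists j.+1 => //; rewrite /run /= -/(aexp m j) e eqxx.
  rewrite (drop_nth 0%N) ?sz //= -/(aexp m j.+1) (negbTE hj).
  by rewrite addnS leq_addr.
exists s; first exact: leqW.
rewrite leqNgt; apply/negP => h; have ej : (s + run m s = j.+1)%N by lia.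
have r0 : (0 < run m s)%N by lia.
move: ej r0; rewrite /run; case: ifP => // _ ej _.
have hs : has (pred1 0%N) (drop s (aexps m)) = false.
  apply/negbTE/negP => /(nth_find 0%N) /=; rewrite nth_drop ej -/(aexp m j.+1).
  by rewrite (negbTE hj).
by move: ej; rewrite hasNfind ?hs // size_drop sz; lia.
Qed.

(** Strict, because a run can start at s' > 0 only after a zero at s' - 1, which an earlier run
    cannot cover. This is where the strict inequalities a < s and s + i < t of [admissible] come
    from. *)
Lemma run_lt m s s' : (s < s')%N -> (0 < run m s')%N -> (s + run m s < s')%N.
Proof.
move=> ss' r'; rewrite ltnNge; apply/negP => h.
have := @run_in m s s'.-1; rewrite run_pred //; last by lia.
have -> : (s <= s'.-1 < s + run m s)%N by lia.
by move/(_ isT).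
Qed.

Lemma run_drop m s : good m -> (0 < s)%N -> (0 < run m s)%N ->
  (uexp m s < uexp m s.-1)%N.
Proof.
move=> [_ h] s0 r0; have e0 := run_pred s0 r0.
have e1 : aexp m s != 0%N by apply: (@run_in m s); lia.
have sn : (s < n)%N by rewrite ltnNge; apply: contra e1 => /aexp_out ->.
case: s s0 r0 e0 e1 sn => // s _ _ /= e0 e1 sn; case: (h s sn) => // -[_].
by rewrite e0 leqn0 (negbTE e1).
Qed.

Lemma good_uexp m j : good m -> (uexp m j.+1 <= uexp m j)%N.
Proof.
move=> [_ h]; case: (ltnP j.+1 n) => jn; last by rewrite uexp_out.
by case: (h j jn) => [/ltnW|[->]].
Qed.

Lemma telescope_lt (u : nat -> nat) j N : (forall i, (u i.+1 <= u i)%N) -> (j <= N)%N ->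
  (\sum_(1 <= s < N.+1) (u s.-1 - u s) * (j < s) = u j - u N)%N.
Proof.
move=> hu /subnKC <-; elim: (N - j)%N => [|d IH].
  rewrite addn0 subnn big_nat big1 // => s hs.
  have -> : (j < s)%N = false by lia.
  by rewrite muln0.
rewrite addnS big_nat_recr //= IH ltnS leq_addr muln1.
have : (u (j + d)%N <= u j)%N; last by have := hu (j + d)%N; lia.
by elim: d {IH} => [|d IH]; rewrite ?addn0 // addnS (leq_trans (hu _)).
Qed.

Definition jump m s : nat := (uexp m s.-1 - uexp m s)%N.

Lemma sum_jump m j : good m -> (j < n)%N ->
  (\sum_(1 <= s < n.+1) jump m s * (j < s) = uexp m j)%N.
Proof.
move=> gm jn; rewrite /jump telescope_lt ?(ltnW jn) // => [|i]; last exact: good_uexp.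
by rewrite (@uexp_out _ m n) // subn0.
Qed.

End Runs.

Section DominantProduct.
Variable n : nat.
Implicit Type m : 'X_{1..n + n}.

Lemma top_dominant_product m : good m -> top (evalR (dominant_product m)) m 1.
Proof.
move=> gm; have [ale _] := gm.
pose i s := run m s.
(* [dominant_product] takes one factor gamma_{s, run m s} at each drop, which is again c_s if the
   run is empty; so a power of c_s is lost only where a run is present. *)
pose k s := if jump m s == 0%N then 0%N else (jump m s - (0 < i s))%N.
have jmp s : (0 < s)%N -> (0 < i s)%N -> (0 < jump m s)%N.
  by move=> s0 r0; rewrite subn_gt0 run_drop.
have an : (run m 0 <= n)%N by rewrite -[run m 0]add0n run_le.
have ht := @top_sigma_gprod n (run m 0) k i an _ _ _ (run m 0) (leqnn _).
have {ht} : top (sigmaR n (run m 0) * gprod n k i 1) (bmon n (run m 0) k i) 1.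
  apply: ht => [s hs|s hs r0|s s' s0 hs r r'].
  - by apply: run_le; lia.
  - by rewrite -[run m 0]add0n; apply/ltnW/run_lt => //; lia.
  - by apply/ltnW/run_lt => //; lia.
have -> : bmon n (run m 0) k i = m.
  apply: mnm_uaP => j jn; rewrite ?uexp_bmon ?aexp_bmon //.
    rewrite -[RHS](sum_jump gm jn) big_nat [RHS]big_nat; apply: eq_bigr => s hs.
    congr (_ * _)%N; rewrite /k; have := @jmp s; case: posnP; case: eqP; lia.
  have := ale j; case: (posnP (aexp m j)) => [e _|h0 h1].
    rewrite e; apply/eqP; rewrite eqb0 negb_or; apply/andP; split.
      rewrite -leqNgt leqNgt; apply/negP => h.
      by have := @run_in n m 0 j; rewrite add0n h e => /(_ isT).
    apply/hasPn => s _; apply/negP => /run_in; by rewrite e.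
  have -> : aexp m j = 1%N by lia.
  apply/eqP; rewrite eqb1; have [s sj js] := @run_cover n m j (lt0n_neq0 h0).
  case: s sj js => [|s] sj js; first by rewrite -[run m 0]add0n js.
  apply/orP; right; apply/hasP; exists s.+1; last by rewrite sj js.
  by rewrite mem_index_iota; lia.
apply: top_red; rewrite /dominant_product rmorphM -[RHS]red_mull red_evalR_gam0.
congr (red (_ * _)); rewrite rmorph_prod /gprod big_nat [RHS]big_nat.
apply: eq_bigr => s /andP[s0 sn]; rewrite -/(jump m s) /k -/(i s).
have hsi : (s + i s <= n)%N by apply: run_le.
have := @jmp s s0; case: eqP => [->|/eqP j0].
  case: posnP => [_ _|_ /(_ isT)]; last by rewrite ltnn.
  by rewrite expr0 mul1r rmorph1.
move=> _; rewrite rmorphM rmorphXn /= evalR_c ?s0 // evalR_gam //.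
case: posnP => [->|_]; last by rewrite subn1.
by rewrite subn0 mulr1 -exprSr prednK // lt0n.
Qed.

End DominantProduct.

(** * Additive weights on monomials in the generators *)

Section Weights.
Variable n : nat.
Implicit Types (M : 'X_{1..ngen n}) (p q : {mpoly rat[ngen n]}).

(** One notion of weight serves both for the grading of the generators and for each component of the
    termination order. *)
Definition wdeg (wt : gname n -> nat) M : nat :=
  (\sum_(k < ngen n) M k * wt (enum_val k))%N.

Lemma wdegD wt M N : wdeg wt (M + N) = (wdeg wt M + wdeg wt N)%N.
Proof. by rewrite -big_split; apply: eq_bigr => k _; rewrite mnmDE mulnDl. Qed.

Lemma wdegU wt v : wdeg wt U_(enum_rank v) = wt v.
Proof.
rewrite /wdeg (bigD1 (enum_rank v)) //= mnm1E eqxx mul1n enum_rankK big1 ?addn0 //.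
by move=> k; rewrite mnm1E eq_sym => /negbTE ->.
Qed.

Lemma wdeg0 wt : wdeg wt 0 = 0%N.
Proof. by rewrite /wdeg big1 // => k _; rewrite mnm0E. Qed.

Definition whomog wt d p := forall M, M \in msupp p -> wdeg wt M = d.

Lemma whomog0 wt d : whomog wt d 0.
Proof. by move=> M; rewrite msupp0. Qed.

Lemma whomog1 wt : whomog wt 0 1.
Proof. by move=> M; rewrite msupp1 inE => /eqP ->; rewrite wdeg0. Qed.

Lemma whomogD wt d p q : whomog wt d p -> whomog wt d q -> whomog wt d (p + q).
Proof. by move=> hp hq M /msuppD_le; rewrite mem_cat => /orP[/hp|/hq]. Qed.

Lemma whomogZ wt d c p : whomog wt d p -> whomog wt d (c *: p).
Proof. by move=> hp M /msuppZ_le /hp. Qed.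

Lemma whomogM wt d e p q : whomog wt d p -> whomog wt e q -> whomog wt (d + e) (p * q).
Proof.
move=> hp hq M /msuppM_le /allpairsP[[M1 M2] /= [/hp <- /hq <- ->]].
by rewrite wdegD.
Qed.

Lemma whomogX wt d p k : whomog wt d p -> whomog wt (k * d) (p ^+ k).
Proof.
move=> hp; elim: k => [|k IH]; first exact: whomog1.
by rewrite exprS mulSn; apply: whomogM.
Qed.

Lemma whomog_gen wt v : whomog wt (wt v) (Xgen rat v).
Proof. by move=> M; rewrite msuppX inE => /eqP ->; apply: wdegU. Qed.

Lemma whomog_prod wt (I : Type) (r : seq I) (P : pred I) (d : I -> nat)
    (F : I -> {mpoly rat[ngen n]}) : (forall i, P i -> whomog wt (d i) (F i)) ->
  whomog wt (\sum_(i <- r | P i) d i)%N (\prod_(i <- r | P i) F i).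
Proof.
by move=> h; elim/big_rec2: _ => [|i e q Pi]; [apply: whomog1 | apply: whomogM (h i Pi)].
Qed.

(* Weights are specified by the weight w0 of alpha and the weight w s i of
   gamma_{s,i}, with c_s = gamma_{s,0}. *)
Definition wgt (w0 : nat) (w : nat -> nat -> nat) (v : gname n) : nat :=
  match v with
  | inl (inl _) => w0
  | inl (inr i) => w i.+1 0%N
  | inr g => w (gs g) (gi g)
  end.

Lemma whomog_alpha w : whomog (wgt 0 w) 0 (Xalpha rat n).
Proof. exact: (@whomog_gen (wgt 0 w) (inl (inl tt))). Qed.

Lemma whomog_c w0 w s : (0 < s <= n)%N -> whomog (wgt w0 w) (w s 0%N) (Xc rat n s).
Proof.
case: s => // s h; rewrite (XcE _ h).
exact: (@whomog_gen (wgt w0 w) (inl (inr (Ordinal h)))).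
Qed.

Lemma whomog_gamma w0 w g : whomog (wgt w0 w) (w (gs g) (gi g)) (Xgamma rat g).
Proof. exact: (@whomog_gen (wgt w0 w) (inr g)). Qed.

Lemma whomog_gam w0 w s i : (0 < s)%N -> (s + i <= n)%N ->
  whomog (wgt w0 w) (w s i) (Xgam n s i).
Proof.
move=> s0 hn; rewrite /Xgam eqn0Ngt s0 /=; case: eqP hn => [->|_] hn.
  by apply: whomog_c; rewrite s0 -[s]addn0.
case: pickP => [g /andP[/eqP <- /eqP <-]|_]; first exact: whomog_gamma.
exact: whomog0.
Qed.

Lemma whomog_gam0 w i : whomog (wgt 0 w) 0 (Xgam n 0 i).
Proof.
rewrite /Xgam /=; apply: whomogZ; elim/big_ind: _ => [|p q hp hq|k _].
- exact: whomog1.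
- exact: (whomogM hp hq).
- apply: whomogD; first exact: whomog_alpha.
  rewrite -scaleN1r -scaler_nat scalerA; exact/whomogZ/whomog1.
Qed.

(** The falling factorial is not homogeneous in alpha, so the power of alpha is only bounded,
    whereas all weights that ignore alpha are determined exactly. *)
Lemma alpha_le_gam0 i M : M \in msupp (Xgam n 0 i) ->
  (wdeg (wgt 1 (fun _ _ => 0%N)) M <= i)%N.
Proof.
rewrite /Xgam /= => /msuppZ_le; elim: i M => [|i IH] M.
  by rewrite big_ord0 msupp1 inE => /eqP->; rewrite wdeg0.
rewrite big_ord_recr /= => /msuppM_le /allpairsP[[M1 M2] /= [/IH h1 h2 ->]].
rewrite wdegD -[i.+1]addn1 leq_add //.
move: h2 => /msuppB_le; rewrite mem_cat => /orP[|].
  by rewrite msuppX inE => /eqP->; rewrite wdegU.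
by rewrite -scaler_nat => /msuppZ_le; rewrite msupp1 inE => /eqP->; rewrite wdeg0.
Qed.

Definition dpweight (w : nat -> nat -> nat) (m : 'X_{1..n + n}) : nat :=
  (\sum_(1 <= s < n.+1) if jump m s == 0 then 0 else
     (jump m s).-1 * w s 0%N + w s (run m s))%N.

Lemma whomog_jumps w0 w m : whomog (wgt w0 w) (dpweight w m)
  (\prod_(1 <= s < n.+1) let k := (uexp m s.-1 - uexp m s)%N in
    if k == 0%N then 1 else Xc rat n s ^+ k.-1 * Xgam n s (run m s)).
Proof.
rewrite /dpweight big_nat [X in whomog _ _ X]big_nat; apply: whomog_prod => s /andP[s0 sn].
rewrite -/(jump m s); case: eqP => _; first exact: whomog1.
by apply: whomogM; [apply/whomogX/whomog_c; rewrite s0 | apply: whomog_gam; rewrite ?run_le].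
Qed.

Lemma whomog_dominant_product w m : whomog (wgt 0 w) (dpweight w m) (dominant_product m).
Proof.
rewrite /dominant_product -[dpweight w m]add0n.
apply: whomogM; [exact: whomog_gam0 | exact: whomog_jumps].
Qed.

Lemma alpha_le_dominant_product m M : M \in msupp (dominant_product m) ->
  (wdeg (wgt 1 (fun _ _ => 0%N)) M <= run m 0)%N.
Proof.
rewrite /dominant_product => /msuppM_le /allpairsP[[M1 M2] /= [/alpha_le_gam0 h1 h2 ->]].
rewrite wdegD (@whomog_jumps 1 (fun _ _ => 0%N) m M2 h2) /dpweight big1 ?addn0 // => s _.
by case: ifP; rewrite ?muln0.
Qed.

End Weights.

Section Homogeneous.
Variable n : nat.
Implicit Types (m : 'X_{1..n + n}) (f g : {mpoly rat[n + n]}).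

Lemma mdegRE m : mdegR m = (\sum_(j < n) uexp m j)%N.
Proof. by apply: eq_bigr => j _; rewrite uexpE. Qed.

Lemma mdegRD m1 m2 : mdegR (m1 + m2) = (mdegR m1 + mdegR m2)%N.
Proof. by rewrite /mdegR -big_split; apply: eq_bigr => j _; rewrite mnmDE. Qed.

Lemma mdegR_redm m : mdegR (redm m) = mdegR m.
Proof. by rewrite !mdegRE; apply: eq_bigr => j _; rewrite uexp_redm. Qed.

Lemma mdegR_gmon (M L : {set 'I_n}) : mdegR (gmon M L) = #|M|.
Proof.
rewrite mdegRE -sum1_card [RHS]big_mkcond; apply: eq_bigr => j _.
by rewrite uexp_gmon; case: (_ \in _).
Qed.

Lemma homogRP d f : reflect (forall m, m \in msupp (red f) -> mdegR m = d) (homogR d f).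
Proof.
by apply: (iffP allP) => h m /h /eqP.
Qed.

Lemma homogRD d f g : homogR d f -> homogR d g -> homogR d (f + g).
Proof.
move=> /homogRP hf /homogRP hg; apply/homogRP => m; rewrite redD.
by move/msuppD_le; rewrite mem_cat => /orP[/hf|/hg].
Qed.

Lemma homogRZ d c f : homogR d f -> homogR d (c *: f).
Proof.
move=> /homogRP hf; apply/homogRP => m; rewrite redZ => /msuppZ_le; exact: hf.
Qed.

Lemma homogRB d f g : homogR d f -> homogR d g -> homogR d (f - g).
Proof. by move=> hf hg; rewrite -scaleN1r; apply/homogRD/homogRZ. Qed.

Lemma homogRM d e f g : homogR d f -> homogR e g -> homogR (d + e) (f * g).
Proof.
move=> /homogRP hf /homogRP hg; apply/homogRP => m /msupp_redM[m1 [m2 [h1 h2 ->]]].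
by rewrite mdegR_redm mdegRD (hf _ h1) (hg _ h2).
Qed.

Lemma homogR_red d f : homogR d (red f) = homogR d f.
Proof. by rewrite /homogR red_red. Qed.

Lemma homogR0 d : homogR d (0 : {mpoly rat[n + n]}).
Proof. by rewrite /homogR red0 msupp0. Qed.

Lemma homogR1 : homogR 0 (1 : {mpoly rat[n + n]}).
Proof.
apply/homogRP => m; rewrite -sigmaR0 red_sigmaR sigmaR0 msupp1 inE => /eqP->.
by rewrite /mdegR big1 // => j _; rewrite mnm0E.
Qed.

Lemma homogR_gamma s i : homogR s (gammaR n s i).
Proof.
apply/homogRP => m; rewrite red_gammaR => /msupp_gammaR[M [L [-> <- _ _]]].
exact: mdegR_gmon.
Qed.

Lemma homogR_gen (v : gname n) : homogR (gdeg v) (evalR (Xgen rat v)).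
Proof.
case: v => [[[]|i]|g].
- rewrite (_ : evalR _ = gammaR n 0 1) /= ?homogR_gamma //.
  by rewrite /gammaR gamma_elt_0s -/(sigmaR n 1) -alpha_sigma1 -evalR_alpha.
- rewrite evalR_gen /= -(gamma_elt_s0 (@uR n) (@aR n)); exact: homogR_gamma.
- by rewrite evalR_gamma homogR_gamma.
Qed.

Lemma evalRX (M : 'X_{1..ngen n}) : evalR 'X_[M] =
  \prod_(k < ngen n) evalR (Xgen rat (enum_val k)) ^+ M k.
Proof.
rewrite mpolyXE_id rmorph_prod; apply: eq_bigr => k _ /=.
by rewrite rmorphXn /= /Xgen enum_valK.
Qed.

Lemma gdegE : @gdeg n =1 wgt 0 (fun s _ => s).
Proof. by case=> [[[]|i]|g]. Qed.

Lemma homogGP d (p : {mpoly rat[ngen n]}) :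
  reflect (whomog (wgt 0 (fun s _ => s)) d p) (homogG d p).
Proof.
have e (M : 'X_{1..ngen n}) : (\sum_(k < ngen n) M k * gdeg (enum_val k) =
    wdeg (wgt 0 (fun s _ => s)) M :> nat)%N.
  by apply: eq_bigr => k _; rewrite gdegE.
by apply: (iffP allP) => h M /h; rewrite e => /eqP.
Qed.

Lemma homogR_evalR d (p : {mpoly rat[ngen n]}) : homogG d p -> homogR d (evalR p).
Proof.
move=> /homogGP hp; rewrite [p]mpolyE raddf_sum big_seq /=.
elim/big_ind: _ => [|f g|M /hp hM]; [exact: homogR0|exact: homogRD|].
rewrite evalRZ; apply: homogRZ; rewrite -hM evalRX /wdeg.
elim/big_rec2: _ => [|k f e _ h]; first exact: homogR1.
apply: homogRM h; rewrite -gdegE; elim: (M k) => [|c IH]; first exact: homogR1.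
by rewrite exprS mulSn; apply: homogRM IH; apply: homogR_gen.
Qed.

Lemma act_evalR (tau : 'S_n) (p : {mpoly rat[ngen n]}) :
  act_mpoly tau (evalR p) = evalR p.
Proof.
rewrite [p]mpolyE !(raddf_sum (@evalR n)) (raddf_sum (act_mpoly tau)) /=.
apply: eq_bigr => M _; rewrite evalRZ act_mpolyZ evalRX rmorph_prod /=.
congr (_ *: _); apply: eq_bigr => k _; rewrite rmorphXn /= evalR_gen.
congr (_ ^+ _); apply: (gen_elt_invariant (tau := tau)) => i.
  by apply: etrans (act_mpolyX _ tau (uI i)) _; rewrite act_var_u.
by apply: etrans (act_mpolyX _ tau (aI i)) _; rewrite act_var_a.
Qed.

Lemma invariantsR_evalR (p : {mpoly rat[ngen n]}) : in_invariantsR (evalR p).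
Proof. by move=> tau; rewrite act_evalR. Qed.

Lemma invariantsRB f g : in_invariantsR f -> in_invariantsR g -> in_invariantsR (f - g).
Proof. by move=> hf hg tau; rewrite (rmorphB (act_mpoly tau)) !raddfB /= hf hg. Qed.

Lemma invariantsR_red f : in_invariantsR f -> in_invariantsR (red f).
Proof. by move=> hf tau; rewrite red_act !red_red -red_act hf. Qed.

(** A drop at s accounts for one unit in each of the first s exponents of the u, so the drops
    weighted by s add up to the u-degree. *)
Lemma homogG_dominant_product m : good m -> homogG (mdegR m) (dominant_product m).
Proof.
move=> gm; apply/homogGP; suff <- : dpweight (fun s _ => s) m = mdegR m.
  exact: whomog_dominant_product.
rewrite mdegRE; under [RHS]eq_bigr => j _ do rewrite -(sum_jump gm (ltn_ord j)).
rewrite exchange_big /dpweight /= big_nat [RHS]big_nat; apply: eq_bigr => s /andP[s0 sn].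
have -> : (\sum_(j < n) jump m s * (j < s) = jump m s * s)%N.
  rewrite -big_distrr /=; congr (_ * _)%N.
  rewrite -[RHS](@card_itv n 0 s sn) -sum1_card [RHS]big_mkcond /=.
  by apply: eq_bigr => j _; rewrite inE /= add0n; case: (_ < _)%N.
by case: eqP => [->//|/eqP]; rewrite -lt0n => /prednK {2}<-; rewrite mulSn addnC.
Qed.

End Homogeneous.

(** * Termination and correctness of the algorithm *)

Section Algorithm.
Variable n : nat.
Implicit Types (m : 'X_{1..n + n}) (f g : {mpoly rat[n + n]}).

Lemma msupp_red_ex f m : m \in msupp (red f) -> exists2 m', m' \in msupp f & m = redm m'.
Proof.
rewrite mcoeff_msupp /red raddf_sum /= => nz.
have [/hasP[m' h /eqP e]|/hasPn h] := boolP (has (fun m' => redm m' == m) (msupp f)).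
  by exists m'.
case/eqP: nz; rewrite big_seq big1 // => m' /h /negbTE ne.
by rewrite mcoeffZ mcoeffX ne mulr0.
Qed.

Definition rmon d (t : {ffun 'I_n -> 'I_d.+1} * {ffun 'I_n -> bool}) : 'X_{1..n + n} :=
  [multinom match split k with inl i => t.1 i : nat | inr i => t.2 i : nat end
    | k < n + n].

(** Counts monomials below m in the box of u-exponents at most d and alpha-exponents at most 1. The
    box has (2 (d + 1))^n elements and contains the dominant terms of all remainders of degree d, so
    the rank bounds the number of steps still to come. *)
Definition rank d m := #|[set t | mlexlt (@rmon d t) m]|.

Lemma rmonP d m : mdegR m = d -> good m -> exists t, rmon (d := d) t = m.
Proof.
move=> hd [ha _].
exists ([ffun i : 'I_n => inord (uexp m i)], [ffun i : 'I_n => aexp m i == 1%N]).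
apply: mnm_uaP => j jn; rewrite -[j]/(nat_of_ord (Ordinal jn)).
  rewrite uexpE mnmE split_uI ffunE inordK // ltnS -hd mdegRE.
  by rewrite (bigD1 (Ordinal jn)) //= leq_addr.
rewrite aexpE mnmE split_aI ffunE /=; have := ha j.
by case: (aexp m j) => [|[|]].
Qed.

Lemma rank_lt d m m' : mdegR m = d -> good m -> mlexlt m m' -> (rank d m < rank d m')%N.
Proof.
move=> hd gm lt; have [t ht] := rmonP hd gm.
apply: proper_card; apply/properP; split.
  apply/subsetP => t'; rewrite !inE => h; exact: mlexlt_trans lt.
by exists t; rewrite inE ht ?mlexlt_irr.
Qed.

Lemma rank_max d m : mdegR m = d -> good m -> (rank d m < (2 * d.+1) ^ n)%N.
Proof.
move=> hd gm; have [t ht] := rmonP hd gm.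
have -> : ((2 * d.+1) ^ n = #|[set: {ffun 'I_n -> 'I_d.+1} * {ffun 'I_n -> bool}]|)%N.
  by rewrite cardsT card_prod !card_ffun !card_ord card_bool -expnMn mulnC.
apply: proper_card; apply/properP; split; first exact: subsetT.
by exists t; rewrite ?inE // ht mlexlt_irr.
Qed.

Lemma dominant_red f : dominant (red f) = dominant f.
Proof. by rewrite /dominant red_red. Qed.

Lemma red_subl f g : red (red f - g) = red (f - g).
Proof. by rewrite !raddfB /= red_red. Qed.

Lemma algo_stepE f p0 : red f != 0 -> algo_step (f, p0) =
  (red (f - evalR ((red f)@_(dominant f) *: dominant_product (dominant f))),
   p0 + (red f)@_(dominant f) *: dominant_product (dominant f)).
Proof.
move=> nz; rewrite /algo_step -[(f, p0).1]/f -[(f, p0).2]/p0; cbv zeta.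
by rewrite (negbTE nz) dominant_red red_subl.
Qed.

Lemma algo_step0 f p0 : red f = 0 -> algo_step (f, p0) = (0, p0).
Proof.
by move=> e; rewrite /algo_step -[(f, p0).1]/f -[(f, p0).2]/p0; cbv zeta; rewrite e eqxx.
Qed.

(** Keeps track of the origin of each output monomial; the termination of the rewriting by types II
    and III depends on it. *)
Definition spanned_by_dominant f (p : {mpoly rat[ngen n]}) := forall M, M \in msupp p ->
  exists m, [/\ good m, red f != 0, m = dominant f \/ mlexlt m (dominant f) &
    M \in msupp (dominant_product m)].

Lemma algo_stepP d f p0 : homogR d f -> in_invariantsR f -> red f != 0 ->
  exists p, [/\ (algo_step (f, p0)) = (red (f - evalR p), p0 + p), homogG d p,
    p = (red f)@_(dominant f) *: dominant_product (dominant f),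
    mdegR (dominant f) = d &
    red (f - evalR p) != 0 -> mlexlt (dominant (f - evalR p)) (dominant f)].
Proof.
move=> hd hi nz; have [h1 h2] := dominantP nz.
have gm := good_dominant hi nz; have hdm := homogRP _ _ hd _ h1.
exists ((red f)@_(dominant f) *: dominant_product (dominant f)).
have topp : top (evalR ((red f)@_(dominant f) *: dominant_product (dominant f)))
    (dominant f) (red f)@_(dominant f).
  by rewrite evalRZ -[X in top _ _ X]mulr1; apply/topZ/top_dominant_product.
split=> //.
- exact: algo_stepE.
- rewrite -hdm; apply/homogGP/whomogZ/homogGP; exact: homogG_dominant_product.
move=> nz'; have [h3 _] := dominantP nz'; set m' := dominant _ in h3 *.
have nm : m' != dominant f.
  apply: contraTneq h3 => ->; rewrite -mcoeff_eq0 raddfB /= mcoeffB.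
  by case: topp => -> _; rewrite subrr.
move: h3; rewrite raddfB /= => /msuppB_le; rewrite mem_cat => /orP[h3|h3].
  by case: h2 => _ /(_ _ h3) [e|//]; rewrite e eqxx in nm.
by case: topp => _ /(_ _ h3) [e|//]; rewrite e eqxx in nm.
Qed.

(** The hypothesis for N = 0 is there because the final remainder must be the polynomial 0, while f
    may vanish in R without being 0; a single step replaces it by its normal form. *)
Lemma algo_iter N d f p0 : homogR d f -> in_invariantsR f ->
  (red f = 0 -> N = 0%N -> f = 0) -> (red f != 0 -> (rank d (dominant f) < N)%N) ->
  exists p, [/\ iter N (@algo_step n) (f, p0) = (0, p0 + p), homogG d p,
    red (evalR p) = red f & spanned_by_dominant f p].
Proof.
elim: N f p0 => [|N IH] f p0 hd hi h0 hN.
  have e0 : red f = 0 by apply/eqP; apply/negPn/negP => /hN.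
  rewrite (h0 e0 erefl); exists 0; split; rewrite ?addr0 ?rmorph0 //.
    by apply/homogGP/whomog0.
  by move=> M; rewrite msupp0.
rewrite iterSr; case: (eqVneq (red f) 0) => [e0|nz].
  exists 0; split; rewrite ?addr0 ?rmorph0 ?red0 //.
  - rewrite algo_step0 //; elim: N {IH h0 hN} => // N IHN.
    by rewrite iterS IHN algo_step0 ?red0.
  - by apply/homogGP/whomog0.
  - by move=> M; rewrite msupp0.
have [p1 [-> hp1 ep1 hdm hlt]] := algo_stepP p0 hd hi nz.
set f' := f - evalR p1 in hlt *.
have hd' : homogR d f' by apply: homogRB => //; apply: homogR_evalR.
have hi' : in_invariantsR f' by apply: invariantsRB => //; apply: invariantsR_evalR.
have [||||p2 [h1 h2 h3 h4]] := IH (red f') (p0 + p1).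
- by rewrite homogR_red.
- exact: invariantsR_red.
- by rewrite red_red.
- rewrite red_red => nz'; rewrite dominant_red.
  apply: leq_trans (hN nz : (rank d (dominant f) <= N)%N).
  apply: rank_lt (hlt nz').
    by have [/(homogRP _ _ hd')] := dominantP nz'.
  exact: good_dominant.
exists (p1 + p2); split.
- by rewrite h1 addrA.
- by apply/homogGP/whomogD; apply/homogGP.
- by rewrite rmorphD redD h3 red_red /f' [red (f - _)]raddfB addrC subrK.
move=> M /msuppD_le; rewrite mem_cat => /orP[|/h4[m [g1 g2 g3 g4]]].
  rewrite ep1 => /msuppZ_le hM; exists (dominant f); split=> //; last by left.
  exact: good_dominant.
exists m; split=> //; right; rewrite red_red in g2.
rewrite dominant_red in g3; case: g3 => [->|h]; first exact: hlt.
exact: mlexlt_trans (hlt g2).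
Qed.

Theorem algorithmP d f : (0 < n)%N -> homogR d f -> in_invariantsR f ->
  exists p, [/\ computes f p, homogG d p, red (evalR p) = red f & spanned_by_dominant f p].
Proof.
move=> n0 hd hi.
have [||p [h1 h2 h3 h4]] := @algo_iter ((2 * msize f) ^ n) d f 0 hd hi.
- by move=> _ /eqP; rewrite expn_eq0 muln_eq0 /= => /andP[/eqP h _]; apply/eqP; rewrite -msize_poly_eq0 h.
- move=> nz; have [h1 _] := dominantP nz; have hdm := homogRP _ _ hd _ h1.
  apply: leq_trans (rank_max hdm (good_dominant hi nz)) _.
  (* What remains is d < [msize f]: the dominant term is the reduction of a monomial of f, and
     reduction keeps the u-degree d, which is at most the total degree. *)
  rewrite leq_exp2r // leq_mul2l /=.
  have [m hm em] : exists2 m, m \in msupp f & dominant f = redm m.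
    exact: msupp_red_ex.
  apply: leq_ltn_trans (msize_mdeg_lt hm); rewrite -hdm em mdegR_redm mdegE.
  by rewrite big_split_ord leq_addr.
by exists p; split=> //; rewrite /computes /algorithm h1 add0r.
Qed.

End Algorithm.

Lemma prod_succ_inv (n : nat) (J : {set 'I_n}) :
  \prod_(i | i \notin J) (i.+1%:R : rat) = n`!%:R * \prod_(i in J) (i.+1%:R)^-1.
Proof.
have -> : n`!%:R = \prod_(i < n) (i.+1%:R : rat).
  by rewrite -natr_prod fact_prod big_add1 /= big_mkord.
rewrite [X in _ = X * _](bigID (fun i => i \in J)) /= mulrAC -big_split /= [X in _ = X * _]big1 ?mul1r // => i _.
by rewrite mulfV // Num.Theory.pnatr_eq0.
Qed.

(** Set the factor alpha apart and expand the others over the set J of factors that contribute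
    alpha: the coefficient is (-1)^(n-|J|) times the product of the i + 1 outside J, that is n!
    divided by the product over J. The full set gives alpha^(n+1), the sets of cardinal m - 1 give
    r_m. *)
Lemma relI_prod n : relI n = \prod_(k < n.+1) (Xalpha rat n - k%:R).
Proof.
set X := Xalpha rat n; rewrite big_ord_recl /= subr0.
have -> : \prod_(i < n) (X - (bump 0 i)%:R) = \sum_(J : {set 'I_n})
    ((-1) ^+ (n - #|J|) * n`!%:R * \prod_(i in J) (i.+1%:R : rat)^-1) *: X ^+ #|J|.
  rewrite bigA_distr; apply: eq_bigr => J _.
  rewrite (bigID (fun i => i \in J)) /= mulrC.
  rewrite (eq_bigr (fun i : 'I_n => ((-1) * i.+1%:R : rat)%:MP)); last first.
    by move=> i /negbTE ->; rewrite mulN1r mpolyCN mpolyC_nat.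
  rewrite [X in _ * X](eq_bigr (fun=> X)); last by move=> i ->.
  rewrite prodr_const -rmorph_prod /= mul_mpolyC; congr (_ *: _).
  rewrite big_split /= prod_succ_inv -mulrA; congr (_ * _).
  rewrite prodr_const; congr (_ ^+ _).
  by rewrite -[X in (X - _)%N](card_ord n) -(cardC (mem J)) addKn.
rewrite mulr_sumr (bigD1 setT) //= cardsT card_ord subnn mul1r.
rewrite (eq_bigl predT) => [|i]; last by rewrite inE.
have -> : \prod_(i < n) (i.+1%:R : rat)^-1 = n`!%:R^-1.
  by rewrite fact_prod natr_prod big_add1 /= big_mkord prodfV.
rewrite mulfV ?scale1r -?exprS; last by rewrite Num.Theory.pnatr_eq0 -lt0n fact_gt0.
rewrite /relI; congr (_ + _).
rewrite big_add1 big_mkord -sumrN.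
rewrite (eq_bigl (fun J : {set 'I_n} => (#|J| < n)%N)) => [|J]; last first.
  by rewrite eqEcard subsetT cardsT card_ord -ltnNge.
rewrite (eq_bigr (fun m : 'I_n => \sum_(J : {set 'I_n} | #|J| == m)
    X * (((-1) ^+ (n - #|J|) * n`!%:R * \prod_(i in J) (i.+1%:R : rat)^-1) *: X ^+ #|J|))).
  rewrite (exchange_big_dep (fun J : {set 'I_n} => (#|J| < n)%N)) /=; last first.
    by move=> m J _ /eqP ->.
  apply: eq_bigr => J hJ; rewrite (big_pred1 (Ordinal hJ)) //.
move=> m _; rewrite -scaleNr /coefI -!mulNr mulr_sumr scaler_suml; apply: eq_bigr => J /eqP ->.
rewrite -scalerAr -exprS; congr (_ *: _); congr (_ * _ * _).
rewrite addnS exprS mulN1r opprK /= -[X in (X + _)%N](subnK (ltnW (ltn_ord m))).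
by rewrite -addnA addnn -mul2n exprD exprM sqrrN !expr1n mulr1.
Qed.

(** * The relations of types I, II and III *)

Section Relations.
Variable n : nat.
Implicit Types (m : 'X_{1..n + n}) (g h : gidx n).

(** Common to types II and III: both products have dominant monomial m and a is the ratio of their
    coefficients, so the difference only has terms below m, and the algorithm never goes up. *)
Lemma rest_algorithm d (q1 q2 : {mpoly rat[ngen n]}) m (a c1 c2 : rat) : (0 < n)%N ->
  homogG d q1 -> homogG d q2 -> top (evalR q1) m c1 -> top (evalR q2) m c2 ->
  c2 != 0 -> a * c2 = c1 ->
  let f := evalR (q1 - a *: q2) in let r := (algorithm f).2 in
  [/\ homogG d r, smallerR (evalR r) (evalR q2), computes f r,
      red (evalR r) = red f &
      forall M, M \in msupp r -> exists m', [/\ good m', mlexlt m' m &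
        M \in msupp (dominant_product m')]].
Proof.
move=> n0 h1 h2 t1 t2 c0 ac f r.
have hq : homogG d (q1 - a *: q2).
  rewrite -scaleN1r scalerA; apply/homogGP/whomogD/whomogZ; exact/homogGP.
have hd : homogR d f by apply: homogR_evalR.
have [p [hp1 hp2 hp3 hp4]] := algorithmP n0 hd (invariantsR_evalR _).
have er : r = p by rewrite /r (hp1 : algorithm f = _).
have lt m' : m' \in msupp (red f) -> mlexlt m' m.
  move=> hm'; have t2' := topZ a t2.
  have nm : m' != m.
    apply: contraTneq hm' => ->; rewrite -mcoeff_eq0 /f raddfB raddfB /= mcoeffB.
    by rewrite evalRZ; case: t1 t2' => -> _ [-> _]; rewrite ac subrr.
  move: hm'; rewrite /f raddfB raddfB /= evalRZ => /msuppB_le.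
  rewrite mem_cat => /orP[h|h].
    by case: t1 => _ /(_ _ h) [e|//]; rewrite e eqxx in nm.
  by case: t2' => _ /(_ _ h) [e|//]; rewrite e eqxx in nm.
rewrite er; split=> //.
- rewrite /smallerR (top_neq0 t2 c0) hp3 /=; case: eqVneq => //= nz.
  rewrite (top_dominant t2 c0) /dominant hp3 -/(dominant f).
  by apply: lt; case: (dominantP nz).
- move=> M /hp4[m' [g1 g2 g3 g4]]; exists m'; split=> //.
  have [/lt h _] := dominantP g2; case: g3 => [->//|h'].
  exact: mlexlt_trans h.
Qed.

Lemma gidx_bounds (g : gidx n) : [/\ 0 < gs g, 0 < gi g & gs g + gi g <= n]%N.
Proof. by have /and3P := valP g. Qed.

Lemma gprod_single s i : (0 < s <= n)%N -> (0 < i)%N ->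
  gprod n (fun=> 0%N) (fun t => if t == s then i else 0%N) 1 = gammaR n s i.
Proof.
move=> hs i0; rewrite /gprod (bigD1_seq s) ?iota_uniq //=; last first.
  by rewrite mem_index_iota; lia.
rewrite eqxx i0 expr0 mul1r big1 ?mulr1 // => t /negbTE ->.
by rewrite expr0 mulr1.
Qed.

Lemma gprod_chern s : (0 < s <= n)%N ->
  gprod n (fun t => (t == s) : nat) (fun=> 0%N) 1 = gammaR n s 0.
Proof.
move=> hs; rewrite /gprod (bigD1_seq s) ?iota_uniq //=; last first.
  by rewrite mem_index_iota; lia.
rewrite eqxx expr1 mulr1 big1 ?mulr1 // => t /negbTE ->.
by rewrite expr0 mulr1.
Qed.

Definition monII (g : gidx n) : 'X_{1..n + n} :=
  bmon n (gs g + gi g) (fun t => (t == gs g) : nat) (fun=> 0%N).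

Lemma top_leadII g : top (evalR (leadII g)) (monII g) (gs g + gi g)`!%:R.
Proof.
have [s0 i0 hn] := gidx_bounds g; have hs : (0 < gs g <= n)%N by lia.
rewrite rmorphM rmorphXn /= evalR_alpha evalR_c // mulrC -gprod_chern //.
by apply: top_alpha_gprod => // s; rewrite addn0; lia.
Qed.

(** The s ones from alpha^s and the i ones that gamma_{s,i} places right after position s form a
    single run of s + i ones, the same as for c_s alpha^(s+i). For this [top_alpha_gprod] has to
    admit runs that touch. *)
Lemma top_lhsII g : top (evalR (lhsII g)) (monII g) (gs g)`!%:R.
Proof.
have [s0 i0 hn] := gidx_bounds g; have hs : (0 < gs g <= n)%N by lia.
rewrite rmorphM rmorphXn /= evalR_alpha evalR_gamma -gprod_single //.
have -> : monII g = bmon n (gs g) (fun=> 0%N)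
    (fun t => if t == gs g then gi g else 0%N).
  apply: mnm_uaP => j jn; rewrite ?uexp_bmon ?aexp_bmon //.
    by apply: eq_bigr => t _; case: eqP => // _; rewrite i0.
  rewrite (introF hasP) ?orbF; last by case=> t _; rewrite addn0; lia.
  congr nat_of_bool; apply/idP/orP => [h|[|/hasP[t _]]]; last 2 first.
  - lia.
  - case: eqP => [->|]; lia.
  case: (ltnP j (gs g)) => hj; [by left|right; apply/hasP; exists (gs g)].
    by rewrite mem_index_iota; lia.
  by rewrite eqxx hj.
apply: top_alpha_gprod => [|s|s|s s'].
- lia.
- case: eqP => [->|]; lia.
- case: eqP => [->|]; lia.
- by do 2!case: eqP => [->|] //; lia.
Qed.

Lemma homogG_lhsII g : homogG (gs g) (lhsII g).
Proof.
apply/homogGP; suff : whomog (wgt 0 (fun s _ => s)) (gs g * 0 + gs g) (lhsII g).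
  by rewrite muln0.
apply: whomogM; first exact/whomogX/whomog_alpha.
exact: (whomog_gamma 0 (fun s _ => s)).
Qed.

Lemma homogG_leadII g : homogG (gs g) (leadII g).
Proof.
have [s0 i0 hn] := gidx_bounds g.
apply/homogGP; suff : whomog (wgt 0 (fun s _ => s)) (gs g + (gs g + gi g) * 0) (leadII g).
  by rewrite muln0 addn0.
apply: whomogM; first by apply: (whomog_c 0 (fun s _ => s)); lia.
exact/whomogX/whomog_alpha.
Qed.

Definition restII_spec g := forall M, M \in msupp (restII g) ->
  exists m', [/\ good m', mlexlt m' (monII g) & M \in msupp (dominant_product m')].

Lemma restIIP g : (0 < n)%N ->
  [/\ homogG (gs g) (restII g), smallerR (evalR (restII g)) (evalR (leadII g)),
      computes (evalR (lhsII g - coefII g *: leadII g)) (restII g),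
      red (evalR (restII g)) = red (evalR (lhsII g - coefII g *: leadII g)) &
      restII_spec g].
Proof.
move=> n0; apply: (rest_algorithm n0 (homogG_lhsII g) (homogG_leadII g)
  (top_lhsII g) (top_leadII g)).
  by rewrite Num.Theory.pnatr_eq0 -lt0n fact_gt0.
by rewrite /coefII mulfVK // Num.Theory.pnatr_eq0 -lt0n fact_gt0.
Qed.

End Relations.

(** * The leading coefficient of type III *)

(** Such an A consists of the whole of [K :\: L] and of an arbitrary subset of L with the i + |L| -
    |K| elements left over. *)
Lemma card_covers (T : finType) (K L : {set T}) (i : nat) : L \subset K ->
  (#|K| <= i + #|L|)%N ->
  #|[set A : {set T} | (#|A| == i) && (A :|: L == K)]| = 'C(#|L|, i + #|L| - #|K|).
Proof.
move=> LK hi; rewrite -cards_draws.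
have cK : (#|K :\: L| + #|L| = #|K|)%N.
  by have := cardsID L K; rewrite (setIidPr LK) addnC.
rewrite -[RHS](card_in_imset (f := fun A => (K :\: L) :|: A)); last first.
  move=> A B; rewrite !inE => /andP[/setIidPl <- _] /andP[/setIidPl <- _] /setP e.
  apply/setP => x; have := e x; rewrite !inE.
  by case: (x \in L); rewrite ?andbF.
apply: eq_card => A; rewrite inE; apply/andP/imsetP => [[/eqP Ai /eqP AL]|[B]].
  exists (A :&: L).
    rewrite inE subsetIr; have := cardsID L A.
    have -> : A :\: L = K :\: L by rewrite -AL setDUl setDv setU0.
    by move=> h; apply/eqP; lia.
  apply/setP => x; rewrite -AL !inE.
  by case: (x \in L); rewrite ?andbF ?orbF ?andbT.
rewrite inE => /andP[BL /eqP Bi] ->; split.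
  rewrite cardsU (_ : _ :&: B = set0) ?cards0 ?subn0 ?Bi; first by apply/eqP; lia.
  apply/setP => x; rewrite !inE; have := subsetP BL x.
  by case: (x \in B); rewrite ?andbF // => /(_ isT) ->.
apply/eqP/setP => x; rewrite !inE; have := subsetP LK x; have := subsetP BL x.
by case: (x \in L); case: (x \in B); case: (x \in K) => //= h h'; [have := h' isT|have := h' isT|have := h isT].
Qed.

Section TypeIII.
Variable n : nat.
Implicit Types (m : 'X_{1..n + n}) (g h : gidx n).
Variables s i t j : nat.
Hypothesis s_t : (s <= t <= s + i)%N.
Hypothesis s_n : (s + i <= n)%N.
Hypothesis t_n : (t + j <= n)%N.
Let k := minn (i + j) (n - s).

(** Choose L2 first, among the last s + k - t elements of [itv n s k]; then [card_covers] counts the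
    L1. The second binomial chooses the overlap, of i + j - k elements, which is nonempty only if n
    - s < i + j. *)
Lemma card_cover_pairs :
  (\sum_(L1 : {set 'I_n} | (#|L1| == i) && [disjoint itv n 0 s & L1])
    \sum_(L2 : {set 'I_n} | (#|L2| == j) && [disjoint itv n 0 t & L2])
      (L1 :|: L2 == itv n s k) = 'C(s + k - t, j) * 'C(j, s + i + j - n))%N.
Proof.
have kn : (s + k <= n)%N by rewrite /k; lia.
have cK : #|itv n s k| = k by rewrite card_itv.
rewrite exchange_big /=.
rewrite (eq_bigr (fun L2 : {set 'I_n} => if L2 \subset itv n s k then 'C(j, i + j - k) else 0)%N).
  rewrite -big_mkcondr /= sum_nat_const; congr (_ * _)%N; last by congr 'C(_, _); rewrite /k; lia.
  rewrite -{1}(@card_itv n t (s + k - t)); last by rewrite /k; lia.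
  rewrite -cards_draws -sum1_card -[RHS]sum1_card; apply: eq_bigl => L.
  rewrite !inE -[(_ \in _)]/((#|L| == j) && [disjoint itv n 0 t & L] && (L \subset itv n s k)).
  rewrite andbC andbA andbAC; congr (_ && _).
  apply/andP/subsetP => [[/subsetP h d] x xL|h].
    have := h _ xL; rewrite !inE => hx; move: d; rewrite disjoint_sym => /disjointFr /(_ xL).
    by rewrite inE /= add0n; lia.
  split; first by apply/subsetP => x /h; rewrite !inE; lia.
  rewrite -setI_eq0; apply/eqP/setP => x; rewrite !inE; apply/negbTE/negP => /andP[h1 /h].
  by rewrite inE; lia.
move=> L2 /andP[/eqP L2j d]; case: ifPn => [L2K|nL2]; last first.
  rewrite big1 // => L1 _; case: eqP => // e; case/negP: nL2; rewrite -e; exact: subsetUr.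
rewrite -[in RHS]L2j -[X in (_ - X)%N]cK -(card_covers (K := itv n s k)) //; last first.
  by rewrite cK L2j /k; lia.
rewrite -sum1_card -big_mkcondr /=; apply: eq_bigl => L1; rewrite inE.
apply/andP/andP => [[/andP[-> _] ->]|[-> /eqP e]] //; rewrite e eqxx; split=> //=.
rewrite -setI_eq0; apply/eqP/setP => x; rewrite !inE; apply/negbTE/negP => /andP[h1 h2].
have : x \in itv n s k by rewrite -e inE h2.
by rewrite inE; lia.
Qed.

(** Written in the shape that two uses of [lead_mulgamma] produce, multiplying 1 by c_t and then by
    gamma_{s,k}. *)
Definition monIII : 'X_{1..n + n} := redm (redm (0 + imon n t 0) + imon n s k).

Lemma top_leadIII : top (gammaR n t 0 * gammaR n s k) monIII 1.
Proof.
have kn : (s + k <= n)%N by rewrite /k; lia.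
rewrite -[gammaR n t 0]mul1r; apply: (lead_top (t := 0)).
apply: (lead_mulgamma (t := n)) => //; last by right.
apply: (lead_mulgamma (t := n)) => //; [exact: lead1 | lia | by left].
Qed.

(** Since the runs may overlap, [lead_mulgamma] does not cover gamma_{s,i} gamma_{t,j} and several
    pairs can reach the dominant monomial. The u-part is maximal only for initial intervals; L1 and
    L2 then avoid the first s positions, so their union has at most k elements and [itv_or_gap]
    compares it with [itv n s k]. *)
Lemma cmpIII (M1 L1 M2 L2 : {set 'I_n}) : #|M1| = s -> #|L1| = i -> [disjoint M1 & L1] ->
  #|M2| = t -> #|L2| = j -> [disjoint M2 & L2] ->
  [/\ M1 = itv n 0 s, M2 = itv n 0 t & L1 :|: L2 = itv n s k] \/
  mlexlt (redm (gmon M1 L1 + gmon M2 L2)) monIII.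
Proof.
move=> M1s L1i d1 M2t L2j d2.
have kn : (s + k <= n)%N by rewrite /k; lia.
have eu0 p : (p < n)%N -> uexp monIII p = ((p < t) + (p < s))%N.
  move=> pn; rewrite uexp_redm uexpD uexp_redm uexpD !uexp_imon //.
  by rewrite -[p]/(nat_of_ord (Ordinal pn)) uexpE mnm0E.
have ea0 p : (p < n)%N -> aexp monIII p = (s <= p < s + k)%N.
  move=> pn; rewrite aexp_redm aexpD aexp_redm aexpD !aexp_imon //.
  have -> : aexp (0%MM : 'X_{1..n + n}) p = 0%N.
    by rewrite -[p]/(nat_of_ord (Ordinal pn)) aexpE mnm0E.
  lia.
have eu p : (p < n)%N -> uexp (redm (gmon M1 L1 + gmon M2 L2)) p =
    (uexp (gmon M2 set0) p + uexp (gmon M1 set0) p)%N.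
  move=> pn; rewrite uexp_redm uexpD addnC.
  by rewrite -[p]/(nat_of_ord (Ordinal pn)) !uexp_gmon.
have eqM (M : {set 'I_n}) r : M = itv n 0 r -> forall p, (p < n)%N ->
    uexp (gmon M set0) p = (p < r)%N.
  by move=> -> p pn; rewrite -[p]/(nat_of_ord (Ordinal pn)) uexp_gmon inE.
have hs : (s <= n)%N by lia.
have ht : (t <= n)%N by lia.
case: (set_fst M1s hs) => [e1|lt1]; last first.
  right; apply/mlexltP; left; apply: (lexlt_eql (x := fun p => (uexp (gmon M1 set0) p + uexp (gmon M2 set0) p)%N)).
    by move=> p pn; rewrite eu // addnC.
  apply: (lexlt_eqr (y := fun p => ((p < s) + (p < t))%N)) => [p pn|].
    by rewrite eu0 // addnC.
  by apply: lexlt_add => //; case: (set_fst M2t ht) => [/eqM|]; [left|right].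
case: (set_fst M2t ht) => [e2|lt2]; last first.
  right; apply/mlexltP; left; apply: (lexlt_eql (x := fun p => (uexp (gmon M2 set0) p + uexp (gmon M1 set0) p)%N)).
    by move=> p pn; rewrite eu.
  apply: (lexlt_eqr (y := fun p => ((p < t) + (p < s))%N)) => [p pn|].
    by rewrite eu0.
  by apply: lexlt_add => //; left; apply: eqM.
have Ls (x : 'I_n) : x \in L1 :|: L2 -> (s <= x)%N.
  rewrite inE leqNgt; apply: contraTN => xs; rewrite negb_or; apply/andP; split.
    by rewrite (disjointFr d1) // e1 inE.
  by rewrite (disjointFr d2) // e2 inE /= add0n; lia.
have cL : (#|L1 :|: L2| <= k)%N.
  have c1 : (#|L1 :|: L2| <= i + j)%N by rewrite cardsU L1i L2j leq_subr.
  have : L1 :|: L2 \subset itv n s (n - s).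
    by apply/subsetP => x /Ls h; rewrite inE h /= subnKC // ltn_ord.
  by move/subset_leq_card; rewrite card_itv /k; lia.
case: (itv_or_gap kn cL Ls) => [e|[x [hx nx hxx]]]; first by left.
right; apply/mlexltP; right; split=> [p pn|].
  by rewrite eu // eu0 // (eqM _ _ e1) // (eqM _ _ e2).
have ea p (pn : (p < n)%N) : aexp (redm (gmon M1 L1 + gmon M2 L2)) p =
    (Ordinal pn \in L1 :|: L2).
  rewrite aexp_redm aexpD -[p]/(nat_of_ord (Ordinal pn)) !aexp_gmon inE /=.
  by do 2!case: (_ \in _).
exists x; split=> // [p px|].
  have pn : (p < n)%N by apply: ltn_trans px _.
  rewrite ea ea0 //; case: (leqP s p) => sp.
    by rewrite (hxx (Ordinal pn)) /=; lia.
  by apply/eqP; rewrite eqb0; apply/negP => /Ls /=; lia.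
rewrite ea0 // ea hx; apply: leq_trans (_ : 1 <= 1)%N => //; rewrite ltnS leqn0 eqb0.
by rewrite (_ : Ordinal _ = x) //; apply: val_inj.
Qed.

Lemma eqIII (L1 L2 : {set 'I_n}) : L1 :|: L2 = itv n s k ->
  redm (gmon (itv n 0 s) L1 + gmon (itv n 0 t) L2) = monIII.
Proof.
move=> e; apply: mnm_uaP => p pn.
  rewrite !(uexp_redm, uexpD) !uexp_imon // -[p]/(nat_of_ord (Ordinal pn)) !uexp_gmon.
  by rewrite uexpE mnm0E !inE /= addnC.
rewrite !(aexp_redm, aexpD) !aexp_imon // -[p]/(nat_of_ord (Ordinal pn)) !aexp_gmon.
have /setP /(_ (Ordinal pn)) := e; rewrite !inE /= => <-.
have -> : aexp (0%MM : 'X_{1..n + n}) p = 0%N.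
  by rewrite -[p]/(nat_of_ord (Ordinal pn)) aexpE mnm0E.
rewrite addn0 (_ : (t <= p < t)%N = false); last by lia.
by do 2!case: (_ \in _).
Qed.

Lemma top_lhsIII : top (gammaR n s i * gammaR n t j) monIII
  ('C(s + k - t, j) * 'C(j, s + i + j - n))%:R.
Proof.
split; last first.
  move=> m /msupp_redM[m1 [m2 [h1 h2 ->]]]; move: h1 h2; rewrite !red_gammaR.
  case/msupp_gammaR=> [M1 [L1 [-> c1 c2 c3]]] /msupp_gammaR [M2 [L2 [-> c4 c5 c6]]].
  case: (cmpIII c1 c2 c3 c4 c5 c6) => [[-> -> e]|]; [left|by right].
  exact: eqIII.
have hs : (s <= n)%N by lia.
have ht : (t <= n)%N by lia.
transitivity (\sum_(M1 : {set 'I_n} | #|M1| == s)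
    \sum_(L1 : {set 'I_n} | (#|L1| == i) && [disjoint M1 & L1])
    \sum_(M2 : {set 'I_n} | #|M2| == t)
    \sum_(L2 : {set 'I_n} | (#|L2| == j) && [disjoint M2 & L2])
      ((redm (gmon M1 L1 + gmon M2 L2) == monIII)%:R : rat)).
  rewrite !gammaRE mulr_suml (raddf_sum (@red n)) (raddf_sum (mcoeff monIII)) /=.
  apply: eq_bigr => M1 _.
  rewrite mulr_suml (raddf_sum (@red n)) (raddf_sum (mcoeff monIII)) /=.
  apply: eq_bigr => L1 _.
  rewrite mulr_sumr (raddf_sum (@red n)) (raddf_sum (mcoeff monIII)) /=.
  apply: eq_bigr => M2 _.
  rewrite mulr_sumr (raddf_sum (@red n)) (raddf_sum (mcoeff monIII)) /=.
  by apply: eq_bigr => L2 _; rewrite -mpolyXD redX mcoeffX.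
have ne (M1 L1 M2 L2 : {set 'I_n}) : #|M1| = s -> #|L1| = i -> [disjoint M1 & L1] ->
    #|M2| = t -> #|L2| = j -> [disjoint M2 & L2] ->
    ~ [/\ M1 = itv n 0 s, M2 = itv n 0 t & L1 :|: L2 = itv n s k] ->
    (redm (gmon M1 L1 + gmon M2 L2) == monIII)%:R = 0 :> rat.
  move=> c1 c2 c3 c4 c5 c6 h; case: eqP => // e.
  by case: (cmpIII c1 c2 c3 c4 c5 c6) => [/h//|]; rewrite e mlexlt_irr.
rewrite -card_cover_pairs natr_sum.
rewrite (bigD1 (itv n 0 s)) ?card_itv //= [X in _ + X]big1 ?addr0; last first.
  move=> M1 /andP[/eqP c1 nM1]; rewrite big1 // => L1 /andP[/eqP c2 c3].
  rewrite big1 // => M2 /eqP c4; rewrite big1 // => L2 /andP[/eqP c5 c6].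
  by apply: ne => // -[e _ _]; rewrite e eqxx in nM1.
have cs : #|itv n 0 s| = s by rewrite card_itv.
apply: eq_bigr => L1 /andP[/eqP c2 c3].
have ct : #|itv n 0 t| = t by rewrite card_itv.
rewrite natr_sum (bigD1 (itv n 0 t)) ?ct //= [X in _ + X]big1 ?addr0; last first.
  move=> M2 /andP[/eqP c4 nM2]; rewrite big1 // => L2 /andP[/eqP c5 c6].
  by apply: ne => // -[_ e _]; rewrite e eqxx in nM2.
apply: eq_bigr => L2 /andP[/eqP c5 c6].
case: (eqVneq (L1 :|: L2) (itv n s k)) => [e|nL]; first by rewrite eqIII ?eqxx.
by apply: ne => // -[_ _ e]; rewrite e eqxx in nL.
Qed.

End TypeIII.

Section RelationIII.
Variable n : nat.
Implicit Types (g h : gidx n).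

Definition monIIIg g h := monIII n (gs g) (gi g) (gs h) (gi h).

Lemma restIIIP g h : (0 < n)%N -> typeIII g h ->
  [/\ homogG (gs g + gs h) (restIII g h),
      smallerR (evalR (restIII g h)) (evalR (leadIII g h)),
      computes (evalR (lhsIII g h - coefIII g h *: leadIII g h)) (restIII g h),
      red (evalR (restIII g h)) = red (evalR (lhsIII g h - coefIII g h *: leadIII g h)) &
      forall M, M \in msupp (restIII g h) -> exists m',
        [/\ good m', mlexlt m' (monIIIg g h) & M \in msupp (dominant_product m')]].
Proof.
move=> n0 st; have [s0 i0 hs] := gidx_bounds g; have [t0 j0 ht] := gidx_bounds h.
have kn : (gs g + minn (gi g + gi h) (n - gs g) <= n)%N by lia.
apply: (@rest_algorithm n _ _ _ (monIIIg g h) _ (coefIII g h) 1) => //.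
- apply/homogGP; apply: whomogM; exact: (whomog_gamma 0 (fun s _ => s)).
- apply/homogGP; rewrite addnC; apply: whomogM.
    by apply: (whomog_c 0 (fun s _ => s)); lia.
  exact: (whomog_gam 0 (fun s _ => s)).
- rewrite rmorphM /= !evalR_gamma.
  have -> : coefIII g h = ('C(gs g + minn (gi g + gi h) (n - gs g) - gs h, gi h) *
      'C(gi h, gs g + gi g + gi h - n))%:R.
    by rewrite /coefIII; congr (('C(_, _) * _)%:R); lia.
  exact: top_lhsIII.
- rewrite rmorphM /= evalR_c; last by lia.
  rewrite evalR_gam //; exact: top_leadIII.
- by rewrite mulr1.
Qed.

End RelationIII.

(** * Termination of the rewriting of monomials into admissible ones *)

Section Measure.
Variable n : nat.
Implicit Types (M L K : 'X_{1..ngen n}) (g h : gidx n) (m : 'X_{1..n + n}).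

Definition Uv (v : gname n) : 'X_{1..ngen n} := U_(enum_rank v).
Definition Ualpha := Uv (inl (inl tt)).

(** On c_s and gamma_{s,i} this is the exponent of u_(j+1) in the dominant term. *)
Definition wmu j := wgt (n := n) 0 (fun s _ => (j < s)%N).
Definition wcount := wgt (n := n) 0 (fun _ i => (0 < i)%N).
Definition walpha := wgt (n := n) 1 (fun _ _ => 0%N).
Definition wrow r := wgt (n := n) 0 (fun s i => ((s == r) * i)%N).

(* The rewriting order: the u-exponents of the dominant term, then the number of
   gammas, then the exponent of alpha, then the total second indices of the
   gamma_{r,i}, for each r.  Being additive in the monomial, it is compatible
   with products, unlike the order on dominant terms. *)
Definition meas M (j : nat) : nat :=
  if (j < n)%N then wdeg (wmu j) M else if j == n then wdeg wcount M
  else if j == n.+1 then wdeg walpha M else wdeg (wrow (j - n.+2)%N) M.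

(** The length is n for the u-exponents, 1 for the gammas, 1 for alpha and n + 1 for the rows r = 0,
    ..., n. *)
Definition msmaller K L := lexlt (n + n).+3 (meas K) (meas L).

Lemma measD M K j : meas (M + K) j = (meas M j + meas K j)%N.
Proof.
by rewrite /meas; case: ifP => _; [|case: ifP => _; [|case: ifP => _]]; rewrite wdegD.
Qed.

Lemma msmallerD M K L : msmaller K L -> msmaller (M + K) (M + L).
Proof.
move=> h; apply: (lexlt_eql (x := fun j => (meas K j + meas M j)%N)).
  by move=> j _; rewrite measD addnC.
apply: (lexlt_eqr (y := fun j => (meas L j + meas M j)%N)).
  by move=> j _; rewrite measD addnC.
exact: lexlt_add2r.
Qed.

Lemma msmaller_mu K L : lexlt n (fun j => wdeg (wmu j) K) (fun j => wdeg (wmu j) L) ->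
  msmaller K L.
Proof.
case=> k [kn hk lk]; exists k; split=> [|j jk|]; rewrite /meas ?kn //; first by lia.
by rewrite (ltn_trans jk kn) hk.
Qed.

Lemma msmaller_count K L : (forall j, (j < n)%N -> wdeg (wmu j) K = wdeg (wmu j) L) ->
  (wdeg wcount K < wdeg wcount L)%N -> msmaller K L.
Proof.
move=> e h; exists n; split=> [|j jn|]; rewrite /meas ?ltnn ?eqxx //; first by lia.
by rewrite jn e.
Qed.

Lemma msmaller_alpha K L : (forall j, (j < n)%N -> wdeg (wmu j) K = wdeg (wmu j) L) ->
  wdeg wcount K = wdeg wcount L -> (wdeg walpha K < wdeg walpha L)%N -> msmaller K L.
Proof.
move=> e ec h; exists n.+1; split=> [|j jn|]; rewrite /meas; first by lia.
  by case: ltnP => hj; [apply: e | have -> : j = n by lia]; rewrite ?eqxx.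
have -> : (n.+1 < n)%N = false by lia.
by have -> : (n.+1 == n)%N = false; [lia | rewrite eqxx].
Qed.

Lemma msmaller_row K L s : (s <= n)%N ->
  (forall j, (j < n)%N -> wdeg (wmu j) K = wdeg (wmu j) L) ->
  wdeg wcount K = wdeg wcount L -> wdeg walpha K = wdeg walpha L ->
  (forall r, (r < s)%N -> wdeg (wrow r) K = wdeg (wrow r) L) ->
  (wdeg (wrow s) K < wdeg (wrow s) L)%N -> msmaller K L.
Proof.
move=> sn e ec ea er h; exists (n.+2 + s)%N; split=> [|j jn|]; rewrite /meas; first by lia.
  case: ltnP => hj; first exact: e.
  case: eqP => // hj1; case: eqP => // hj2; apply: er; lia.
have -> : (n.+2 + s < n)%N = false by lia.
have -> : (n.+2 + s == n)%N = false by lia.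
have -> : (n.+2 + s == n.+1)%N = false by lia.
by rewrite addKn.
Qed.

Lemma dpweight_mu m j : good m -> (j < n)%N ->
  dpweight (n := n) (fun s _ => (j < s)%N) m = uexp m j.
Proof.
move=> gm jn; rewrite -(sum_jump gm jn); apply: eq_bigr => s _.
by case: eqP => [->//|/eqP]; rewrite -lt0n => /prednK {2}<-; rewrite mulSn addnC.
Qed.

(** Carries an inequality between dominant terms over to the rewriting order, for every monomial of
    the product and whatever its power of alpha. *)
Lemma dominant_product_mu m M j : good m -> (j < n)%N ->
  M \in msupp (dominant_product m) -> wdeg (wmu j) M = uexp m j.
Proof. by move=> gm jn /whomog_dominant_product ->; apply: dpweight_mu. Qed.

Lemma wdeg_muln wt M k : wdeg (n := n) wt (M *+ k) = (wdeg wt M * k)%N.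
Proof.
elim: k => [|k IH]; first by rewrite mulm0n wdeg0 muln0.
by rewrite mulmS wdegD IH mulnS.
Qed.

Lemma relI_smaller K : K \in msupp ('X_[Ualpha *+ n.+1] - relI n) ->
  msmaller K (Ualpha *+ n.+1).
Proof.
rewrite /relI /Xalpha /Xgen -/(Uv _) -/Ualpha mpolyXn opprB addrC subrK => hK.
have [k kn ->] : exists2 k, (k < n.+1)%N & K = (Ualpha *+ k)%MM.
  move: hK; rewrite big_nat; elim/big_ind: _ => [|p q hp hq|k /andP[_ kn]].
  - by rewrite msupp0.
  - by move/msuppD_le; rewrite mem_cat => /orP[/hp|/hq].
  - by move/msuppZ_le; rewrite mpolyXn msuppX inE => /eqP ->; exists k.
apply: msmaller_alpha => [j jn||]; rewrite !wdeg_muln !wdegU //.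
by rewrite /walpha /= !mul1n.
Qed.

Lemma jump_mu m s : good m -> (forall j, (j < n)%N -> uexp m j = (j < s)%N) ->
  (s <= n)%N -> forall r, (0 < r <= n)%N -> jump m r = (r == s).
Proof.
move=> gm h sn r hr; rewrite /jump h; last by lia.
case: (ltnP r n) => rn; first by rewrite h //; lia.
by rewrite uexp_out // ; lia.
Qed.

(** The leading term c_s alpha^(s+i) has more alphas but no gamma, which is why gammas are counted
    before alphas. For a monomial of the rest with the same u-exponents there is one drop, at s: it
    gives either c_s, and no gamma is left, or gamma_{s,r} with r > 0, and then the power of alpha
    is at most [run m 0], which is less than s by [run_lt]. *)
Lemma relII_smaller g K : (0 < n)%N ->
  K \in msupp ('X_[Ualpha *+ gs g + Uv (inr g)] - relII g) ->
  msmaller K (Ualpha *+ gs g + Uv (inr g)).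
Proof.
move=> n0; have [s0 i0 hn] := gidx_bounds g; set L := (_ + _)%MM.
have eL : lhsII g = 'X_[L] by rewrite /lhsII /Xgamma /Xalpha /Xgen mpolyXn -mpolyXD.
have muL j : wdeg (wmu j) L = (j < gs g)%N.
  by rewrite wdegD wdeg_muln !wdegU.
have cL : wdeg wcount L = 1%N by rewrite wdegD wdeg_muln !wdegU /= i0.
have aL : wdeg walpha L = gs g by rewrite wdegD wdeg_muln !wdegU /= mul1n addn0.
rewrite /relII eL opprB addrC subrK => /msuppD_le; rewrite mem_cat => /orP[/msuppZ_le hK|hK].
  have hw w : wdeg (wgt 0 w) K = w (gs g) 0%N.
    have : whomog (wgt 0 w) (w (gs g) 0%N + (gs g + gi g) * 0) (leadII g).
      apply: whomogM; first by apply: whomog_c; lia.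
      exact/whomogX/whomog_alpha.
    by rewrite muln0 addn0; apply.
  by apply: msmaller_count => [j jn|]; rewrite ?hw ?muL // cL.
have [_ _ _ _ /(_ _ hK) [m [gm lt hm]]] := restIIP g n0.
have muK j : (j < n)%N -> wdeg (wmu j) K = uexp m j.
  by move=> jn; apply: dominant_product_mu.
have umon j : (j < n)%N -> uexp (monII g) j = (j < gs g)%N.
  move=> jn; rewrite uexp_bmon // (bigD1_seq (gs g)) ?iota_uniq //=; last first.
    by rewrite mem_index_iota; lia.
  by rewrite eqxx addn0 mul1n big1 ?addn0 // => t /negbTE ->.
case/mlexltP: lt => [lt|[eu _]].
  apply: msmaller_mu; apply: (lexlt_eql (x := uexp m)) => [j jn|]; first by rewrite muK.
  by apply: lexlt_eqr lt => j jn; rewrite umon ?muL.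
have hj := jump_mu gm (fun j jn => etrans (eu j jn) (umon j jn)) (leq_trans (leq_addr _ _) hn).
have eK j : (j < n)%N -> wdeg (wmu j) K = wdeg (wmu j) L.
  by move=> jn; rewrite muK // eu // umon // muL.
have cK : wdeg wcount K = (0 < run m (gs g))%N.
  rewrite (@whomog_dominant_product n (fun _ i => (0 < i)%N) m K hm) /dpweight (bigD1_seq (gs g)) ?iota_uniq //=; last first.
    by rewrite mem_index_iota; lia.
  rewrite hj ?eqxx; last by lia.
  rewrite big_seq_cond big1 ?addn0 // => t /andP[]; rewrite mem_index_iota => ht /negbTE nt.
  by rewrite hj ?nt.
case: (posnP (run m (gs g))) => r0; first by apply: msmaller_count; rewrite // cK cL r0.
apply: msmaller_alpha; rewrite ?cK ?cL ?r0 //.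
rewrite aL; apply: leq_ltn_trans (alpha_le_dominant_product hm) _.
by rewrite -[run m 0]add0n run_lt.
Qed.

(** With equal u-exponents the drops of m are at s and t. If s = t, or if one of the two runs is
    empty, fewer than two gammas remain. Otherwise no alpha remains, and [run_lt] gives s +
    [run m s] < t <= s + i, so row s decreases. *)
Lemma relIII_smaller g h K : (0 < n)%N -> typeIII g h ->
  K \in msupp ('X_[Uv (inr g) + Uv (inr h)] - relIII g h) ->
  msmaller K (Uv (inr g) + Uv (inr h)).
Proof.
move=> n0 st; have [s0 i0 hs] := gidx_bounds g; have [t0 j0 ht] := gidx_bounds h.
have kn : (gs g + minn (gi g + gi h) (n - gs g) <= n)%N by lia.
set L := (_ + _)%MM.
have eL : lhsIII g h = 'X_[L] by rewrite /lhsIII /Xgamma /Xgen -mpolyXD.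
have hL w0 w : wdeg (wgt w0 w) L = (w (gs g) (gi g) + w (gs h) (gi h))%N.
  by rewrite wdegD !wdegU.
rewrite /relIII eL opprB addrC subrK => /msuppD_le; rewrite mem_cat => /orP[/msuppZ_le hK|hK].
  have hw w0 w : wdeg (wgt w0 w) K = (w (gs h) 0%N + w (gs g) (minn (gi g + gi h) (n - gs g)))%N.
    by move: K hK; apply: whomogM; [apply: whomog_c; lia | apply: whomog_gam].
  apply: msmaller_count => [j jn|]; rewrite hw hL; first by rewrite addnC.
  by rewrite i0 j0 /=; case: (0 < _)%N.
have [_ _ _ _ /(_ _ hK) [m [gm lt hm]]] := restIIIP n0 st.
have muK j : (j < n)%N -> wdeg (wmu j) K = uexp m j.
  by move=> jn; apply: dominant_product_mu.
have umon j : (j < n)%N -> uexp (monIIIg g h) j = ((j < gs g) + (j < gs h))%N.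
  move=> jn; rewrite uexp_redm uexpD uexp_redm uexpD !uexp_imon // addnC.
  by rewrite -[j]/(nat_of_ord (Ordinal jn)) uexpE mnm0E.
case/mlexltP: lt => [lt|[eu la]].
  apply: msmaller_mu; apply: (lexlt_eql (x := uexp m)) => [j jn|]; first by rewrite muK.
  by apply: lexlt_eqr lt => j jn; rewrite umon ?hL.
have eK j : (j < n)%N -> wdeg (wmu j) K = wdeg (wmu j) L.
  by move=> jn; rewrite muK // eu // umon // hL.
have hj r : (0 < r <= n)%N -> jump m r = ((r == gs g) + (r == gs h))%N.
  move=> hr; have e1 : uexp m r.-1 = ((r.-1 < gs g) + (r.-1 < gs h))%N.
    by rewrite eu ?umon //; lia.
  have e2 : uexp m r = ((r < gs g) + (r < gs h))%N.
    case: (ltnP r n) => rn; first by rewrite eu ?umon.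
    rewrite uexp_out //; lia.
  rewrite /jump e1 e2; lia.
have hdp w : (forall s, w s 0%N = 0%N) -> wdeg (wgt 0 w) K =
    (\sum_(1 <= r < n.+1 | (r == gs g) || (r == gs h)) w r (run m r))%N.
  move=> w0; rewrite (@whomog_dominant_product n w m K hm) /dpweight [RHS]big_mkcond /=.
  rewrite big_nat [RHS]big_nat; apply: eq_bigr => r hr; rewrite hj ?w0 ?muln0 ?add0n //.
  by case: (r == gs g); case: (r == gs h).
have hg : gs g \in index_iota 1 n.+1 by rewrite mem_index_iota; lia.
have hh : gs h \in index_iota 1 n.+1 by rewrite mem_index_iota; lia.
have one s (F : nat -> nat) : s \in index_iota 1 n.+1 ->
    (\sum_(1 <= r < n.+1 | pred1 s r) F r = F s)%N.
  by move=> hs'; rewrite -big_filter filter_pred1_uniq ?iota_uniq // big_seq1.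
have cL : wdeg wcount L = 2%N by rewrite hL i0 j0.
case: (eqVneq (gs g) (gs h)) => [e|nst].
  apply: msmaller_count => //; rewrite cL hdp // -e.
  rewrite (eq_bigl (pred1 (gs g))) => [|r]; last by rewrite orbb.
  by rewrite one // ltnS leq_b1.
have cK w : (forall s, w s 0%N = 0%N) -> wdeg (wgt 0 w) K =
    (w (gs g) (run m (gs g)) + w (gs h) (run m (gs h)))%N.
  move=> w0; rewrite hdp // (bigID (pred1 (gs g))) /=; congr (_ + _)%N.
    rewrite (eq_bigl (pred1 (gs g))) ?one // => r.
    by rewrite /= andbC; case: (r =P gs g).
  rewrite (eq_bigl (pred1 (gs h))) ?one // => r /=.
  by case: (r =P gs g) => [->|] /=; rewrite ?(negbTE nst) ?andbT ?andbF.
have slt : (gs g < gs h)%N by move: st nst; rewrite /typeIII; lia.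
have hc : wdeg wcount K = ((0 < run m (gs g)) + (0 < run m (gs h)))%N by rewrite cK.
case: (posnP (run m (gs g))) => r0.
  by apply: msmaller_count; rewrite // cL hc r0 ltnn add0n ltnS leq_b1.
case: (posnP (run m (gs h))) => r0'.
  by apply: msmaller_count; rewrite // cL hc r0' ltnn addn0 ltnS leq_b1.
(* The alpha-exponents of m are lexicographically below those of [monIIIg g h], which begin with a
   zero because s > 0. *)
have a0 : aexp m 0 = 0%N.
  case: la => p [pn hp lp].
  have am q : (q < n)%N -> aexp (monIIIg g h) q =
      (gs g <= q < gs g + minn (gi g + gi h) (n - gs g))%N.
    move=> qn; rewrite aexp_redm aexpD aexp_redm aexpD !aexp_imon //.
    have -> : aexp (0%MM : 'X_{1..n + n}) q = 0%N.
      by rewrite -[q]/(nat_of_ord (Ordinal qn)) aexpE mnm0E.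
    lia.
  rewrite hp ?am //; move: lp; rewrite am //; lia.
have rn0 : run m 0 = 0%N.
  apply/eqP; rewrite eqn0Ngt; apply/negP => h0.
  by have := @run_in n m 0 0 h0; rewrite a0.
apply: (@msmaller_row _ _ (gs g)) => //.
- lia.
- by rewrite hc cL r0 r0'.
- have := alpha_le_dominant_product hm; rewrite rn0 leqn0 => /eqP ->.
  by rewrite hL.
- move=> r rs; rewrite cK ?hL => [|s]; last by rewrite muln0.
  have -> : (gs g == r) = false by lia.
  by have -> : (gs h == r) = false by lia.
rewrite cK ?hL => [|s]; last by rewrite muln0.
rewrite eqxx !mul1n; have -> : (gs h == gs g) = false by lia.
rewrite !mul0n !addn0; have := run_lt slt r0'; move: st; rewrite /typeIII; lia.
Qed.

End Measure.

(** * Admissible monomials span modulo the relations *)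

Section Spanning.
Variable n : nat.
Hypothesis n0 : (0 < n)%N.
Implicit Types (M L K : 'X_{1..ngen n}) (g h : gidx n) (p q : {mpoly rat[ngen n]}).
Implicit Type b : bidx n.

Definition genmon b : 'X_{1..ngen n} :=
  (Ualpha n *+ b.1.1 + \sum_(i < n) Uv (inl (inr i)) *+ b.1.2 i +
   \sum_(g in b.2) Uv (inr g))%MM.

Lemma genmonE b (v : gname n) : genmon b (enum_rank v) =
  match v with
  | inl (inl _) => b.1.1 : nat
  | inl (inr i) => b.1.2 i
  | inr g => (g \in b.2) : nat
  end.
Proof.
have U w : Uv w (enum_rank v) = (w == v).
  by rewrite mnm1E (inj_eq enum_rank_inj).
rewrite !mnmDE mulmnE !mnm_sumE U.
under eq_bigr => i _ do rewrite mulmnE U.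
under [X in (_ + X)%N]eq_bigr => g _ do rewrite U.
case: v U => [[[]|i]|g] U; rewrite ?eqxx /=.
- by rewrite mul1n !big1 ?addn0 // => i _; rewrite mul0n.
- rewrite mul0n add0n (eq_bigr (fun j => (j == i) * b.1.2 j)%N) //.
  rewrite (bigD1 i) //= eqxx mul1n !big1 ?addn0 // => j ne.
  by rewrite (negbTE ne).
rewrite mul0n add0n big1 ?add0n => [|i _]; last by rewrite mul0n.
case: (boolP (g \in b.2)) => hg.
  rewrite (bigD1 g) //= eqxx big1 // => h /andP[_ /negbTE ne].
  by rewrite -[_ == _]/(h == g) ne.
rewrite big1 // => h hh; case: eqP => // -[e]; by rewrite -e hh in hg.
Qed.

Lemma genmonX (A : comNzRingType) b : ('X_[genmon b] : {mpoly A[ngen n]}) =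
  Xalpha A n ^+ b.1.1 * \prod_(i < n) Xgen A (inl (inr i)) ^+ b.1.2 i *
  \prod_(g in b.2) Xgamma A g.
Proof.
rewrite !mpolyXD -mpolyXn -!mprodXE; congr (_ * _ * _).
by apply: eq_bigr => i _; rewrite -mpolyXn.
Qed.

Definition adm_span p := exists (r : seq (bidx n)) (l : bidx n -> rat),
  [/\ uniq r, all (@admissible n) r &
    in_ideal (relsS n) (p - \sum_(b <- r) l b *: 'X_[genmon b])].

Lemma sum_extend (R : nzRingType) (V : lmodType R) (I : eqType) (r s : seq I)
    (l : I -> R) (e : I -> V) : uniq r -> uniq s -> {subset r <= s} ->
  \sum_(b <- s) (if b \in r then l b else 0) *: e b = \sum_(b <- r) l b *: e b.
Proof.
move=> ur us rs; transitivity (\sum_(b <- s | b \in r) l b *: e b).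
  rewrite [RHS]big_mkcond; apply: eq_bigr => b _.
  by case: ifP => //; rewrite scale0r.
rewrite -big_filter; apply: perm_big; apply: uniq_perm => //; first exact: filter_uniq.
by move=> b; rewrite mem_filter andb_idr // => /rs.
Qed.

Lemma adm_span_ideal p : in_ideal (relsS n) p -> adm_span p.
Proof. by move=> hp; exists [::], (fun=> 0); split=> //; rewrite big_nil subr0. Qed.

Lemma adm_spanZ c p : adm_span p -> adm_span (c *: p).
Proof.
case=> r [l [h1 h2 h3]]; exists r, (fun b => c * l b); split=> //.
under eq_bigr => b _ do rewrite -scalerA.
by rewrite -scaler_sumr -scalerBr -mul_mpolyC; apply: in_idealM.
Qed.

Lemma adm_spanD p q : adm_span p -> adm_span q -> adm_span (p + q).
Proof.
case=> r1 [l1 [u1 a1 i1]] [r2 [l2 [u2 a2 i2]]]; set s := undup (r1 ++ r2).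
have us : uniq s by apply: undup_uniq.
have s1 : {subset r1 <= s} by move=> b h; rewrite mem_undup mem_cat h.
have s2 : {subset r2 <= s} by move=> b h; rewrite mem_undup mem_cat h orbT.
exists s, (fun b => (if b \in r1 then l1 b else 0) + (if b \in r2 then l2 b else 0)).
split=> //.
  apply/allP => b; rewrite mem_undup mem_cat => /orP[/(allP a1)|/(allP a2)] //.
under eq_bigr => b _ do rewrite scalerDl.
by rewrite big_split /= !sum_extend // opprD addrACA; apply: in_idealD.
Qed.

Lemma adm_span_sum (I : Type) (r : seq I) (F : I -> {mpoly rat[ngen n]}) :
  (forall i, adm_span (F i)) -> adm_span (\sum_(i <- r) F i).
Proof.
move=> h; elim/big_ind: _ => // [|p q]; last exact: adm_spanD.
exact/adm_span_ideal/in_ideal0.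
Qed.

Lemma genmon_ex M : (M (enum_rank (inl (inl tt) : gname n)) <= n)%N ->
  (forall g, (M (enum_rank (inr g : gname n)) <= 1)%N) ->
  exists b, [/\ genmon b = M, b.1.1 = M (enum_rank (inl (inl tt) : gname n)) :> nat &
    forall g, (g \in b.2) = (0 < M (enum_rank (inr g : gname n)))%N].
Proof.
move=> ha hg; exists (inord (M (enum_rank (inl (inl tt) : gname n))),
  [multinom M (enum_rank (inl (inr i) : gname n)) | i < n],
  [set g | 0 < M (enum_rank (inr g : gname n))]%N).
split=> [||g]; rewrite ?inE //=; last by rewrite inordK.
apply/mnmP => k; rewrite -(enum_valK k) genmonE /=.
case: (enum_val k) => [[[]|i]|g]; rewrite ?inordK ?mnmE ?inE //.
by have := hg g; case: (M _) => [|[]].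
Qed.

(** One rewriting step: multiplied by the cofactor of L in M, the relation replaces M by monomials
    that stay smaller because [msmaller] is compatible with products. *)
Lemma rels_step r L M : r \in relsS n -> (forall v, (L (enum_rank v) <= M (enum_rank v))%N) ->
  (forall K, K \in msupp ('X_[L] - r) -> msmaller K L) ->
  (forall K, msmaller K M -> adm_span 'X_[K]) -> adm_span 'X_[M].
Proof.
move=> hr hL hsm IH.
have LM : (L <= M)%MM by apply/mnm_lepP => k; rewrite -(enum_valK k).
have eM : M = (M - L + L)%MM by rewrite submK.
have -> : 'X_[M] = 'X_[M - L] * r + 'X_[M - L] * ('X_[L] - r) :> {mpoly rat[ngen n]}.
  by rewrite -mulrDr addrC subrK -mpolyXD -eM.
apply: adm_spanD; first exact/adm_span_ideal/in_idealM/in_ideal_mem.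
rewrite [_ - r]mpolyE mulr_sumr big_seq; elim/big_ind: _ => [|p q|K hK].
- exact/adm_span_ideal/in_ideal0.
- exact: adm_spanD.
rewrite -scalerAr -mpolyXD; apply/adm_spanZ/IH.
by rewrite [X in msmaller _ X]eM; apply/msmallerD/hsm.
Qed.

(** A monomial that is not admissible is divisible by alpha^(n+1), by some alpha^s gamma_{s,i}, or
    by a product gamma_{s,i} gamma_{t,j} with s <= t <= s + i, that is by the left-hand side of a
    relation. *)
Lemma adm_spanX M : adm_span 'X_[M].
Proof.
move: M; apply: (lexlt_ind (f := @meas n) (N := (n + n).+3)) => M IH.
have UE v w : Uv v (enum_rank w) = (v == w) :> nat.
  by rewrite mnm1E (inj_eq enum_rank_inj).
case: (leqP (M (enum_rank (inl (inl tt) : gname n))) n) => ha; last first.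
  apply: (@rels_step (relI n) (Ualpha n *+ n.+1)) => //.
  - by rewrite inE eqxx.
  - move=> v; rewrite mulmnE UE; case: v => [[[]|i]|g]; rewrite ?mul0n //.
    by rewrite eqxx mul1n.
  - by move=> K; apply: relI_smaller.
case: (boolP [exists g, (0 < M (enum_rank (inr g : gname n))) &&
    (gs g <= M (enum_rank (inl (inl tt) : gname n)))]%N) => [/existsP[g /andP[h1 h2]]|hII].
  apply: (@rels_step (relII g) (Ualpha n *+ gs g + Uv (inr g))) => //.
  - rewrite inE mem_cat; apply/orP; right; apply/orP; left.
    by apply/mapP; exists g; rewrite ?mem_enum.
  - move=> v; rewrite mnmDE mulmnE !UE; case: v => [[[]|i]|h]; rewrite ?mul0n //.
      by rewrite eqxx mul1n addn0.
    rewrite add0n; case: eqP => // -[<-] //.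
  - by move=> K; apply: relII_smaller.
have inIII g h : typeIII g h -> relIII g h \in relsS n.
  move=> st; rewrite inE mem_cat; apply/orP; right; apply/orP; right.
  by apply/mapP; exists (g, h); rewrite // mem_filter st mem_enum.
case: (boolP [exists g, 1 < M (enum_rank (inr g : gname n))]%N) => [/existsP[g h1]|hg].
  (* Squares of gammas are the case g = h of type III. *)
  have st : typeIII g g by rewrite /typeIII leqnn leq_addr.
  apply: (@rels_step (relIII g g) (Uv (inr g) + Uv (inr g))) => //.
  - exact: inIII.
  - move=> v; rewrite mnmDE !UE; case: eqP => // <-; exact: h1.
  - by move=> K; apply: relIII_smaller.
case: (boolP [exists g, exists h, [&& 0 < M (enum_rank (inr g : gname n)),
    0 < M (enum_rank (inr h : gname n)), g != h & typeIII g h]]%N) => [|hIII].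
  case/existsP=> g /existsP[h /and4P[h1 h2 ne st]].
  apply: (@rels_step (relIII g h) (Uv (inr g) + Uv (inr h))) => //.
  - exact: inIII.
  - move=> v; rewrite mnmDE !UE; case: eqP => [<-|_].
      by rewrite (_ : (_ == _) = false) ?addn0 //; apply/eqP => -[e]; rewrite e eqxx in ne.
    by case: eqP => [<-|].
  - by move=> K; apply: relIII_smaller.
have hg1 g : (M (enum_rank (inr g : gname n)) <= 1)%N.
  by rewrite leqNgt; apply: contra hg => h; apply/existsP; exists g.
have [b [eb ea eg]] := genmon_ex ha hg1.
exists [:: b], (fun=> 1); split=> //; last first.
  by rewrite big_seq1 scale1r eb subrr; apply: in_ideal0.
rewrite /= andbT; apply/andP; split.
  apply/forallP => g; apply/implyP; rewrite eg ea => h1.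
  rewrite ltnNge; apply: contra hII => h2; apply/existsP; exists g; by rewrite h1.
apply/forallP => g; apply/implyP; rewrite eg => h1.
apply/forallP => h; apply/implyP; rewrite eg => h2; apply/implyP => /andP[ne le].
rewrite ltnNge; apply: contra hIII => le'; apply/existsP; exists g; apply/existsP; exists h.
by rewrite h1 h2 ne /typeIII le.
Qed.

Theorem adm_spanP p : adm_span p.
Proof.
by rewrite [p]mpolyE; apply: adm_span_sum => M; apply/adm_spanZ/adm_spanX.
Qed.

End Spanning.

(** Among the indices with nonzero coefficient, take the one with the greatest monomial: no other
    summand can cancel its dominant term. *)
Lemma top_indep (n : nat) (I : eqType) (r : seq I) (F : I -> {mpoly rat[n + n]})
    (m : I -> 'X_{1..n + n}) (c l : I -> rat) : uniq r ->
  (forall b, b \in r -> top (F b) (m b) (c b) /\ c b != 0) -> {in r &, injective m} ->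
  red (\sum_(b <- r) l b *: F b) = 0 -> forall b, b \in r -> l b = 0.
Proof.
move=> ur ht mi h0 b br; apply/eqP/negPn/negP => lb.
have mx (s : seq I) : s != [::] -> exists2 b0, b0 \in s &
    forall b, b \in s -> m b = m b0 \/ mlexlt (m b) (m b0).
  elim: s => // x s IH _; case: (altP (s =P [::])) => [->|/IH[y ys hy]].
    by exists x => [|z]; rewrite inE ?eqxx // => /eqP ->; left.
  case: (mlexlt_total (m x) (m y)) => h.
  - exists y => [|z]; rewrite inE ?ys ?orbT // => /orP[/eqP ->|/hy//]; by left.
  - exists y => [|z]; rewrite inE ?ys ?orbT // => /orP[/eqP ->|/hy//]; by right.
  - exists x => [|z]; rewrite inE ?eqxx // => /orP[/eqP->|/hy[->|h']]; [by left|by right|].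
    by right; apply: mlexlt_trans h.
have [|b0 hb0 hmax] := mx [seq b <- r | l b != 0].
  apply: contraTneq br => e; have : b \in [seq b <- r | l b != 0] = false by rewrite e.
  by rewrite mem_filter lb => /= ->.
move: hb0; rewrite mem_filter => /andP[lb0 b0r].
have [[tc _] c0] := ht _ b0r.
have : (red (\sum_(b <- r) l b *: F b))@_(m b0) = 0 by rewrite h0 mcoeff0.
rewrite (raddf_sum (@red n)) (raddf_sum (mcoeff (m b0))) /= (bigD1_seq b0) //=.
rewrite big_seq_cond big1 ?addr0; last first.
  move=> b1 /andP[b1r ne]; rewrite redZ mcoeffZ.
  case: (eqVneq (l b1) 0) => [->|lb1]; first by rewrite mul0r.
  have [t1 _] := ht _ b1r.
  have [|e|lt] := hmax b1; first by rewrite mem_filter lb1.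
    by rewrite (mi _ _ b1r b0r e) eqxx in ne.
  by rewrite (top_coef_lt t1 lt) mulr0.
by rewrite redZ mcoeffZ tc => /eqP; rewrite mulf_eq0 (negbTE lb0) (negbTE c0).
Qed.

(** Runs separated by gaps are determined by the positions they cover. If the run of I at s were
    longer, an I'-run covering s could not start earlier, since s - 1 would then be covered by an
    I-run touching s; so it starts at s, and position s + I' s is covered by I but, because of the
    gap, not by I'. *)
Lemma runs_le n (I I' : nat -> nat) :
  (forall s s', (s < s' <= n)%N -> (0 < I s')%N -> (s + I s < s')%N) ->
  (forall s s', (s < s' <= n)%N -> (0 < I' s')%N -> (s + I' s < s')%N) ->
  (forall s, (s <= n)%N -> (s + I s <= n)%N) ->
  (forall j, (j < n)%N -> (exists2 s, (s <= n)%N & (s <= j < s + I s)%N) <->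
     (exists2 s, (s <= n)%N & (s <= j < s + I' s)%N)) ->
  forall s, (s <= n)%N -> (I s <= I' s)%N.
Proof.
move=> H H' In e s sn; rewrite leqNgt; apply/negP => lt.
have Is : (0 < I s)%N by lia.
have hIn := In s sn; have sln : (s < n)%N by lia.
have [t tn ht] : exists2 t, (t <= n)%N & (t <= s < t + I' t)%N.
  by apply/e => //; exists s; lia.
have ets : t = s.
  apply/eqP; rewrite eqn_leq; apply/andP; split; first by lia.
  rewrite leqNgt; apply/negP => ts.
  have [r rn hr] : exists2 r, (r <= n)%N & (r <= s.-1 < r + I r)%N.
    by apply/e; [lia | exists t; lia].
  by have := H r s; lia.
rewrite {t tn}ets in ht.
have [t tn ht'] : exists2 t, (t <= n)%N & (t <= s + I' s < t + I' t)%N.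
  by apply/e; [lia | exists s; lia].
case: (ltngtP t s) => c; last by subst t; lia.
  by have := H' t s; lia.
by have := H' s t; lia.
Qed.

(** * Independence of the admissible monomials *)

Section Independence.
Variable n : nat.
Implicit Types (g h : gidx n) (b : bidx n).

Definition bk b s : nat := (\sum_(i < n | i.+1 == s) b.1.2 i)%N.
(** For admissible b the sum has at most one term: it is the second index of the gamma with first
    index s, and 0 if there is none. *)
Definition bi b s : nat := (\sum_(g in b.2 | gs g == s) gi g)%N.
Definition btop b : 'X_{1..n + n} := bmon n b.1.1 (bk b) (bi b).

Lemma bkE b (i : 'I_n) : bk b i.+1 = b.1.2 i.
Proof. by rewrite /bk (big_pred1 i) // => j; rewrite eqSS. Qed.

Lemma uexp_btop b j : (j < n)%N -> uexp (btop b) j =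
  (bk b j.+1 + (0 < bi b j.+1) + uexp (btop b) j.+1)%N.
Proof.
move=> jn; have h i : uexp (btop b) i = (\sum_(1 <= s < n.+1) (bk b s + (0 < bi b s)) * (i < s))%N.
  case: (ltnP i n) => hi; first exact: uexp_bmon.
  rewrite uexp_out // big_nat big1 // => s hs.
  by rewrite (_ : (i < s)%N = false) ?muln0 //; lia.
rewrite !h; have -> : (bk b j.+1 + (0 < bi b j.+1) =
    \sum_(1 <= s < n.+1) (bk b s + (0 < bi b s)) * (s == j.+1))%N.
  rewrite (bigD1_seq j.+1) ?iota_uniq ?mem_index_iota //= eqxx muln1 big1 ?addn0 //.
  by move=> s /negbTE ->; rewrite muln0.
rewrite -big_split; apply: eq_bigr => s _ /=; rewrite -mulnDr; congr (_ * _)%N; lia.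
Qed.

Section Admissible.
Variable b : bidx n.
Hypothesis adm : admissible b.

Lemma adm_gs_inj : {in b.2 &, injective (@gs n)}.
Proof.
case/andP: adm => _ /forallP h g g' hg hg' e.
apply/eqP/negPn/negP => ne; have /implyP /(_ hg) /forallP /(_ g') := h g.
by move=> /implyP /(_ hg') /implyP; rewrite ne e leqnn => /(_ isT); lia.
Qed.

Lemma biE g : g \in b.2 -> bi b (gs g) = gi g.
Proof.
move=> hg; rewrite /bi (bigD1 g) ?hg ?eqxx //= big1 ?addn0 // => h.
case/andP=> /andP[hh /eqP e] ne.
by rewrite (adm_gs_inj hh hg e) eqxx in ne.
Qed.

Lemma bi_gt0 s : (0 < bi b s)%N -> exists2 g, g \in b.2 & gs g = s.
Proof.
move=> h; have [/existsP[g /andP[h1 /eqP h2]]|/existsPn hn] :=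
  boolP [exists g, (g \in b.2) && (gs g == s)]; first by exists g.
by move: h; rewrite /bi big_pred0 // => g; apply/negbTE.
Qed.

Lemma adm_alpha s : (0 < bi b s)%N -> (b.1.1 < s)%N.
Proof.
case/bi_gt0=> g hg <-; case/andP: adm => /forallP /(_ g) /implyP h _; exact: h.
Qed.

Lemma adm_runs s s' : (s < s')%N -> (0 < bi b s)%N -> (0 < bi b s')%N ->
  (s + bi b s < s')%N.
Proof.
move=> lt /bi_gt0[g hg eg] /bi_gt0[h hh eh]; rewrite -eg biE // -eh.
case/andP: adm => _ /forallP /(_ g) /implyP /(_ hg) /forallP /(_ h) /implyP /(_ hh).
move/implyP; apply; rewrite eg eh ltnW // andbT.
by apply: contraTneq lt => e; rewrite -eg -eh e ltnn.
Qed.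

Lemma adm_bound s : (s <= n)%N -> (s + bi b s <= n)%N.
Proof.
move=> sn; case: (posnP (bi b s)) => [->|/bi_gt0[g hg <-]]; first by rewrite addn0.
by rewrite biE //; case: (gidx_bounds g).
Qed.

Lemma evalR_genmon : evalR 'X_[genmon b] = alphaR n ^+ b.1.1 * gprod n (bk b) (bi b) 1.
Proof.
rewrite genmonX !rmorphM rmorphXn !rmorph_prod /= evalR_alpha -mulrA; congr (_ * _).
rewrite /gprod big_split /=; congr (_ * _).
  rewrite big_add1 big_mkord; apply: eq_bigr => i _.
  rewrite rmorphXn /= bkE evalR_gen /gammaR gamma_elt_s0 //.
rewrite (eq_bigr (fun g => gammaR n (gs g) (gi g))) => [|g _]; last exact: evalR_gamma.
rewrite (partition_big (fun g => (val g).1) (fun s => 0 < s)%N) /=; last first.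
  by move=> g _; case: (gidx_bounds g).
rewrite big_add1 big_mkord big_mkcond big_ord_recl /= mul1r; apply: eq_bigr => s _.
case: posnP => [e0|/bi_gt0[g hg eg]].
  apply: big_pred0 => g; apply/negbTE/negP => /andP[hg /eqP eg].
  have := biE hg; have -> : gs g = s.+1 by rewrite /gs eg.
  by rewrite e0 => e1; case: (gidx_bounds g); rewrite -e1.
have es : (val g).1 == lift ord0 s by rewrite -val_eqE; apply/eqP; exact: eg.
rewrite (bigD1 g) ?hg ?es //= big1 ?mulr1 -?eg ?biE // => h /andP[/andP[hh /eqP eh]].
case/eqP; apply: adm_gs_inj => //; rewrite eg /gs eh //.
Qed.

Lemma top_genmon : top (evalR 'X_[genmon b]) (btop b) (b.1.1)`!%:R.
Proof.
rewrite evalR_genmon; apply: top_alpha_gprod => [|s hs|s hs|s s' hs hs'].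
- by rewrite -ltnS.
- by apply: adm_bound; lia.
- by move=> /adm_alpha /ltnW.
- by move=> h1 h2; apply/ltnW/adm_runs => //; lia.
Qed.

(** Treats alpha^a like gamma_{0,a}, so that the initial run obeys the same separation as the
    others. *)
Definition brun s := if s is 0 then b.1.1 : nat else bi b s.

Lemma brun_sep s s' : (s < s' <= n)%N -> (0 < brun s')%N -> (s + brun s < s')%N.
Proof.
case: s' => // s' hs h'; case: s hs => [|s] hs.
  by rewrite add0n; apply: adm_alpha.
rewrite /brun.
case: (posnP (bi b s.+1)) => [->|h]; first by lia.
by apply: adm_runs => //; lia.
Qed.

Lemma brun_bound s : (s <= n)%N -> (s + brun s <= n)%N.
Proof. by case: s => [|s] sn; [rewrite add0n -ltnS ltn_ord | apply: adm_bound]. Qed.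

Lemma aexp_btop j : (j < n)%N -> aexp (btop b) j != 0%N <->
  exists2 s, (s <= n)%N & (s <= j < s + brun s)%N.
Proof.
move=> jn; rewrite aexp_bmon // eqb0 negbK; split.
  case/orP=> [h|/hasP[s]]; first by exists 0%N.
  by rewrite mem_index_iota => hs h; exists s; [lia | case: s hs h].
case=> -[|s] sn h; apply/orP; [by left|right; apply/hasP; exists s.+1 => //].
by rewrite mem_index_iota.
Qed.

End Admissible.

(** The alpha-exponents determine the runs by [runs_le] used in both directions, hence a and the set
    of gammas; the drops of the u-exponents then give the powers of the c_i. *)
Lemma btop_inj : {in @admissible n &, injective btop}.
Proof.
move=> b b'; rewrite /in_mem /= => hb hb' e.
have eE j : (j < n)%N -> (exists2 s, (s <= n)%N & (s <= j < s + brun b s)%N) <->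
     (exists2 s, (s <= n)%N & (s <= j < s + brun b' s)%N).
  by move=> jn; rewrite -!aexp_btop // e.
have er s : (s <= n)%N -> brun b s = brun b' s.
  move=> sn; apply/eqP; rewrite eqn_leq; apply/andP; split.
    by apply: (runs_le (brun_sep hb) (brun_sep hb') (brun_bound hb)).
  apply: (runs_le (brun_sep hb') (brun_sep hb) (brun_bound hb')) => // j /eE; tauto.
have ei s : (0 < s <= n)%N -> bi b s = bi b' s by case: s => // s h; apply: (er s.+1).
have ek (i : 'I_n) : b.1.2 i = b'.1.2 i.
  have := uexp_btop b (ltn_ord i); rewrite e uexp_btop //.
  rewrite (ei i.+1) ?ltn_ord // !bkE => /addIn /addIn //.
have eS : b.2 = b'.2.
  have sub c c' : admissible c -> admissible c' ->
      (forall s, (0 < s <= n)%N -> bi c s = bi c' s) -> c.2 \subset c'.2.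
    move=> hc hc' ec; apply/subsetP => g hg.
    have [s0 i0 hn] := gidx_bounds g; have hs : (0 < gs g <= n)%N by lia.
    have := biE hc hg; rewrite ec // => eg.
    have [|g' hg' eg'] := @bi_gt0 c' (gs g); first by rewrite eg.
    suff <- : g' = g by [].
    have e1 : (val g').1 = (val g).1 by apply: val_inj; exact: eg'.
    have e2 : (val g').2 = (val g).2.
      by apply: val_inj; rewrite -[LHS]/(gi g') -[RHS]/(gi g) -eg -eg' biE.
    by apply: val_inj; case: (val g') (val g) e1 e2 => [? ?] [? ?] /= -> ->.
  by apply/eqP; rewrite eqEsubset !sub // => s /ei.
have ea : b.1.1 = b'.1.1 by apply: val_inj; exact: (er 0%N).
have ek' : b.1.2 = b'.1.2 by apply/mnmP.
by case: b b' ea ek' eS {e hb hb' eE er ei ek} => [[? ?] ?] [[? ?] ?] /= -> -> ->.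
Qed.

Theorem admissible_free (r : seq (bidx n)) (l : bidx n -> rat) : uniq r ->
  all (@admissible n) r -> red (evalR (\sum_(b <- r) l b *: 'X_[genmon b])) = 0 ->
  forall b, b \in r -> l b = 0.
Proof.
move=> ur ar; rewrite (raddf_sum (@evalR n)) /=.
under eq_bigr => b _ do rewrite evalRZ.
apply: (top_indep (m := btop) (c := fun b => (b.1.1)`!%:R)) => // [b /(allP ar) hb|b b'].
  by split; [exact: top_genmon | rewrite Num.Theory.pnatr_eq0 -lt0n fact_gt0].
by move=> /(allP ar) h /(allP ar) h'; apply: btop_inj.
Qed.

End Independence.

(** * Splitting of AQ into two copies of the rational numbers *)

Section AQEvaluation.

Local Notation hAQ := ('X^2 - 2%:R *: 'X : {poly rat}).

Lemma mk_monic_AQ : mk_monic hAQ = hAQ.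
Proof.
have hm : hAQ \is @monic rat.
  rewrite monicE lead_coefDl ?lead_coefXn // size_polyXn size_polyN.
  by rewrite (leq_ltn_trans (size_scale_leq _ _)) // size_polyX.
have sz : size hAQ = 3%N.
  rewrite size_polyDl size_polyXn // size_polyN.
  by rewrite (leq_ltn_trans (size_scale_leq _ _)) // size_polyX.
by rewrite /mk_monic sz hm.
Qed.

(** Evaluates the reduced representative; multiplicative for the two roots c = 0 and c = 2 of X^2 -
    2X. In the product description x = (2, 0), [aq2] belongs to the nonequivariant factor and [aq0]
    to the fixed points. *)
Definition evAQ (c : rat) (a : AQ) : rat := (val (a : {poly %/ hAQ})).[c].

Lemma evAQ_mod c (p : {poly rat}) : c ^+ 2 = 2%:R * c ->
  evAQ c (in_qpoly hAQ p) = p.[c].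
Proof.
move=> hc; rewrite /evAQ /= mk_monic_AQ.
have hm : hAQ \is @monic rat by rewrite -mk_monic_AQ monic_mk_monic.
rewrite [in RHS](Pdiv.RingMonic.rdivp_eq hm p) hornerD hornerM.
by rewrite [hAQ.[c]](_ : _ = 0) ?mulr0 ?add0r // !hornerE hc subrr.
Qed.

Lemma in_qpoly_val (a : AQ) : in_qpoly hAQ (val (a : {poly %/ hAQ})) = a.
Proof. by apply: val_inj; apply: in_qpoly_small; apply: size_mk_monic. Qed.

Lemma evAQ_zmod c : zmod_morphism (evAQ c).
Proof. by move=> a b; rewrite /evAQ /= hornerD hornerN. Qed.

Lemma evAQ_monoid c : c ^+ 2 = 2%:R * c -> monoid_morphism (evAQ c).
Proof.
move=> hc; split=> [|a b].
  have -> : (1 : AQ) = in_qpoly hAQ 1 by apply: esym (in_qpoly1 hAQ).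
  by rewrite evAQ_mod // hornerC.
rewrite -[a in LHS]in_qpoly_val -[b in LHS]in_qpoly_val.
rewrite -[X in evAQ _ X](in_qpolyM hAQ) evAQ_mod // hornerM.
by [].
Qed.

Definition aq0 : AQ -> rat := evAQ 0.
Definition aq2 : AQ -> rat := evAQ 2%:R.

Fact sq0 : (0 : rat) ^+ 2 = 2%:R * 0. Proof. by rewrite expr0n mulr0. Qed.
Fact sq2 : (2%:R : rat) ^+ 2 = 2%:R * 2%:R. Proof. by []. Qed.

HB.instance Definition _ := GRing.isZmodMorphism.Build AQ rat aq0 (evAQ_zmod 0).
HB.instance Definition _ := GRing.isMonoidMorphism.Build AQ rat aq0 (evAQ_monoid sq0).
HB.instance Definition _ := GRing.isZmodMorphism.Build AQ rat aq2 (evAQ_zmod 2%:R).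
HB.instance Definition _ := GRing.isMonoidMorphism.Build AQ rat aq2 (evAQ_monoid sq2).

Lemma aq0_x : aq0 xA = 0.
Proof. by rewrite /aq0 /xA (evAQ_mod _ sq0) hornerX. Qed.

Lemma aq2_x : aq2 xA = 2%:R.
Proof. by rewrite /aq2 /xA (evAQ_mod _ sq2) hornerX. Qed.

Lemma evAQZ c r (a : AQ) : evAQ c (r *: a) = r * evAQ c a.
Proof. exact: hornerZ. Qed.

Lemma aq0A r : aq0 r%:A = r.
Proof. by rewrite /aq0 evAQZ -/aq0 rmorph1 mulr1. Qed.

Lemma aq2A r : aq2 r%:A = r.
Proof. by rewrite /aq2 evAQZ -/aq2 rmorph1 mulr1. Qed.

Lemma AQ_ext (a b : AQ) : aq0 a = aq0 b -> aq2 a = aq2 b -> a = b.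
Proof.
move=> h0 h2; apply: val_inj => /=.
have sz (d : AQ) : (size (val (d : {poly %/ hAQ})) <= 2)%N.
  rewrite -ltnS; apply: leq_trans (size_mk_monic _) _; rewrite mk_monic_AQ.
  rewrite size_polyDl size_polyXn // size_polyN.
  by rewrite (leq_ltn_trans (size_scale_leq _ _)) // size_polyX.
have ev (d : AQ) c : evAQ c d = (val (d : {poly %/ hAQ}))`_0 + (val (d : {poly %/ hAQ}))`_1 * c.
  rewrite /evAQ (horner_coef_wide _ (sz d)) !big_ord_recl big_ord0 /=.
  by rewrite expr0 mulr1 expr1 addr0.
move: h0 h2; rewrite /aq0 /aq2 !ev !mulr0 !addr0 => e0; rewrite e0 => /addrI.
move/(mulIf (_ : 2%:R != 0 :> rat)) => /(_ isT) e1.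
apply/polyP => -[|[|i]] //.
by rewrite !nth_default // (leq_trans (sz _)).
Qed.

(** The idempotent x/2; its complement [e0A] is y. *)
Definition e2A : AQ := 2%:R^-1 *: xA.
Definition e0A : AQ := 1 - e2A.

Lemma aq0_e2 : aq0 e2A = 0.
Proof. by rewrite /aq0 evAQZ -/aq0 aq0_x mulr0. Qed.

Lemma aq2_e2 : aq2 e2A = 1.
Proof. by rewrite /aq2 evAQZ -/aq2 aq2_x mulVf. Qed.

Lemma aq0_e0 : aq0 e0A = 1.
Proof. by rewrite rmorphB rmorph1 /= aq0_e2 subr0. Qed.

Lemma aq2_e0 : aq2 e0A = 0.
Proof. by rewrite rmorphB rmorph1 /= aq2_e2 subrr. Qed.

Lemma AQ_decomp (a : AQ) : a = e0A * (aq0 a)%:A + e2A * (aq2 a)%:A.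
Proof.
apply: AQ_ext; rewrite rmorphD !rmorphM /= ?aq0_e0 ?aq0_e2 ?aq2_e0 ?aq2_e2.
  by rewrite aq0A mul0r mul1r addr0.
by rewrite !aq2A mul0r mul1r add0r.
Qed.

Lemma aq0_eq0P (a : AQ) : aq0 a = 0 <-> exists b, a = xA * b.
Proof.
split=> [h|[b ->]]; last by rewrite rmorphM /= aq0_x mul0r.
exists ((2%:R^-1 * aq2 a)%:A); apply: AQ_ext.
  by rewrite h rmorphM /= aq0_x mul0r.
by rewrite rmorphM /= aq2_x aq2A mulVKf.
Qed.

End AQEvaluation.

(** * Evaluation morphisms and reduction to the two rational factors *)

Section Evaluation.

Lemma aeval_comp (A A' : comNzRingType) (B : comAlgType A) (C : comAlgType A')
    (f : {rmorphism B -> C}) (phi : {rmorphism A -> A'}) k (h : 'I_k -> B)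
    (h' : 'I_k -> C) (p : {mpoly A[k]}) :
  (forall c, f c%:A = (phi c)%:A) -> (forall i, f (h i) = h' i) ->
  f (aeval h p) = aeval h' (map_mpoly phi p).
Proof.
move=> hc hh; rewrite [p]mpolyE (raddf_sum (map_mpoly phi)) (raddf_sum (aeval h)).
rewrite (raddf_sum (aeval h')) (raddf_sum f) /=; apply: eq_bigr => m _.
rewrite map_mpolyZ map_mpolyX !aevalZ -[_ *: aeval h _]mulr_algl.
rewrite -[_ *: aeval h' _]mulr_algl rmorphM hc; congr (_ * _).
rewrite /aeval !mmapX /mmap1 rmorph_prod; apply: eq_bigr => i _ /=.
by rewrite rmorphXn hh.
Qed.

Lemma map_mpoly_id (A : nzRingType) k (p : {mpoly A[k]}) : map_mpoly idfun p = p.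
Proof. by apply/mpolyP => m; rewrite mcoeff_map_mpoly. Qed.

Lemma aeval_comp_id (A : comNzRingType) (B C : comAlgType A) (f : {rmorphism B -> C})
    k (h : 'I_k -> B) (h' : 'I_k -> C) (p : {mpoly A[k]}) :
  (forall c, f c%:A = c%:A) -> (forall i, f (h i) = h' i) ->
  f (aeval h p) = aeval h' p.
Proof. by move=> hc hh; rewrite (aeval_comp (phi := idfun) _ hc hh) map_mpoly_id. Qed.

Lemma aeval_id (A : comNzRingType) k (p : {mpoly A[k]}) : aeval (fun i => 'X_i) p = p.
Proof.
rewrite [in RHS](mpolyE p) [in LHS](mpolyE p).
rewrite (raddf_sum (aeval _)) /=; apply: eq_bigr => m _; rewrite aevalZ; congr (_ *: _); rewrite [RHS]mpolyXE_id /aeval mmapX; exact: eq_bigr.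
Qed.

(** Telescoping over the variables and their powers. It allows variables to be replaced after
    multiplication by an idempotent: the alpha_i by 0, the generators other than the c_i by 0, the
    alpha_i by the indicator of a set. *)
Lemma in_ideal_aeval (A : comNzRingType) (B : comAlgType A) (s : seq B) (e : B) k
    (h h' : 'I_k -> B) (p : {mpoly A[k]}) :
  (forall i, in_ideal s (e * (h i - h' i))) ->
  in_ideal s (e * (aeval h p - aeval h' p)).
Proof.
move=> hh; rewrite [p]mpolyE (raddf_sum (aeval h)) (raddf_sum (aeval h')).
rewrite -sumrB mulr_sumr.
apply: in_ideal_sum => m _ /=; rewrite !aevalZ -scalerBr -scalerAr -mulr_algl.
apply: in_idealM; rewrite /aeval !mmapX /mmap1.
elim/big_rec2: _ => [|i x y _ IH]; first by rewrite subrr mulr0; apply: in_ideal0.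
have -> : e * (h i ^+ m i * y - h' i ^+ m i * x) =
    h i ^+ m i * (e * (y - x)) + x * (e * (h i ^+ m i - h' i ^+ m i)) by ring.
apply: in_idealD; first exact: in_idealM.
apply: in_idealM; elim: (m i) => [|d IHd].
  by rewrite subrr mulr0; apply: in_ideal0.
have -> : e * (h i ^+ d.+1 - h' i ^+ d.+1) =
    h i * (e * (h i ^+ d - h' i ^+ d)) + h' i ^+ d * (e * (h i - h' i)).
  by rewrite !exprS; ring.
by apply: in_idealD; apply: in_idealM.
Qed.

Lemma gen_elt_rmorph (B C : comNzRingType) n (f : {rmorphism B -> C}) (u a : 'I_n -> B) v :
  f (gen_elt u a v) = gen_elt (fun i => f (u i)) (fun i => f (a i)) v.
Proof.
case: v => [[[]|i]|g] /=.
- exact: rmorph_sum.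
- rewrite rmorph_sum; apply: eq_bigr => M _; exact: rmorph_prod.
rewrite rmorph_sum; apply: eq_bigr => M _; rewrite rmorph_sum; apply: eq_bigr => L _.
by rewrite rmorphM !rmorph_prod.
Qed.

Lemma eq_gen_elt (B : comNzRingType) n (u u' a a' : 'I_n -> B) v :
  u =1 u' -> a =1 a' -> gen_elt u a v = gen_elt u' a' v.
Proof.
move=> eu ea; case: v => [[[]|i]|g] /=.
- by apply: eq_bigr => i _.
- by apply: eq_bigr => M _; apply: eq_bigr => j _.
apply: eq_bigr => M _; apply: eq_bigr => L _.
by congr (_ * _); apply: eq_bigr => j _.
Qed.

End Evaluation.

Lemma mcoeff_lin (A : nzRingType) k (c d : A) (p q : {mpoly A[k]}) m :
  (c *: p + d *: q)@_m = c * p@_m + d * q@_m.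
Proof. by rewrite mcoeffD !mcoeffZ. Qed.

Lemma map_mpolyA (A B : nzRingType) (f : {rmorphism A -> B}) k (c : A) :
  map_mpoly f (c%:A : {mpoly A[k]}) = (f c)%:A.
Proof. by rewrite map_mpolyZ rmorph1. Qed.

Section Splitting.

Definition iotaA k (p : {mpoly rat[k]}) : {mpoly AQ[k]} := map_mpoly (in_alg AQ) p.
HB.instance Definition _ k := GRing.RMorphism.copy (@iotaA k) (map_mpoly (in_alg AQ)).

Lemma iotaAX k (m : 'X_{1..k}) : iotaA 'X_[m] = 'X_[m].
Proof. exact: map_mpolyX. Qed.

Lemma map0_iota k (p : {mpoly rat[k]}) : map_mpoly aq0 (iotaA p) = p.
Proof. apply/mpolyP => m; rewrite !mcoeff_map_mpoly; exact: aq0A. Qed.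

Lemma map2_iota k (p : {mpoly rat[k]}) : map_mpoly aq2 (iotaA p) = p.
Proof. apply/mpolyP => m; rewrite !mcoeff_map_mpoly; exact: aq2A. Qed.

Lemma mcoeff_iota k (p : {mpoly rat[k]}) m : (iotaA p)@_m = (p@_m)%:A.
Proof. exact: mcoeff_map_mpoly. Qed.

Lemma mcoeff_glue k (p q : {mpoly rat[k]}) m :
  (e0A *: iotaA p + e2A *: iotaA q)@_m = e0A * (p@_m)%:A + e2A * (q@_m)%:A.
Proof. by rewrite mcoeff_lin; congr (_ * _ + _ * _); apply: mcoeff_iota. Qed.

Lemma mpolyAQ_decomp k (p : {mpoly AQ[k]}) :
  p = e0A *: iotaA (map_mpoly aq0 p) + e2A *: iotaA (map_mpoly aq2 p).
Proof.
apply/mpolyP => m; apply: etrans (esym (mcoeff_glue _ _ _)).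
rewrite [LHS]AQ_decomp.
by congr (_ * _%:A + _ * _%:A); apply/esym/mcoeff_map_mpoly.
Qed.

Lemma map0_glue k (p q : {mpoly rat[k]}) :
  map_mpoly aq0 (e0A *: iotaA p + e2A *: iotaA q) = p.
Proof.
apply/mpolyP => m; apply: etrans (mcoeff_map_mpoly _ _ _) _ => /=.
rewrite mcoeff_glue (rmorphD aq0) !(rmorphM aq0) /= aq0_e0 aq0_e2.
by rewrite mul1r mul0r addr0 aq0A.
Qed.

Lemma map2_glue k (p q : {mpoly rat[k]}) :
  map_mpoly aq2 (e0A *: iotaA p + e2A *: iotaA q) = q.
Proof.
apply/mpolyP => m; apply: etrans (mcoeff_map_mpoly _ _ _) _ => /=.
rewrite mcoeff_glue (rmorphD aq2) !(rmorphM aq2) /= aq2_e0 aq2_e2.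
by rewrite mul1r mul0r add0r aq2A.
Qed.

Lemma mpolyAQ_ext k (p q : {mpoly AQ[k]}) : map_mpoly aq0 p = map_mpoly aq0 q ->
  map_mpoly aq2 p = map_mpoly aq2 q -> p = q.
Proof. by move=> h0 h2; rewrite (mpolyAQ_decomp p) h0 h2 -mpolyAQ_decomp. Qed.

Variable n : nat.

Definition kill_alpha (A : comNzRingType) (k : 'I_(n + n)) : {mpoly A[n + n]} :=
  if split k is inl i then 'X_(uI i) else 0.

Definition Zalpha (f : {mpoly rat[n + n]}) : {mpoly rat[n + n]} := aeval (kill_alpha rat) f.
HB.instance Definition _ := GRing.RMorphism.copy Zalpha (aeval (kill_alpha rat)).

Lemma ZalphaZ c f : Zalpha (c *: f) = c *: Zalpha f.
Proof. exact: aevalZ. Qed.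

Lemma ZalphaA c : Zalpha c%:A = c%:A.
Proof. by rewrite ZalphaZ rmorph1. Qed.

Lemma act_mpolyA (tau : 'S_n) c : act_mpoly tau (c%:A : {mpoly rat[n + n]}) = c%:A.
Proof. by rewrite act_mpolyZ rmorph1. Qed.

Lemma Zalpha_u i : Zalpha (uR i) = uR i.
Proof. by rewrite /Zalpha /uR aevalX /kill_alpha split_uI. Qed.

Lemma Zalpha_a (i : 'I_n) : Zalpha (aR i) = 0.
Proof. by rewrite /Zalpha /aR aevalX /kill_alpha split_aI. Qed.

Lemma Zalpha_relsR f : in_ideal (relsR n) f -> Zalpha f = 0.
Proof.
move=> hf; have hz q : in_ideal [::] q -> q = 0 :> {mpoly rat[n + n]} by apply: in_ideal_nil.
apply: hz; apply: in_ideal_morph hf => q /mapP[i _ ->].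
by rewrite rmorphB rmorphXn /= Zalpha_a expr0n subrr; apply: in_ideal0.
Qed.

Lemma Zalpha_id f : Zalpha (Zalpha f) = Zalpha f.
Proof.
rewrite {2}/Zalpha; apply: (aeval_comp_id (f := Zalpha)) => [c|k]; first exact: ZalphaA.
rewrite /kill_alpha; case: (split k) => i; [exact: Zalpha_u | exact: rmorph0].
Qed.

Lemma Zalpha_act (tau : 'S_n) f : Zalpha (act_mpoly tau f) = act_mpoly tau (Zalpha f).
Proof.
rewrite [in LHS]/act_mpoly [in RHS]/Zalpha.
rewrite (aeval_comp_id (f := Zalpha) (h' := fun k => Zalpha 'X_(act_var tau k))) //; last first.
  exact: ZalphaA.
rewrite (aeval_comp_id (f := act_mpoly tau) (h' := fun k => Zalpha 'X_(act_var tau k))) //.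
  exact: act_mpolyA.
move=> k; rewrite -(splitK k) /kill_alpha unsplitK; case: (split k) => i /=.
  rewrite -[lshift n i]/(uI i) act_var_u [RHS]Zalpha_u.
  by apply: etrans (act_mpolyX _ tau (uI i)) _; rewrite act_var_u.
by rewrite rmorph0 -[rshift n i]/(aI i) act_var_a [RHS]Zalpha_a.
Qed.

Lemma in_ideal_scale (A : comNzRingType) k (s : seq {mpoly A[k]}) (c : A) p :
  in_ideal s p -> in_ideal s (c *: p).
Proof. by rewrite -mul_mpolyC; apply: in_idealM. Qed.

(** At x = 0 the relations x alpha_i disappear and those of R remain; at x = 2 they read 2 alpha_i =
    0 and kill the alphas. *)
Lemma in_relsTP (p : {mpoly AQ[n + n]}) : in_ideal (relsT n) p <->
  in_ideal (relsR n) (map_mpoly aq0 p) /\ Zalpha (map_mpoly aq2 p) = 0.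
Proof.
split=> [hp|[h0 h2]].
  split.
    apply: in_ideal_morph hp => q; rewrite mem_cat => /orP[] /mapP[i _ ->] /=.
      by rewrite map_mpolyZ /= aq0_x scale0r; apply: in_ideal0.
    rewrite rmorphB rmorphXn /= map_mpolyX; apply: in_ideal_mem.
    by apply/mapP; exists i; rewrite ?mem_enum.
  have hz q : in_ideal [::] q -> q = 0 :> {mpoly rat[n + n]} by apply: in_ideal_nil.
  apply: hz; have : in_ideal [::] ((Zalpha \o map_mpoly aq2) p); last by [].
  apply: in_ideal_morph hp => q; rewrite mem_cat => /orP[] /mapP[i _ ->] /=.
    rewrite map_mpolyZ /= ZalphaZ map_mpolyX [Zalpha _]Zalpha_a scaler0.
    exact: in_ideal0.
  rewrite rmorphB rmorphXn /= map_mpolyX rmorphB rmorphXn /= [Zalpha _]Zalpha_a expr0n subrr.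
  exact: in_ideal0.
rewrite (mpolyAQ_decomp p); apply: in_idealD.
  apply: in_ideal_scale; apply: in_ideal_morph h0 => q /mapP[i _ ->].
  rewrite rmorphB rmorphXn /= iotaAX; apply: in_ideal_mem; rewrite mem_cat.
  by apply/orP; right; apply/mapP; exists i; rewrite ?mem_enum.
set q := map_mpoly aq2 p in h2 *.
have -> : e2A *: iotaA q = e2A%:MP * (aeval (fun k => 'X_k) (iotaA q) -
    aeval (kill_alpha AQ) (iotaA q)).
  rewrite aeval_id -mul_mpolyC -[aeval _ _](_ : iotaA (Zalpha q) = _); last first.
    apply: aeval_comp => [c|k]; first exact: map_mpolyA.
    by rewrite /kill_alpha; case: (split k) => i; [exact: iotaAX | exact: rmorph0].
  by rewrite h2 rmorph0 subr0.
apply: in_ideal_aeval => k; rewrite -(splitK k) /kill_alpha unsplitK.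
case: (split k) => i /=; first by rewrite subrr mulr0; apply: in_ideal0.
rewrite subr0 mul_mpolyC /e2A -[_ *: xA]mulr_algl -scalerA; apply: in_ideal_scale.
apply: in_ideal_mem; rewrite mem_cat; apply/orP; left.
by apply/mapP; exists i; rewrite ?mem_enum.
Qed.

Definition evalA (p : {mpoly AQ[ngen n]}) : {mpoly AQ[n + n]} :=
  aeval (fun k => gen_elt (fun i => 'X_(uI i)) (fun i => 'X_(aI i)) (enum_val k)) p.

Lemma piT_scalar (c : AQ) : piT (c%:A : {mpoly AQ[n + n]}) = c%:A :> HT n.
Proof. by rewrite -[RHS]/(scaleT c 1) /scaleT mulr1 alg_mpolyC. Qed.

Lemma HBU_val_eval (p : {mpoly AQ[ngen n]}) :
  HBU_val (aeval (@genH_fam n) p) = piT (evalA p).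
Proof.
transitivity (aeval (fun k => gen_elt (@uT n) (@aT n) (enum_val k)) p).
  exact: (aeval_comp_id (f := val : {rmorphism HBU n -> HT n})).
apply/esym/aeval_comp_id => [c|k]; first exact: piT_scalar.
exact: gen_elt_rmorph.
Qed.

Lemma map0_evalA p : map_mpoly aq0 (evalA p) = evalR (map_mpoly aq0 p).
Proof.
apply: aeval_comp => [c|k]; first exact: map_mpolyA.
rewrite gen_elt_rmorph; apply: eq_gen_elt => i; exact: map_mpolyX.
Qed.

Lemma map2_evalA p : map_mpoly aq2 (evalA p) = evalR (map_mpoly aq2 p).
Proof.
apply: aeval_comp => [c|k]; first exact: map_mpolyA.
rewrite gen_elt_rmorph; apply: eq_gen_elt => i; exact: map_mpolyX.
Qed.

(** Vanishing in the cohomology becomes two conditions over Q; the presentation, the independence of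
    the c_i and the basis are all tested through it. *)
Lemma eval_genH_eq0 p : aeval (@genH_fam n) p = 0 <->
  red (evalR (map_mpoly aq0 p)) = 0 /\ Zalpha (evalR (map_mpoly aq2 p)) = 0.
Proof.
rewrite red_eq0 -map0_evalA -map2_evalA -in_relsTP.
have -> : in_ideal (relsT n) (evalA p) <-> piT (evalA p) = 0.
  by rewrite -[evalA p]subr0 -piTE rmorph0 subr0.
rewrite -HBU_val_eval; have v0 := rmorph0 (val : {rmorphism HBU n -> HT n}).
by split=> [->|h]; [exact: v0 | apply: val_inj; rewrite v0].
Qed.

End Splitting.

Lemma aevalA (A : comNzRingType) (B : comAlgType A) k (h : 'I_k -> B) c :
  aeval h c%:A = c%:A.
Proof. by rewrite aevalZ rmorph1. Qed.

(** * The presentation and the basis *)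

Section Presentation.
Variable n : nat.
Hypothesis n0 : (0 < n)%N.
Implicit Types (p q : {mpoly rat[ngen n]}) (f : {mpoly rat[n + n]}) (b : bidx n).

(** The same subtraction as in the algorithm, but without homogeneity, which representatives of
    arbitrary classes lack; well-founded induction on the dominant term replaces the count of
    steps. *)
Lemma invariants_spanned f : in_invariantsR f -> exists p, red (evalR p) = red f.
Proof.
move: f; apply: (mlexlt_ind (f := @dominant n)) => f IH hi.
case: (eqVneq (red f) 0) => [->|nz]; first by exists 0; rewrite rmorph0 red0.
have [h1 h2] := dominantP nz; have gm := good_dominant hi nz.
pose p1 := (red f)@_(dominant f) *: dominant_product (dominant f).
have topp : top (evalR p1) (dominant f) (red f)@_(dominant f).
  by rewrite evalRZ -[X in top _ _ X]mulr1; apply/topZ/top_dominant_product.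
have hi' : in_invariantsR (f - evalR p1).
  by apply: invariantsRB => //; apply: invariantsR_evalR.
suff [p2 hp2] : exists p2, red (evalR p2) = red (f - evalR p1).
  by exists (p1 + p2); rewrite rmorphD redD hp2 raddfB addrC subrK.
case: (eqVneq (red (f - evalR p1)) 0) => [->|nz'].
  by exists 0; rewrite rmorph0 red0.
apply: IH hi'; have [h3 _] := dominantP nz'; set m' := dominant _ in h3 *.
have nm : m' != dominant f.
  apply: contraTneq h3 => ->; rewrite -mcoeff_eq0 raddfB /= mcoeffB.
  by case: topp => -> _; rewrite subrr.
move: h3; rewrite raddfB /= => /msuppB_le; rewrite mem_cat => /orP[h3|h3].
  by case: h2 => _ /(_ _ h3) [e|//]; rewrite e eqxx in nm.
by case: topp => _ /(_ _ h3) [e|//]; rewrite e eqxx in nm.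
Qed.

Lemma eval_relsS p : in_ideal (relsS n) p -> red (evalR p) = 0.
Proof.
move=> hp; apply/red_eq0; apply: in_ideal_morph hp => q.
rewrite inE => /orP[/eqP ->|]; last rewrite mem_cat => /orP[] /mapP[x hx ->] /=.
(* The product is (n+1)! sigma_{n+1}(alpha_1, ..., alpha_n), and this sigma is an empty sum. *)
- apply/red_eq0; rewrite relI_prod rmorph_prod.
  under eq_bigr => k _ do rewrite rmorphB rmorph_nat /= evalR_alpha.
  by rewrite red_falling sigmaR_gt // mul0rn.
- have [_ _ _ e _] := restIIP x n0; apply/red_eq0.
  by rewrite /relII opprD addrA !(rmorphB (@evalR n)) raddfB /= e -rmorphB subrr.
have st : typeIII x.1 x.2 by move: hx; rewrite mem_filter => /andP[].
have [_ _ _ e _] := restIIIP n0 st; apply/red_eq0.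
by rewrite /relIII opprD addrA !(rmorphB (@evalR n)) raddfB /= e -rmorphB subrr.
Qed.

(** Modulo the relations p is a combination of admissible monomials, and their independence forces
    all its coefficients to vanish. *)
Lemma relsS_complete p : red (evalR p) = 0 -> in_ideal (relsS n) p.
Proof.
move=> hp; have [r [l [ur ar hr]]] := adm_spanP n0 p.
have h0 := admissible_free ur ar (l := l).
have es : red (evalR (\sum_(b <- r) l b *: 'X_[genmon b])) = 0.
  have := eval_relsS hr; rewrite rmorphB raddfB /= hp sub0r => /eqP.
  by rewrite oppr_eq0 => /eqP.
move: hr; rewrite [X in p - X]big_seq big1 ?subr0 // => b /(h0 es) ->.
by rewrite scale0r.
Qed.

Lemma Zalpha_gen (v : gname n) : Zalpha (evalR (Xgen rat v)) =
  if v is inl (inr _) then evalR (Xgen rat v) else 0.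
Proof.
rewrite evalR_gen gen_elt_rmorph.
rewrite (@eq_gen_elt _ _ _ (@uR n) _ (fun=> 0)) => [|i|i]; first last.
- exact: Zalpha_a.
- exact: Zalpha_u.
case: v => [[[]|i]|g] //=; first by rewrite /alpha_elt big1.
have [_ i0 _] := gidx_bounds g.
rewrite /gamma_elt big1 // => M _; rewrite big1 // => L /andP[/eqP Li _].
have /card_gt0P[l lL] : (0 < #|L|)%N by rewrite Li.
by rewrite [X in _ * X](bigD1 l) //= mul0r mulr0.
Qed.

Definition chernpoly (A : comNzRingType) (q : {mpoly A[n]}) : {mpoly A[ngen n]} :=
  aeval (fun i => Xgen A (inl (inr i))) q.
HB.instance Definition _ A := GRing.RMorphism.copy (@chernpoly A)
  (aeval (fun i => Xgen A (inl (inr i)))).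

Lemma chernpolyE (A : comNzRingType) (q : {mpoly A[n]}) : chernpoly q =
  \sum_(m <- msupp q) q@_m *: 'X_[genmon (ord0, m, set0)].
Proof.
rewrite [in LHS](mpolyE q) (raddf_sum (@chernpoly A)) /=; apply: eq_bigr => m _.
rewrite /chernpoly aevalZ genmonX /= expr0 mul1r big_set0 mulr1; congr (_ *: _).
by rewrite /aeval mmapX.
Qed.

Lemma admissible_chern (m : 'X_{1..n}) : admissible (ord0, m, set0 : {set gidx n}).
Proof. by apply/andP; split; apply/forallP => g; rewrite inE. Qed.

Lemma chern_free (q : {mpoly rat[n]}) : red (evalR (chernpoly q)) = 0 -> q = 0.
Proof.
move=> h; apply/mpolyP => m; rewrite mcoeff0.
case: (boolP (m \in msupp q)) => [hm|]; last exact: memN_msupp_eq0.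
pose r := [seq ((ord0, m, set0) : bidx n) | m <- msupp q].
have ur : uniq r by rewrite map_inj_uniq ?msupp_uniq // => x y [].
have ar : all (@admissible n) r by apply/allP => b /mapP[x _ ->]; apply: admissible_chern.
have := admissible_free (l := fun b => q@_(b.1.2)) ur ar.
rewrite big_map -chernpolyE => /(_ h (ord0, m, set0)) /=; apply.
by apply/mapP; exists m.
Qed.

Definition Kvar (A : comNzRingType) (v : gname n) : {mpoly A[n]} :=
  if v is inl (inr i) then 'X_i else 0.

Definition Kgen (A : comNzRingType) (p : {mpoly A[ngen n]}) : {mpoly A[n]} :=
  aeval (fun k => Kvar A (enum_val k)) p.
HB.instance Definition _ A := GRing.RMorphism.copy (@Kgen A)
  (aeval (fun k => Kvar A (enum_val k))).

Lemma chernpoly_Kvar (A : comNzRingType) v : chernpoly (Kvar A v) =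
  if v is inl (inr _) then Xgen A v else 0.
Proof.
by case: v => [[[]|i]|g]; [exact: rmorph0|exact: aevalX|exact: rmorph0].
Qed.

Lemma chernpoly_Kgen (A : comNzRingType) (p : {mpoly A[ngen n]}) :
  chernpoly (Kgen p) = aeval (fun k => chernpoly (Kvar A (enum_val k))) p.
Proof. by apply: (aeval_comp_id (f := @chernpoly A)) => //; exact: aevalA. Qed.

Lemma Zalpha_eval p : Zalpha (evalR p) = evalR (chernpoly (Kgen p)).
Proof.
rewrite chernpoly_Kgen /evalR.
rewrite (aeval_comp_id (f := @Zalpha n) (h' := fun k => Zalpha (evalR (Xgen rat (enum_val k))))).
- apply/esym/(aeval_comp_id (f := @evalR n)) => [c|k]; first exact: aevalA.
  have h v : evalR (chernpoly (Kvar rat v)) = Zalpha (evalR (Xgen rat v)).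
    by rewrite Zalpha_gen chernpoly_Kvar; case: v => [[[]|i]|g] //; rewrite rmorph0.
  exact: h.
- exact: ZalphaA.
- by move=> k; rewrite evalR_gen.
Qed.

Lemma evalR_chern_red (q : {mpoly rat[n]}) : evalR (chernpoly q) = 0 -> q = 0.
Proof. by move=> h; apply: chern_free; rewrite h red0. Qed.

Lemma eval_genH_iota p : in_ideal (relsS n) p -> aeval (@genH_fam n) (iotaA p) = 0.
Proof.
move=> hp; apply/eval_genH_eq0; rewrite map0_iota map2_iota.
by have e := eval_relsS hp; split=> //; apply/Zalpha_relsR/red_eq0.
Qed.

Lemma eval_rels (P : {mpoly AQ[ngen n]}) : in_ideal (rels n) P ->
  aeval (@genH_fam n) P = 0.
Proof.
have hz (t : HBU n) : in_ideal [::] t -> t = 0 by apply: in_ideal_nil.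
have hx v : (if v is inl (inr _) then false else true) ->
    aeval (@genH_fam n) (xA *: Xgen AQ v) = 0.
  move=> hv; apply/eval_genH_eq0; rewrite !map_mpolyZ /= aq0_x scale0r rmorph0 red0.
  split=> //; rewrite evalRZ ZalphaZ map_mpolyX [Zalpha _]Zalpha_gen.
  by case: v hv => [[]|] //; rewrite scaler0.
move=> hP; apply: hz; apply: in_ideal_morph hP => Q; rewrite inE.
have h0 (t : HBU n) : t = 0 -> in_ideal [::] t by move=> ->; apply: in_ideal0.
case/orP=> [/eqP ->|]; first by apply: h0; exact: (hx (inl (inl tt)) isT).
rewrite mem_cat => /orP[] /mapP[x hx' ->]; apply: h0; first exact: (hx (inr x) isT).
exact/eval_genH_iota/in_ideal_mem.
Qed.

(** The part at [e0A] is [relsS_complete]. At [e2A] the relations x alpha and x gamma allow alpha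
    and the gammas to be replaced by 0; what is left is a polynomial in the c_i, zero by their
    independence. *)
Lemma rels_complete (P : {mpoly AQ[ngen n]}) : aeval (@genH_fam n) P = 0 ->
  in_ideal (rels n) P.
Proof.
move=> /eval_genH_eq0[/relsS_complete h0 h2].
rewrite (mpolyAQ_decomp P); apply: in_idealD.
  apply: in_ideal_scale; apply: in_ideal_morph h0 => q hq; apply: in_ideal_mem.
  rewrite inE mem_cat; apply/orP; right; apply/orP; right.
  by apply/mapP; exists q.
rewrite Zalpha_eval in h2; have e := evalR_chern_red h2.
set q := map_mpoly aq2 P in e *.
have -> : e2A *: iotaA q = e2A%:MP * (aeval (fun k => 'X_k) (iotaA q) -
    aeval (fun k => chernpoly (Kvar AQ (enum_val k))) (iotaA q)).
  rewrite aeval_id -chernpoly_Kgen -[Kgen (iotaA q)](_ : iotaA (Kgen q) = _); last first.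
    apply: aeval_comp => [c|k]; first exact: map_mpolyA.
    have h v : iotaA (Kvar rat v) = Kvar AQ v.
      by case: v => [[[]|i]|g]; [exact: rmorph0|exact: iotaAX|exact: rmorph0].
    exact: h.
  by rewrite e !rmorph0 subr0 mul_mpolyC.
apply: in_ideal_aeval => k.
have hxx v : in_ideal (rels n) (xA *: Xgen AQ v) ->
    in_ideal (rels n) (e2A%:MP * (Xgen AQ v - 0)).
  by rewrite subr0 mul_mpolyC /e2A -[_ *: xA]mulr_algl -scalerA; apply: in_ideal_scale.
have hv v : in_ideal (rels n) (e2A%:MP * (Xgen AQ v - chernpoly (Kvar AQ v))).
  rewrite chernpoly_Kvar; case: v => [[[]|i]|g].
  - by apply/hxx/in_ideal_mem; rewrite inE eqxx.
  - by rewrite subrr mulr0; apply: in_ideal0.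
  - apply/hxx/in_ideal_mem; rewrite inE mem_cat; apply/orP; right; apply/orP; left.
    by apply/mapP; exists g; rewrite ?mem_enum.
by have := hv (enum_val k); rewrite /Xgen enum_valK.
Qed.

(** A representative is invariant only modulo the ideal. By [in_relsTP] its image at x = 0 is
    invariant in R and its image at x = 2 is invariant once the alphas are killed; both are
    expressed in the generators and glued by the idempotents. *)
Lemma genH_generate (t : HBU n) : exists P, aeval (@genH_fam n) P = t.
Proof.
pose Q := generic_quotient.repr (HBU_val t).
have eQ : piT Q = HBU_val t by rewrite piTK.
have hinv (tau : 'S_n) : in_ideal (relsT n) (act_mpoly tau Q - Q).
  by apply/piTE; rewrite -act_piT eQ; have /invariantTP -> := valP t.
have act0 tau : map_mpoly aq0 (act_mpoly tau Q) = act_mpoly tau (map_mpoly aq0 Q).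
  apply: aeval_comp => [c|k]; first exact: map_mpolyA.
  exact: map_mpolyX.
have act2 tau : map_mpoly aq2 (act_mpoly tau Q) = act_mpoly tau (map_mpoly aq2 Q).
  apply: aeval_comp => [c|k]; first exact: map_mpolyA.
  exact: map_mpolyX.
have [|p0 hp0] := @invariants_spanned (map_mpoly aq0 Q).
  move=> tau; have /in_relsTP[+ _] := hinv tau.
  by rewrite rmorphB /= act0 => /red_eqP.
have [|p2 hp2] := @invariants_spanned (Zalpha (map_mpoly aq2 Q)).
  move=> tau; have /in_relsTP[_ +] := hinv tau.
  rewrite rmorphB /= act2 rmorphB /= Zalpha_act => /eqP.
  by rewrite subr_eq0 => /eqP ->.
exists (e0A *: iotaA p0 + e2A *: iotaA p2); apply: val_inj => /=.
rewrite HBU_val_eval -eQ; apply/piTE/in_relsTP.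
rewrite !rmorphB /= map0_evalA map2_evalA map0_glue map2_glue.
split; first exact/red_eqP.
have /red_eqP/Zalpha_relsR := hp2; rewrite rmorphB /= Zalpha_id => ->.
by [].
Qed.

Theorem presentation : presented_by (@genH_fam n) (rels n).
Proof.
split; first exact: genH_generate.
by move=> P; split; [exact: rels_complete | exact: eval_rels].
Qed.

Lemma basis_eltE b : basis_elt b = aeval (@genH_fam n) 'X_[genmon b].
Proof.
have eg v : aeval (@genH_fam n) (Xgen AQ v) = genH v.
  by rewrite /Xgen aevalX /genH_fam enum_rankK.
rewrite genmonX !rmorphM rmorphXn !rmorph_prod /=; congr (_ * _ * _).
- by congr (_ ^+ _); apply/esym/(eg (inl (inl tt))).
- by apply: eq_bigr => i _; rewrite rmorphXn /= eg.
- by apply: eq_bigr => g _; apply/esym/(eg (inr g)).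
Qed.

Lemma aeval_chernH (q : {mpoly AQ[n]}) :
  aeval (@chernH n) q = aeval (@genH_fam n) (chernpoly q).
Proof.
apply/esym/(aeval_comp_id (f := aeval (@genH_fam n))) => [c|i]; first exact: aevalA.
exact: etrans (aevalX _ _) (congr1 (@genH n) (enum_rankK _)).
Qed.

Lemma map0_chernpoly (q : {mpoly AQ[n]}) :
  map_mpoly aq0 (chernpoly q) = chernpoly (map_mpoly aq0 q).
Proof.
apply: aeval_comp => [c|k]; first exact: map_mpolyA.
exact: map_mpolyX.
Qed.

Lemma map2_chernpoly (q : {mpoly AQ[n]}) :
  map_mpoly aq2 (chernpoly q) = chernpoly (map_mpoly aq2 q).
Proof.
apply: aeval_comp => [c|k]; first exact: map_mpolyA.
exact: map_mpolyX.
Qed.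

Lemma Kgen_chernpoly (A : comNzRingType) (q : {mpoly A[n]}) : Kgen (chernpoly q) = q.
Proof.
rewrite -[RHS]aeval_id; apply: (aeval_comp_id (f := @Kgen A)) => [c|i]; first exact: aevalA.
exact: etrans (aevalX _ _) (congr1 (@Kvar A) (enum_rankK _)).
Qed.

Theorem chern_independent : algebraically_independent (@chernH n).
Proof.
move=> q q' e; apply/eqP; rewrite -subr_eq0; apply/eqP.
have : aeval (@chernH n) (q - q') = 0 by rewrite rmorphB /= e subrr.
rewrite aeval_chernH => /eval_genH_eq0; rewrite map0_chernpoly map2_chernpoly.
case=> /chern_free h0; rewrite Zalpha_eval Kgen_chernpoly => /evalR_chern_red h2.
by apply: mpolyAQ_ext; rewrite ?h0 ?h2 rmorph0.
Qed.

End Presentation.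

Section Basis.
Variable n : nat.
Hypothesis n0 : (0 < n)%N.
Implicit Types (p q : {mpoly rat[ngen n]}) (b : bidx n).

Lemma aeval_basis (r : seq (bidx n)) (l : bidx n -> AQ) :
  aeval (@genH_fam n) (\sum_(b <- r) l b *: 'X_[genmon b]) = \sum_(b <- r) l b *: basis_elt b.
Proof.
rewrite (raddf_sum (aeval _)) /=; apply: eq_bigr => b _.
by rewrite aevalZ basis_eltE.
Qed.

Lemma iota_basis p : exists (r : seq (bidx n)) (l : bidx n -> AQ),
  [/\ uniq r, all (@admissible n) r &
      aeval (@genH_fam n) (iotaA p) = \sum_(b <- r) l b *: basis_elt b].
Proof.
have [r [l [ur ar hr]]] := adm_spanP n0 p.
exists r, (fun b => (l b)%:A); split=> //; rewrite -aeval_basis.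
have -> : \sum_(b <- r) (l b)%:A *: 'X_[genmon b] =
    iotaA (\sum_(b <- r) l b *: 'X_[genmon b]) :> {mpoly AQ[ngen n]}.
  rewrite (raddf_sum (@iotaA _)) /=; apply: eq_bigr => b _.
  by rewrite /iotaA map_mpolyZ map_mpolyX.
by apply/eqP; rewrite -subr_eq0 -!rmorphB; apply/eqP/(eval_genH_iota n0).
Qed.

Lemma eval_glue p q : aeval (@genH_fam n) (e0A *: iotaA p + e2A *: iotaA q) =
  e0A *: aeval (@genH_fam n) (iotaA p) + e2A *: aeval (@genH_fam n) (iotaA q).
Proof. by rewrite (rmorphD (aeval _)) /=; congr (_ + _); apply: aevalZ. Qed.

Lemma basis_span (t : HBU n) : exists (r : seq (bidx n)) (l : bidx n -> AQ),
  all (@admissible n) r /\ t = \sum_(b <- r) l b *: basis_elt b.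
Proof.
have [P <-] := genH_generate t.
have [p0 [p2 ->]] : exists p0 p2, P = e0A *: iotaA p0 + e2A *: iotaA p2.
  by exists (map_mpoly aq0 P), (map_mpoly aq2 P); apply: mpolyAQ_decomp.
have [r0 [l0 [u0 a0 h0]]] := iota_basis p0.
have [r2 [l2 [u2 a2 h2]]] := iota_basis p2.
have {h0 h2} e := etrans (eval_glue p0 p2)
  (congr2 (fun x y : HBU n => e0A *: x + e2A *: y) h0 h2).
exists (undup (r0 ++ r2)), (fun b => (if b \in r0 then e0A * l0 b else 0) +
  (if b \in r2 then e2A * l2 b else 0)); split.
  by apply/allP => b; rewrite mem_undup mem_cat => /orP[/(allP a0)|/(allP a2)].
under [RHS]eq_bigr => b _ do rewrite scalerDl.
rewrite [RHS]big_split /=; apply: etrans e _; congr (_ + _); rewrite scaler_sumr.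
  rewrite (sum_extend _ _ u0) ?undup_uniq // => [|b h]; last by rewrite mem_undup mem_cat h.
  by apply: eq_bigr => b _; rewrite scalerA.
rewrite (sum_extend _ _ u2) ?undup_uniq // => [|b h]; last by rewrite mem_undup mem_cat h orbT.
by apply: eq_bigr => b _; rewrite scalerA.
Qed.

Lemma Zalpha_genmon b : Zalpha (evalR 'X_[genmon b]) =
  if pure_chern b then evalR 'X_[genmon b] else 0.
Proof.
rewrite genmonX !rmorphM !rmorphXn !rmorph_prod /=.
rewrite [Zalpha (evalR (Xalpha rat n))](Zalpha_gen (inl (inl tt))).
under eq_bigr => i _ do rewrite !rmorphXn /= (Zalpha_gen (inl (inr i))).
under [X in _ * X]eq_bigr => g _ do rewrite [Zalpha _](Zalpha_gen (inr g)).
rewrite /pure_chern; case: eqP => [->|/eqP a0] /=; last by rewrite expr0n (negbTE a0) !mul0r.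
case: eqP => [->|/eqP/set0Pn[g hg]]; last by rewrite (bigD1 g) //= mul0r mulr0.
rewrite !big_set0; congr (_ * _ * _).
by apply: eq_bigr => i _; rewrite rmorphXn.
Qed.

Lemma map_mpoly_basis (f : {rmorphism AQ -> rat}) (r : seq (bidx n)) (l : bidx n -> AQ) :
  map_mpoly f (\sum_(b <- r) l b *: 'X_[genmon b]) = \sum_(b <- r) f (l b) *: 'X_[genmon b].
Proof.
rewrite (raddf_sum (map_mpoly f)) /=; apply: eq_bigr => b _.
by rewrite map_mpolyZ map_mpolyX.
Qed.

Lemma evalR_genmon_neq0 b : admissible b -> red (evalR 'X_[genmon b]) != 0.
Proof.
move=> hb; apply: top_neq0 (top_genmon hb) _.
by rewrite Num.Theory.pnatr_eq0 -lt0n fact_gt0.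
Qed.

(** In the factor x = 0 every admissible monomial is nonzero; in the factor x = 2 only the monomials
    in the c_i survive. *)
Lemma basis_scale_eq0 b (l : AQ) : admissible b ->
  l *: basis_elt b = 0 <-> aq0 l = 0 /\ (pure_chern b -> aq2 l = 0).
Proof.
move=> hb; rewrite basis_eltE -aevalZ.
have ez (c : rat) f : red f != 0 -> red (c *: f : {mpoly rat[n + n]}) = 0 -> c = 0.
  move=> nz /eqP; rewrite redZ -mul_mpolyC mulf_eq0 (negbTE nz) orbF => /eqP h.
  by apply/eqP; rewrite -(@mpolyC_eq (n + n) rat) h.
have nz := evalR_genmon_neq0 hb.
split=> [/eval_genH_eq0|[h0 h2]].
  rewrite !map_mpolyZ !map_mpolyX !evalRZ ZalphaZ Zalpha_genmon => -[/(ez _ _ nz) h0 h2].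
  split=> // hp; move: h2; rewrite hp => h2.
  by apply: (ez _ _ nz); rewrite h2 red0.
apply/eval_genH_eq0; rewrite !map_mpolyZ !map_mpolyX !evalRZ ZalphaZ Zalpha_genmon /= h0.
rewrite scale0r red0; split=> //; case: ifP => [/h2 ->|_]; by rewrite ?scale0r ?scaler0.
Qed.

Theorem AQ_basis : is_AQ_basis (@admissible n).
Proof.
split; first exact: basis_span.
- move=> r l ur ar; rewrite -aeval_basis => /eval_genH_eq0.
  rewrite (map_mpoly_basis aq0) (map_mpoly_basis aq2) => -[h0 h2] b br.
  have hb := allP ar _ br; apply/(basis_scale_eq0 _ hb); split.
    exact: (admissible_free ur ar h0).
  move=> hp; have uf : uniq [seq b <- r | pure_chern b] by apply: filter_uniq.
  have af : all (@admissible n) [seq b <- r | pure_chern b].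
    by apply/allP => c; rewrite mem_filter => /andP[_ /(allP ar)].
  apply: (admissible_free (l := fun b => aq2 (l b)) uf af); last by rewrite mem_filter hp.
  suff -> : evalR (\sum_(b <- [seq b <- r | pure_chern b]) aq2 (l b) *: 'X_[genmon b]) =
      Zalpha (evalR (\sum_(b <- r) aq2 (l b) *: 'X_[genmon b])) by rewrite h2 red0.
  rewrite !(raddf_sum (@evalR n)) (raddf_sum (@Zalpha n)) /= big_filter big_mkcond.
  apply: eq_bigr => c _; rewrite !evalRZ ZalphaZ Zalpha_genmon.
  by case: ifP; rewrite ?scaler0.
move=> b l hb; split=> [/(basis_scale_eq0 _ hb)[h0 h2]|h].
  case: ifP => [/h2 h2'|_]; last exact/aq0_eq0P.
  by apply: AQ_ext; rewrite ?h0 ?h2' rmorph0.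
apply/(basis_scale_eq0 _ hb); case: ifP h => [hp ->|hp /aq0_eq0P ->]; last by [].
by rewrite !rmorph0.
Qed.

Lemma basis_elt_chern b : basis_elt b =
  aeval (@chernH n) 'X_[b.1.2] * basis_elt ((b.1.1, 0%MM, b.2) : bidx n).
Proof.
rewrite /basis_elt /= [X in _ = _ * (_ * X * _)]big1 ?mulr1 => [|i _]; last by rewrite mnm0E.
rewrite mulrCA mulrA; congr (_ * _ * _).
by rewrite /aeval mmapX.
Qed.

(** Splitting off the powers of the c_i leaves finitely many products of a power of alpha and
    distinct gammas. *)
Theorem chern_finite : finite_over_subalgebra (@chernH n).
Proof.
pose bas (c : 'I_n.+1 * {set gidx n}) : HBU n := basis_elt ((c.1, 0%MM, c.2) : bidx n).
pose cs := enum {: 'I_n.+1 * {set gidx n}}.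
exists [seq bas c | c <- cs] => t.
have [r [l [_ ->]]] := basis_span t.
(* The coefficient of the i-th product collects the Chern monomials of all basis elements that share
   its alpha and gamma part. *)
exists (fun i => \sum_(b <- r | index (b.1.1, b.2) cs == i) l b *: 'X_[b.1.2]).
under [RHS]eq_bigr => i _ do rewrite (raddf_sum (aeval _)) mulr_suml /=.
rewrite (exchange_big_dep predT) //=; apply: eq_bigr => b _.
have hi : (index (b.1.1, b.2) cs < size [seq bas c | c <- cs])%N.
  by rewrite size_map index_mem mem_enum.
rewrite (big_pred1 (Ordinal hi)) => [|i]; last by rewrite /= [LHS]eq_sym.
rewrite /= (nth_map (b.1.1, b.2)) ?index_mem ?mem_enum // nth_index ?mem_enum //.
by rewrite aevalZ -scalerAl [in LHS]basis_elt_chern.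
Qed.

End Basis.

(** * Krull dimension *)

Section AlgebraicDependence.

(** Exponents as lists, so that the first element of a chain can be split off in an induction on its
    length. *)
Fixpoint exps (k D : nat) : seq (seq nat) :=
  if k is k'.+1 then [seq i :: l | i <- iota 0 D, l <- exps k' D] else [:: [::]].

Fixpoint monl (B : comNzRingType) (x : seq B) (l : seq nat) : B :=
  match x, l with x0 :: x', i :: l' => x0 ^+ i * monl x' l' | _, _ => 1 end.

Lemma size_exps k D : size (exps k D) = (D ^ k)%N.
Proof. by elim: k => //= k IH; rewrite size_allpairs size_iota IH expnS. Qed.

Lemma uniq_exps k D : uniq (exps k D).
Proof.
elim: k => //= k IH; apply: allpairs_uniq => //; first exact: iota_uniq.
by move=> [a l] [b l'] _ _ /= [-> ->].
Qed.

Lemma monl_rmorph (B C : comNzRingType) (f : {rmorphism B -> C}) x l :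
  f (monl x l) = monl [seq f y | y <- x] l.
Proof.
elim: x l => [|y x IH] [|i l] /=; rewrite ?rmorph1 //.
by rewrite rmorphM rmorphXn IH.
Qed.

Lemma msize_monl n (x : seq {mpoly rat[n]}) d D l :
  (forall y, y \in x -> (msize y <= d.+1)%N) -> l \in exps (size x) D ->
  (msize (monl x l) <= (size x * (D * d)).+1)%N.
Proof.
have hM (p q : {mpoly rat[n]}) a b : (msize p <= a.+1)%N -> (msize q <= b.+1)%N ->
    (msize (p * q) <= (a + b).+1)%N.
  move=> hp hq; case: (eqVneq p 0) => [->|p0]; first by rewrite mul0r msize0.
  case: (eqVneq q 0) => [->|q0]; first by rewrite mulr0 msize0.
  by rewrite msizeM //; move: (msize p) (msize q) hp hq => u v; lia.
elim: x l => [|y x IH] l hx /=; first by rewrite msize1.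
case/allpairsP=> [[i l'] /= [hi hl ->]]; rewrite mulSn; apply: (hM); last first.
  by apply: IH hl => z hz; apply: hx; rewrite inE hz orbT.
have iD : (i <= D)%N by move: hi; rewrite mem_iota; lia.
apply: leq_trans (_ : (i * d).+1 <= _)%N; last by rewrite ltnS leq_mul2r iD orbT.
elim: i {hi iD} => [|i IHi]; first by rewrite expr0 msize1.
by rewrite exprS mulSn; apply: (hM) => //; apply: hx; rewrite inE eqxx.
Qed.

Lemma alg_dependent n (x : seq {mpoly rat[n]}) : size x = n.+1 ->
  exists D (f : seq nat -> rat), (exists2 l, l \in exps n.+1 D & f l != 0) /\
    \sum_(l <- exps n.+1 D) f l *: monl x l = 0.
Proof.
move=> sx; pose d := \max_(y <- x) msize y.
have hd y : y \in x -> (msize y <= d.+1)%N.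
  by move=> hy; apply: leqW; rewrite /d (big_rem y) //= leq_maxl.
(* The D^(n+1) monomials in x have degree at most W, and W + 1 <= C D. They lie in a space of
   dimension at most (C D)^n = C^n D^n, and D > C^n makes this less than D^(n+1). *)
pose C := (n.+1 * d).+1; pose D := (C ^ n).+1.
pose W := (n.+1 * (D * d))%N.
pose L := exps n.+1 D; pose T := {ffun 'I_n -> 'I_W.+1}.
pose mon (t : T) : 'X_{1..n} := [multinom (t i : nat) | i < n].
pose A : 'M[rat]_(size L, #|{: T}|) :=
  \matrix_(i, j) (monl x (nth [::] L i))@_(mon (enum_val j)).
have lt : (#|{: T}| < size L)%N.
  rewrite card_ffun !card_ord size_exps.
  apply: (@leq_ltn_trans ((C * D) ^ n)); last first.
    by rewrite expnMn expnS ltn_mul2r expn_gt0 ltnSn.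
  by case: (posnP n) => [->|n0] //; rewrite leq_exp2r // /W /C; lia.
have nz : kermx A != 0.
  rewrite -mxrank_eq0 mxrank_ker -lt0n subn_gt0.
  exact: leq_ltn_trans (rank_leq_col A) lt.
case/rowV0Pn: nz => v /sub_kermxP vA v0.
pose f l := if insub (index l L) is Some i then v 0 i else 0.
have fE (i : 'I_(size L)) : f (nth [::] L i) = v 0 i.
  by rewrite /f index_uniq ?uniq_exps // valK.
exists D, f; split.
  have [i vi] : exists i, v 0 i != 0.
    apply/existsP; apply: contraNT v0 => /existsPn h.
    by apply/eqP/rowP => i; rewrite mxE; apply/eqP/negPn.
  by exists (nth [::] L i); rewrite ?mem_nth // fE.
apply/mpolyP => m; rewrite mcoeff0 -/L (big_nth [::]) big_mkord raddf_sum /=.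
under eq_bigr => i _ do rewrite mcoeffZ fE.
case: (boolP [forall i, m i < W.+1]%N) => [/forallP hm|/forallPn[i]].
  pose t : T := [ffun i => Ordinal (hm i)].
  have := congr1 (fun u : 'rV_#|{: T}| => u 0 (enum_rank t)) vA; rewrite !mxE => {2}<-.
  apply: eq_bigr => i _; rewrite mxE enum_rankK; congr (_ * mcoeff _ _).
  by apply/mnmP => j; rewrite mnmE ffunE.
rewrite -leqNgt => hi; rewrite big1 // => j _.
suff -> : (monl x (nth [::] L j))@_m = 0 by rewrite mulr0.
apply/memN_msupp_eq0/negP => /msize_mdeg_lt hm.
have hl : nth [::] L j \in exps (size x) D by rewrite sx mem_nth.
have := msize_monl hd hl; rewrite sx -/W => hW.
have : (m i <= mdeg m)%N by rewrite mdegE (bigD1 i) //= leq_addr.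
lia.
Qed.

End AlgebraicDependence.

Section Chains.
Variables (B : comNzRingType) (s : {rmorphism rat -> B}).

Lemma prime_expM (I : B -> Prop) a b k : prime_ideal I -> ~ I a -> I (a ^+ k * b) -> I b.
Proof.
case=> _ _ _ _ hp na; elim: k => [|k IH]; first by rewrite mul1r.
by rewrite exprS -mulrA => /hp[].
Qed.

(* A polynomial relation would, after dividing by the lowest power of x_0 and
   reducing modulo I_1, give a relation between the remaining elements. *)
Lemma chain_independent D k (I : nat -> B -> Prop) (x : seq B) (f : seq nat -> rat) :
  size x = k -> prime_chain k I ->
  (forall i, (i < k)%N -> I i.+1 x`_i /\ ~ I i x`_i) ->
  (exists2 l, l \in exps k D & f l != 0) ->
  ~ I 0%N (\sum_(l <- exps k D) s (f l) * monl x l).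
Proof.
elim: k I x f => [|k IH] I x f.
  case: x => // _ [hp _] _ [l]; rewrite inE => /eqP -> nz.
  rewrite big_seq1 mulr1; have [_ _ hM h1 _] := hp 0%N isT => h.
  by case: h1; rewrite -(rmorph1 s) -(mulVf nz) rmorphM; apply: hM.
case: x => // x0 x [sx] [hp hi] hx [l0 hl0 nz0].
pose S i := \sum_(l <- exps k D) s (f (i :: l)) * monl x l.
have -> : \sum_(l <- exps k.+1 D) s (f l) * monl (x0 :: x) l =
    \sum_(0 <= i < D) x0 ^+ i * S i.
  rewrite /= big_allpairs_dep /index_iota subn0; apply: eq_bigr => i _.
  by rewrite mulr_sumr; apply: eq_bigr => l _; rewrite /= mulrCA.
have ex : exists i, (i < D)%N && has (fun l => f (i :: l) != 0) (exps k D).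
  move: hl0 nz0 => /allpairsP[[i l] /= [h1 h2 ->]] nz; exists i.
  by move: h1; rewrite mem_iota add0n /= => ->; apply/hasP; exists l.
case: (ex_minnP ex) => i0 /andP[i0D /hasP[l hl nz]] hmin.
have S0 i : (i < i0)%N -> S i = 0.
  move=> ii0; rewrite /S big_seq big1 // => l' hl'.
  suff -> : f (i :: l') = 0 by rewrite rmorph0 mul0r.
  apply/eqP/negPn/negP => nz'; have : (i0 <= i)%N; last by rewrite leqNgt ii0.
  by apply: hmin; rewrite (ltn_trans ii0 i0D) /=; apply/hasP; exists l'.
pose Q := \sum_(i0.+1 <= i < D) x0 ^+ (i - i0.+1) * S i.
have -> : \sum_(0 <= i < D) x0 ^+ i * S i = x0 ^+ i0 * (S i0 + x0 * Q).
  rewrite (big_cat_nat (n := i0)) ?(ltnW i0D) //= big_nat big1 ?add0r; last first.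
    by move=> i hi'; rewrite S0 ?mulr0.
  rewrite big_ltn // mulrDr; congr (_ + _); rewrite mulrA -exprSr /Q mulr_sumr.
  rewrite big_nat [RHS]big_nat; apply: eq_bigr => i /andP[h1 _].
  by rewrite mulrA -exprD subnKC.
have [hx0 nx0] := hx 0%N isT => h0.
have h1 : I 1%N (S i0 + x0 * Q).
  by case: (hi 0%N isT) => + _; apply; apply: (prime_expM (hp 0%N isT) nx0 h0).
have h2 : I 1%N (S i0).
  have [_ hA hM _ _] := hp 1%N isT.
  have -> : S i0 = S i0 + x0 * Q + (- Q) * x0 by ring.
  by apply: hA; last exact: hM.
apply: (IH (fun i => I i.+1) x (fun l => f (i0 :: l)) sx _ _ _ h2).
- by split=> j hj; [apply: hp | apply: hi].
- by move=> j hj; apply: (hx j.+1).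
- by exists l.
Qed.

End Chains.

(** * Points of the spectrum and chains of primes *)

Section Points.
Variable n : nat.

(* The geometric points of the spectrum: None is the nonequivariant cohomology
   (x = 2), Some E the fixed component on which alpha_i is the indicator of E. *)
Definition ptvar (j : option {set 'I_n}) (k : 'I_(n + n)) : {mpoly rat[n]} :=
  match split k with
  | inl i => 'X_i
  | inr i => if j is Some E then (i \in E)%:R else 0
  end.

Definition ptR (j : option {set 'I_n}) (f : {mpoly rat[n + n]}) : {mpoly rat[n]} :=
  aeval (ptvar j) f.
HB.instance Definition _ j := GRing.RMorphism.copy (ptR j) (aeval (ptvar j)).

Definition ptA (j : option {set 'I_n}) (P : {mpoly AQ[n + n]}) : {mpoly rat[n]} :=
  if j is Some _ then ptR j (map_mpoly aq0 P) else ptR j (map_mpoly aq2 P).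

Lemma ptA_zmod j : zmod_morphism (ptA j).
Proof. by case: j => [E|] P Q; rewrite /ptA !rmorphB. Qed.

Lemma ptA_monoid j : monoid_morphism (ptA j).
Proof. by case: j => [E|]; split=> [|P Q]; rewrite /ptA ?rmorph1 ?rmorphM. Qed.

HB.instance Definition _ j := GRing.isZmodMorphism.Build
  {mpoly AQ[n + n]} {mpoly rat[n]} (ptA j) (ptA_zmod j).
HB.instance Definition _ j := GRing.isMonoidMorphism.Build
  {mpoly AQ[n + n]} {mpoly rat[n]} (ptA j) (ptA_monoid j).

Lemma ptR_a j i : ptR j (aR i) = if j is Some E then (i \in E)%:R else 0.
Proof. by rewrite /ptR /aR aevalX /ptvar split_aI. Qed.

Lemma ptR_u j (i : 'I_n) : ptR j (uR i) = 'X_i.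
Proof. by rewrite /ptR /uR aevalX /ptvar split_uI. Qed.

Lemma ptR_relsR j f : in_ideal (relsR n) f -> ptR j f = 0.
Proof.
have hz (q : {mpoly rat[n]}) : in_ideal [::] q -> q = 0 by apply: in_ideal_nil.
move=> hf; apply: hz; apply: in_ideal_morph hf => q /mapP[i _ ->].
rewrite rmorphB rmorphXn /= -/(aR i) ptR_a.
suff -> : (if j is Some E then (i \in E)%:R else 0) ^+ 2 -
  (if j is Some E then (i \in E)%:R else 0) = 0 :> {mpoly rat[n]} by apply: in_ideal0.
case: j => [E|]; last by rewrite expr0n subrr.
by case: (i \in E); rewrite ?expr1n ?expr0n subrr.
Qed.

Definition embu (q : {mpoly rat[n]}) : {mpoly rat[n + n]} := aeval (@uR n) q.
HB.instance Definition _ := GRing.RMorphism.copy embu (aeval (@uR n)).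

Lemma embu_ptR j f : embu (ptR j f) = aeval (fun k => embu (ptvar j k)) f.
Proof. by apply: (aeval_comp_id (f := embu)) => // c; apply: aevalA. Qed.

Lemma embu_None f : embu (ptR None f) = Zalpha f.
Proof.
rewrite embu_ptR.
rewrite -[RHS](aeval_id) /Zalpha; apply/esym.
rewrite aeval_id; apply: (aeval_comp_id (f := idfun)) => // k.
rewrite /= /kill_alpha /ptvar; case: (split k) => i; last by rewrite rmorph0.
by rewrite /embu aevalX.
Qed.

(** The products [e E] of the alpha_i for i in E and the 1 - alpha_i for the others sum to 1, and
    multiplied by [e E] each alpha_i becomes the indicator of E modulo the relations. *)
Lemma ptR_inj f : (forall E, ptR (Some E) f = 0) -> in_ideal (relsR n) f.
Proof.
move=> h; pose e (E : {set 'I_n}) : {mpoly rat[n + n]} :=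
  \prod_i (if i \in E then aR i else 1 - aR i).
have e1 : \sum_(E : {set 'I_n}) e E = 1.
  have := bigA_distr 1 +%R (@aR n) (fun i => 1 - aR i).
  rewrite big1 => [->|i _]; last exact: subrKC.
  by apply: eq_bigl => E; rewrite inE.
rewrite -[f]mul1r -e1 mulr_suml; apply: in_ideal_sum => E _.
have -> : e E * f = e E * (aeval (fun k => 'X_k) f - aeval (fun k => embu (ptvar (Some E) k)) f).
  by rewrite -embu_ptR h rmorph0 subr0 aeval_id.
apply: in_ideal_aeval => k; rewrite -(splitK k) /ptvar unsplitK.
case: (split k) => i /=.
  by rewrite /embu aevalX subrr mulr0; apply: in_ideal0.
rewrite /e (bigD1 i) //= -mulrA mulrCA; apply: in_idealM.
rewrite -['X_(rshift n i)]/(aR i) rmorph_nat.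
have hr : in_ideal (relsR n) (aR i ^+ 2 - aR i).
  by apply/in_ideal_mem/mapP; exists i; rewrite ?mem_enum.
case: (i \in E); first by rewrite mulrBr mulr1 -expr2.
have -> : (1 - aR i) * (aR i - 0%:R) = (-1) * (aR i ^+ 2 - aR i) by ring.
exact: in_idealM.
Qed.

Lemma ptA_eq0 (P : {mpoly AQ[n + n]}) : (forall j, ptA j P = 0) <-> in_ideal (relsT n) P.
Proof.
rewrite in_relsTP; split=> [h|[h0 h2] [E|]].
- split; first by apply: ptR_inj => E; exact: (h (Some E)).
  by rewrite -embu_None; have := h None; rewrite /ptA => ->; rewrite rmorph0.
- exact: ptR_relsR.
rewrite /ptA; set f := map_mpoly aq2 P in h2 *.
have <- : ptR None (Zalpha f) = ptR None f; last by rewrite h2 rmorph0.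
apply: (aeval_comp_id (f := ptR None)) => [c|k]; first exact: aevalA.
rewrite /kill_alpha /ptvar; case: (split k) => i; first by rewrite [LHS]ptR_u.
by rewrite rmorph0.
Qed.

Definition pt (j : option {set 'I_n}) (t : HBU n) : {mpoly rat[n]} :=
  ptA j (generic_quotient.repr (HBU_val t)).

Lemma ptE j t P : piT P = HBU_val t -> pt j t = ptA j P.
Proof.
move=> e; apply/eqP; rewrite -subr_eq0 -rmorphB; apply/eqP.
move: j; apply/ptA_eq0/piTE; rewrite piTK e //.
Qed.

Lemma pt_zmod j : zmod_morphism (pt j).
Proof.
move=> t t'; rewrite /pt -rmorphB; apply: ptE.
by rewrite rmorphB /= !piTK.
Qed.

Lemma pt_monoid j : monoid_morphism (pt j).
Proof.
split=> [|t t']; first by rewrite (@ptE _ _ 1) ?rmorph1.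
rewrite /pt -rmorphM; apply: ptE.
by rewrite rmorphM /= !piTK.
Qed.

HB.instance Definition _ j := GRing.isZmodMorphism.Build (HBU n) {mpoly rat[n]} (pt j) (pt_zmod j).
HB.instance Definition _ j := GRing.isMonoidMorphism.Build (HBU n) {mpoly rat[n]} (pt j) (pt_monoid j).

Lemma pt_inj (t : HBU n) : (forall j, pt j t = 0) -> t = 0.
Proof.
move=> /ptA_eq0; rewrite -[X in in_ideal _ X]subr0 -piTE piTK rmorph0 => h.
by apply: val_inj; exact: h.
Qed.

Definition sHBU : rat -> HBU n := in_alg (HBU n) \o in_alg AQ.
HB.instance Definition _ := GRing.RMorphism.copy sHBU (in_alg (HBU n) \o in_alg AQ).

Lemma pt_scalar j r : pt j (sHBU r) = r%:A.
Proof.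
have -> : pt j (sHBU r) = ptA j ((r%:A : AQ)%:MP).
  by apply: ptE; rewrite -alg_mpolyC piT_scalar.
by case: j => [E|]; rewrite /ptA map_mpolyC /= ?aq0A ?aq2A /ptR aevalC.
Qed.

(** Otherwise each point j has an element killed by [pt j] but outside I. There are finitely many
    points, and the product of these elements is killed by all of them, hence is 0 by [pt_inj] and
    lies in the prime I. *)
Lemma prime_contains_pt (I : HBU n -> Prop) : prime_ideal I ->
  exists j, forall t, pt j t = 0 -> I t.
Proof.
move=> hI; have [i0 iA iM i1 iP] := hI.
apply: NNPP => no; have hz j : exists z, pt j z = 0 /\ ~ I z.
  apply: NNPP => hj; apply: no; exists j => t ht; apply: NNPP => nt.
  by apply: hj; exists t.
have [z hz' nz] : exists2 z, (forall j, j \in enum {: option {set 'I_n}} -> pt j z = 0) & ~ I z.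
  elim: (enum _) => [|j l [z hz' nz]]; first by exists 1.
  have [w [hw nw]] := hz j; exists (w * z); last by move/iP => [].
  move=> j'; rewrite inE rmorphM /= => /orP[/eqP ->|/hz' ->]; last by rewrite mulr0.
  by rewrite hw mul0r.
by apply: nz; rewrite (pt_inj (t := z)) // => j; rewrite hz' ?mem_enum.
Qed.

Lemma Krull_upper e (I : nat -> HBU n -> Prop) : prime_chain e I -> (e <= n)%N.
Proof.
move=> [hp hi]; rewrite leqNgt; apply/negP => en.
have [x sx hx] : exists2 x : seq (HBU n), size x = n.+1 &
    forall i, (i < n.+1)%N -> I i.+1 x`_i /\ ~ I i x`_i.
  have : (n.+1 <= e)%N by []; elim: n.+1 => [|k IH] ke; first by exists [::].
  have [x sx hx] := IH (ltnW ke); have [_ [a ha na]] := hi k ke.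
  exists (rcons x a); first by rewrite size_rcons sx.
  move=> i; rewrite ltnS leq_eqVlt nth_rcons sx => /orP[/eqP ->|ik].
    by rewrite ltnn eqxx.
  by rewrite ik; apply: hx.
have [j hj] := prime_contains_pt (hp 0%N isT).
have [|D [f [hf h0]]] := @alg_dependent n [seq pt j y | y <- x].
  by rewrite size_map.
have hc : prime_chain n.+1 I.
  by split=> k hk; [apply: hp; apply: leq_trans en | apply: hi; apply: leq_trans en].
(* The dependence holds only after [pt j]; it becomes membership in [I 0] because [I 0] contains the
   kernel of [pt j]. *)
apply: (chain_independent (s := sHBU) sx hc hx hf); apply: hj.
rewrite rmorph_sum -[RHS]h0; apply: eq_bigr => l _ /=.
by rewrite rmorphM /= pt_scalar monl_rmorph mulr_algl.
Qed.

(* Killing the last k variables of the nonequivariant cohomology. *)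
Definition cutvar k (i : 'I_n) : {mpoly rat[n]} := if (i < n - k)%N then 'X_i else 0.
Definition cut k (q : {mpoly rat[n]}) : {mpoly rat[n]} := aeval (cutvar k) q.
HB.instance Definition _ k := GRing.RMorphism.copy (cut k) (aeval (cutvar k)).

Lemma cutS k q : cut k.+1 (cut k q) = cut k.+1 q.
Proof.
apply: (aeval_comp_id (f := cut k.+1)) => [c|i]; first exact: aevalA.
rewrite /cutvar; case: ifP => h; first exact: aevalX.
by rewrite rmorph0 ifN //; apply: contraFN h; lia.
Qed.

Lemma pt_chern (i : 'I_n) : pt None (chernH i) = chern_elt (fun k : 'I_n => 'X_k) i.+1.
Proof.
pose P : {mpoly AQ[n + n]} := gen_elt (fun i => 'X_(uI i)) (fun i => 'X_(aI i)) (inl (inr i)).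
rewrite (@ptE _ _ P); last by rewrite /P (gen_elt_rmorph (@piT n)).
rewrite /P (gen_elt_rmorph (ptA None)) /=; apply: eq_bigr => M _; apply: eq_bigr => k _.
by rewrite /ptA map_mpolyX [LHS]ptR_u.
Qed.

(** The primes are the kernels of [pt None] followed by [cut k]. The inclusion from k to k + 1 is
    strict at c_{n-k}: each of its monomials involves one of the last k + 1 variables, while u_1 ...
    u_{n-k} survives [cut k]. *)
Lemma Krull_lower : exists I : nat -> HBU n -> Prop, prime_chain n I.
Proof.
exists (fun k t => cut k (pt None t) = 0); split=> k kn.
  split=> [|a b ha hb|a b hb||a b].
  - by rewrite !rmorph0.
  - by rewrite !rmorphD /= ha hb addr0.
  - by rewrite !rmorphM /= hb mulr0.
  - by rewrite !rmorph1 => /eqP; rewrite oner_eq0.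
  - by rewrite !rmorphM /= => /eqP; rewrite mulf_eq0 => /orP[] /eqP; [left|right].
split=> [t ht|]; first by rewrite -cutS ht rmorph0.
have hk : (n - k.+1 < n)%N by lia.
have hs : (n - k.+1).+1 = (n - k)%N by lia.
exists (chernH (Ordinal hk)); rewrite pt_chern /= hs /chern_elt.
  rewrite rmorph_sum big1 // => M /eqP cM; rewrite rmorph_prod /=.
  have [m mM hm] : exists2 m, m \in M & (n - k.+1 <= m)%N.
    apply/exists_inP; apply: contraT => /exists_inPn h.
    have : M \subset itv n 0 (n - k.+1).
      by apply/subsetP => m /h; rewrite inE /= add0n -ltnNge.
    by move/subset_leq_card; rewrite cM card_itv; lia.
  by rewrite (bigD1 m) //= [cut _ _]aevalX /cutvar ltnNge hm mul0r.
(* Setting the surviving variables to 1 turns c_{n-k} into the number of its surviving monomials,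
   which is 1. *)
pose v (q : {mpoly rat[n]}) : rat := (cut k q).@[fun=> 1].
have vX m : v 'X_m = if (m < n - k)%N then 1 else 0.
  by rewrite /v [cut _ _]aevalX /cutvar; case: ifP => _; rewrite ?mevalXU ?meval0.
move/(congr1 (meval (fun=> 1))); rewrite !(rmorph_sum (cut k)) rmorph_sum rmorph0.
have -> : \sum_(M : {set 'I_n} | #|M| == (n - k)%N) (cut k (\prod_(m in M) 'X_m)).@[fun=> 1] =
    \sum_(M : {set 'I_n} | #|M| == (n - k)%N) \prod_(m in M) v 'X_m.
  by apply: eq_bigr => M _; rewrite (rmorph_prod (cut k)) rmorph_prod.
have cI : #|itv n 0 (n - k)| = (n - k)%N by rewrite card_itv // add0n leq_subr.
rewrite (bigD1 (itv n 0 (n - k))) ?cI //= [X in _ + X]big1 ?addr0 => [|M /andP[/eqP cM ne]].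
  rewrite big1 => [/eqP|m]; first by rewrite oner_eq0.
  by rewrite inE /= add0n => hm; rewrite vX hm.
have [m mM hm] : exists2 m, m \in M & (n - k <= m)%N.
  apply/exists_inP; apply: contraT => /exists_inPn h.
  have : M \subset itv n 0 (n - k).
    by apply/subsetP => m /h; rewrite inE /= add0n -ltnNge.
  by move=> sub; case/eqP: ne; apply/eqP; rewrite eqEcard sub cI cM leqnn.
by rewrite (bigD1 m) //= vX ltnNge hm mul0r.
Qed.

Theorem Krull_HBU : Krull_dimension (HBU n) n.
Proof. by split; [exact: Krull_lower | exact: Krull_upper]. Qed.

End Points.

Theorem corollary5p3 (n : nat) (n_gt0 : (0 < n)%N) :
  (* the presentation *)
  presented_by (@genH_fam n) (rels n)
  /\
  (* type I: the two forms of the relation *)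
  relI n = \prod_(k < n.+1) (Xalpha rat n - k%:R)
  /\
  (* type II: the remaining terms *)
  (forall g : gidx n,
     [/\ homogG (gs g) (restII g),
         smallerR (evalR (restII g)) (evalR (leadII g))
       & computes (evalR (lhsII g - coefII g *: leadII g)) (restII g)])
  /\
  (* type III: the remaining terms *)
  (forall g h : gidx n, typeIII g h ->
     [/\ homogG (gs g + gs h) (restIII g h),
         smallerR (evalR (restIII g h)) (evalR (leadIII g h))
       & computes (evalR (lhsIII g h - coefIII g h *: leadIII g h))
                  (restIII g h)])
  /\
  (* the algorithm is correct on all homogeneous invariants *)
  (forall (d : nat) (f : {mpoly rat[n + n]}),
     homogR d f -> in_invariantsR f ->
     exists p, [/\ computes f p, homogG d p & red (evalR p) = red f])
  /\
  (* the Chern classes *)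
  algebraically_independent (@chernH n)
  /\
  finite_over_subalgebra (@chernH n)
  /\
  Krull_dimension (HBU n) n
  /\
  (* the basis *)
  is_AQ_basis (@admissible n).
Proof.
split; first exact: presentation.
split; first exact: relI_prod.
split=> [g|]; first by have [? ? ? _ _] := restIIP g n_gt0.
split=> [g h st|]; first by have [? ? ? _ _] := restIIIP n_gt0 st.
split=> [d f hd hi|].
  by have [p [? ? ? _]] := algorithmP n_gt0 hd hi; exists p.
split; first exact: chern_independent.
split; first exact: chern_finite.
split; first exact: Krull_HBU.
exact: AQ_basis.
Qed.
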